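(* Let $0<\alpha<2$, $d\in\mathbb{N}$, and let $X=\{X_t\}_{t\in\mathbb{R}^d}$ be a mixed moving average, i.e. an S$\alpha$S process with $$\{X_t\}_{t\in\mathbb{R}^d}\stackrel{d}{=}\Big\{\int_{\mathbb{R}^d\times V}f(t+s,v)\,M_\alpha(\mathrm{d}s,\mathrm{d}v)\Big\}_{t\in\mathbb{R}^d},$$ where $M_\alpha$ is an S$\alpha$S random measure on $\mathbb{R}^d\times V$ with control measure $\lambda\times\nu$, $\lambda$ is the Lebesgue measure on $\mathbb{R}^d$, $\nu$ is a probability measure on $(V,\mathcal{B}_V)$, and $f\in L^\alpha(\mathbb{R}^d\times V,\mathcal{B}_{\mathbb{R}^d\times V},\lambda\times\nu)$. Then $X$ is indecomposable if and only if it has a moving average representation $$\{X_t\}_{t\in\mathbb{R}^d}\stackrel{d}{=}\Big\{\int_{\mathbb{R}^d}g(t+s)\,M'_\alpha(\mathrm{d}s)\Big\}_{t\in\mathbb{R}^d}$$ for some $g\in L^\alpha(\mathbb{R}^d,\mathcal{B}_{\mathbb{R}^d},\lambda)$, where $M'_\alpha$ is an S$\alpha$S random measure on $\mathbb{R}^d$ with control measure $\lambda$.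
   Context: A random variable $Z$ is symmetric $\alpha$-stable (S$\alpha$S) if $\mathbb{E}\exp(itZ)=\exp(-\sigma^\alpha|t|^\alpha)$ for all $t\in\mathbb{R}$, for some constant $\sigma\ge 0$ (with $\sigma=0$ the degenerate case). A process is S$\alpha$S if all its finite linear combinations are S$\alpha$S. $\stackrel{d}{=}$ denotes equality of finite-dimensional distributions. Underlying measure spaces $(S,\mathcal{B}_S,\mu)$ (here $\mathbb{R}^d\times V$ and $\mathbb{R}^d$) are standard Lebesgue spaces (standard Borel with a $\sigma$-finite measure) and functions are real-valued. For an S$\alpha$S random measure $M_\alpha$ with control measure $\mu$ and $\{g_t\}\subset L^\alpha(S,\mathcal{B}_S,\mu)$, the process $Y_t=\int_S g_t\,\mathrm{d}M_\alpha$ satisfies $\mathbb{E}\exp(i\sum_{j=1}^m a_jY_{t_j})=\exp(-\int_S|\sum_{j=1}^m a_jg_{t_j}|^\alpha \mathrm{d}\mu)$. A stationary component of a stationary S$\alpha$S process $X$ is any of the processes $X^{(k)}$ in a decomposition $X\stackrel{d}{=}X^{(1)}+\cdots+X^{(n)}$ with $X^{(1)},\dots,X^{(n)}$ independent stationary S$\alpha$S processes. A component is trivial if it is equal in finite-dimensional distributions to a constant multiple of $X$. A stationary S$\alpha$S process is indecomposable if all its stationary components are trivial. *)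

(* Defs.v *)
From HB Require Import structures.
From mathcomp Require Import all_boot all_order all_algebra.
From mathcomp Require Import complex.
From mathcomp Require Import all_classical all_reals all_analysis.

Set Implicit Arguments.
Unset Strict Implicit.
Unset Printing Implicit Defensive.

Import Order.TTheory GRing.Theory Num.Theory.
Import numFieldNormedType.Exports HBSimple.

Local Open Scope classical_set_scope.
Local Open Scope ring_scope.

(* R^d is the library's measurable type of d-tuples (product sigma-algebra of
   the Borel sets of R), which carries no addition or measure of its own. *)
Notation Rd R d := (d.-tuple (measurableTypeR R)).

Definition addRd (R : realType) (d : nat) (t s : Rd R d) : Rd R d :=
  [tuple tnth t i + tnth s i | i < d].

Section lebesgue_measure_cons.
Context (R : realType) (n : nat).
Variable mu : {sigma_finite_measure set (Rd R n) -> \bar R}.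

Definition consRd (p : measurableTypeR R * Rd R n) : Rd R n.+1 :=
  [tuple of p.1 :: p.2].

Lemma measurable_consRd : measurable_fun [set: _] consRd.
Proof. by apply: measurable_cons; [exact: measurable_fst|exact: measurable_snd]. Qed.

Definition lebesgue_cons : set (Rd R n.+1) -> \bar R :=
  pushforward (lebesgue_measure \x mu)%E consRd.

Let lebesgue_cons0 : lebesgue_cons set0 = 0%E.
Proof. by rewrite /lebesgue_cons /pushforward preimage_set0 measure0. Qed.

Let lebesgue_cons_ge0 A : (0 <= lebesgue_cons A)%E.
Proof. by rewrite /lebesgue_cons /pushforward measure_ge0. Qed.

Let lebesgue_cons_sigma_additive : semi_sigma_additive lebesgue_cons.
Proof.
move=> F mF tF mUF; rewrite /lebesgue_cons /pushforward preimage_bigcup.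
have mP (A : set (Rd R n.+1)) : measurable A -> measurable (consRd @^-1` A).
  by move=> mA; rewrite -[X in measurable X]setTI; exact: measurable_consRd.
apply: measure_semi_sigma_additive.
- by move=> k; exact: mP.
- apply/trivIsetP => /= i j _ _ ij; rewrite -preimage_setI.
  by move/trivIsetP : tF => /(_ _ _ _ _ ij) ->//; rewrite preimage_set0.
- by rewrite -preimage_bigcup; exact: mP.
Qed.

HB.instance Definition _ := isMeasure.Build _ _ _ lebesgue_cons
  lebesgue_cons0 lebesgue_cons_ge0 lebesgue_cons_sigma_additive.

Let lebesgue_cons_sigma_finite : sigma_finite setT lebesgue_cons.
Proof.
have /sigma_finiteP[F [TF ndF Foo]] := sigma_finiteT (@lebesgue_measure R).
have /sigma_finiteP[G [TG ndG Goo]] := sigma_finiteT mu.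
pose unc (u : Rd R n.+1) : measurableTypeR R * Rd R n :=
  (tnth u ord0, [tuple of behead u]).
have uncK : cancel consRd unc.
  move=> [x t]; rewrite /unc /consRd /=; congr pair.
  by apply/val_inj.
have munc : measurable_fun [set: _] unc.
  by apply: measurable_fun_pair; [exact: measurable_tnth|exact: measurable_behead].
exists (fun k => unc @^-1` (F k `*` G k)).
  rewrite -preimage_bigcup -[LHS](preimage_setT unc); congr (_ @^-1` _).
  apply/esym; rewrite -subTset => -[x t] _.
  have [k _ Fkx] : (\bigcup_k F k) x by rewrite -TF.
  have [l _ Glt] : (\bigcup_k G k) t by rewrite -TG.
  exists (maxn k l) => //; split => /=.
  - by move: x Fkx; exact/subsetPset/ndF/leq_maxl.
  - by move: t Glt; exact/subsetPset/ndG/leq_maxr.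
move=> k; have [mF Fk] := Foo k; have [mG Gk] := Goo k; split.
  by rewrite -[X in measurable X]setTI; apply: munc => //; exact: measurableX.
rewrite /lebesgue_cons /pushforward -comp_preimage.
rewrite (_ : unc \o consRd = id); last by apply/funext => p; exact: uncK.
by rewrite preimage_id product_measure1E// lte_mul_pinfty// ge0_fin_numE.
Qed.

HB.instance Definition _ := Measure_isSigmaFinite.Build _ _ _ lebesgue_cons
  lebesgue_cons_sigma_finite.

End lebesgue_measure_cons.

Fixpoint lebesgue_Rd (R : realType) (d : nat) :
    {sigma_finite_measure set (Rd R d) -> \bar R} :=
  match d with
  | 0 => \d_([tuple] : Rd R 0)
  | d'.+1 => lebesgue_cons (lebesgue_Rd R d')
  end.

Lemma lebesgue_Rd_rectangle (R : realType) (d : nat)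
    (B : 'I_d -> set (measurableTypeR R)) :
  (forall i, measurable (B i)) ->
  lebesgue_Rd R d [set t | forall i, B i (tnth t i)] =
  (\prod_(i < d) lebesgue_measure (B i))%E.
Proof.
elim: d B => [B _|d IH B mB].
  rewrite big_ord0 /= diracE mem_set//= => -[].
  by move=> ? ?.
rewrite big_ord_recl -IH; last by move=> i; exact: mB.
rewrite /= /lebesgue_cons /pushforward.
rewrite -product_measure1E//; last first.
  rewrite (_ : [set t | _] =
      \bigcap_(i in [set: 'I_d]) ((@tnth d _)^~ i @^-1` B (lift ord0 i))).
    apply: fin_bigcap_measurable => // i _; rewrite -[X in measurable X]setTI.
    exact: measurable_tnth.
  by apply/seteqP; split => t /= h i; [move=> _|]; exact: h.
congr ((_ \x _)%E _); apply/seteqP; split => -[x t] /=.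
  by move=> h; split => [|i]; [exact: (h ord0)|have := h (lift ord0 i); rewrite tnthS].
move=> [h0 h] i; case: (unliftP ord0 i) => [j ->|->] //.
by rewrite tnthS; exact: h.
Qed.

Section probability_notions.
Context (R : realType) (dO : measure_display) (O : measurableType dO).
Variable P : probability O R.

(* t |-> E exp(i t Z), split into real and imaginary parts. *)
Definition charfun (Z : O -> R) (t : R) : R[i] :=
  Complex (\int[P]_w cos (t * Z w)) (\int[P]_w sin (t * Z w)).

Definition SaS (alpha : R) (Z : O -> R) : Prop :=
  exists2 sigma : R, 0 <= sigma &
    forall t, charfun Z t =
      Complex (expR (- (sigma `^ alpha * `|t| `^ alpha))) 0.

Definition SaS_process (T : Type) (alpha : R) (X : T -> {RV P >-> R}) : Prop :=
  forall (n : nat) (a : 'I_n -> R) (t : 'I_n -> T),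
    SaS alpha (fun w => \sum_(j < n) a j * X (t j) w).

(* The families F k are meant to be sigma-algebras; as they contain the whole
   space, the product rule for all n of them covers every subfamily. *)
Definition independent_sigma (n : nat) (F : 'I_n -> set (set O)) : Prop :=
  forall A : 'I_n -> set O, (forall k, F k (A k)) ->
    P (\bigcap_(k in [set: 'I_n]) A k) = (\prod_(k < n) P (A k))%E.

Definition independent_RVs (n : nat) (Z : 'I_n -> {RV P >-> R}) : Prop :=
  independent_sigma (fun k => preimage_set_system [set: O] (Z k) measurable).

Definition process_sigma (T : Type) (X : T -> {RV P >-> R}) : set (set O) :=
  <<s \bigcup_(t in [set: T]) preimage_set_system [set: O] (X t) measurable >>.

Definition independent_processes (T : Type) (n : nat)
    (X : 'I_n -> T -> {RV P >-> R}) : Prop :=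
  independent_sigma (fun k => process_sigma (X k)).

Definition cvg_in_probability (Z : nat -> O -> R) (Y : O -> R) : Prop :=
  forall e : R, 0 < e ->
    P [set w | e <= `|Z n w - Y w|] @[n --> \oo] --> (0 : \bar R).

End probability_notions.

Definition fdd_eq (R : realType) (T : Type)
    (dO : measure_display) (O : measurableType dO) (P : probability O R)
    (X : T -> O -> R)
    (dO' : measure_display) (O' : measurableType dO') (Q : probability O' R)
    (Y : T -> O' -> R) : Prop :=
  forall (n : nat) (t : 'I_n -> T) (B : set (Rd R n)), measurable B ->
    P [set w | B [tuple X (t j) w | j < n]] =
    Q [set w | B [tuple Y (t j) w | j < n]].

Definition stationary (R : realType) (d : nat)
    (dO : measure_display) (O : measurableType dO) (P : probability O R)
    (X : Rd R d -> {RV P >-> R}) : Prop :=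
  forall h : Rd R d, fdd_eq P (fun t => X (addRd t h)) P X.

Section indecomposability.
Context (R : realType) (d : nat) (alpha : R).
Context (dO : measure_display) (O : measurableType dO) (P : probability O R).
Variable X : Rd R d -> {RV P >-> R}.

Definition stationary_decomposition
    (dO' : measure_display) (O' : measurableType dO') (Q : probability O' R)
    (n : nat) (Y : 'I_n -> Rd R d -> {RV Q >-> R}) : Prop :=
  [/\ forall k, SaS_process alpha (Y k),
      forall k, stationary (Y k),
      independent_processes Y
    & fdd_eq P X Q (fun t w => \sum_(k < n) Y k t w)].

Definition stationary_component
    (dO' : measure_display) (O' : measurableType dO') (Q : probability O' R)
    (Z : Rd R d -> {RV Q >-> R}) : Prop :=
  exists (n : nat) (Y : 'I_n -> Rd R d -> {RV Q >-> R}) (k : 'I_n),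
    stationary_decomposition Y /\ Z = Y k.

Definition trivial_component
    (dO' : measure_display) (O' : measurableType dO') (Q : probability O' R)
    (Z : Rd R d -> {RV Q >-> R}) : Prop :=
  exists c : R, fdd_eq Q Z P (fun t w => c * X t w).

Definition indecomposable : Prop :=
  forall (dO' : measure_display) (O' : measurableType dO')
         (Q : probability O' R) (Z : Rd R d -> {RV Q >-> R}),
    stationary_component Z -> trivial_component Z.

End indecomposability.

Section stable_integral.
Context (R : realType) (alpha : R).
Context (dS : measure_display) (S : measurableType dS).
Variable mu : {measure set S -> \bar R}.
Context (dO : measure_display) (O : measurableType dO) (P : probability O R).

Definition finite_measurable (A : set S) : Prop :=
  measurable A /\ (mu A < +oo)%E.

(* The values of M outside finite_measurable are irrelevant. *)
Definition SaS_random_measure (M : set S -> {RV P >-> R}) : Prop :=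
  [/\ forall A, finite_measurable A -> forall t,
        charfun P (M A) t =
        Complex (expR (- (fine (mu A) * `|t| `^ alpha))) 0,
      forall (n : nat) (A : 'I_n -> set S),
        (forall k, finite_measurable (A k)) -> trivIset [set: 'I_n] A ->
        independent_RVs (fun k => M (A k))
    & forall A : nat -> set S,
        (forall k, finite_measurable (A k)) -> trivIset [set: nat] A ->
        finite_measurable (\bigcup_k A k) ->
        {ae P, forall w,
          \sum_(k < n) M (A k) w @[n --> \oo] --> M (\bigcup_k A k) w}].

Definition simple_integral (M : set S -> {RV P >-> R})
    (h : {sfun S >-> measurableTypeR R}) (w : O) : R :=
  \sum_(y \in range h) y * M (h @^-1` [set y]) w.

(* Y is (a version of) the integral of g with respect to M: a limit in
   probability of integrals of simple functions converging to g in L^alpha.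
   A simple function lies in L^alpha iff its nonzero level sets have finite
   measure, and the zero level set contributes 0 to simple_integral. *)
Definition is_stable_integral (M : set S -> {RV P >-> R}) (g : S -> R)
    (Y : {RV P >-> R}) : Prop :=
  g \in Lfun mu alpha%:E /\
  exists h : nat -> {sfun S >-> measurableTypeR R},
    [/\ forall n, (h n : S -> R) \in Lfun mu alpha%:E,
        (\int[mu]_x (`|g x - h n x| `^ alpha)%:E)%E @[n --> \oo]
          --> (0 : \bar R)
      & cvg_in_probability P (fun n => simple_integral M (h n)) Y].

End stable_integral.

Definition integral_representation (R : realType) (alpha : R) (T : Type)
    (dO : measure_display) (O : measurableType dO) (P : probability O R)
    (X : T -> {RV P >-> R})
    (dS : measure_display) (S : measurableType dS)
    (mu : {measure set S -> \bar R}) (g : T -> S -> R) : Prop :=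
  exists (dO' : measure_display) (O' : measurableType dO')
         (Q : probability O' R) (M : set S -> {RV Q >-> R})
         (Y : T -> {RV Q >-> R}),
    [/\ SaS_random_measure alpha mu M,
        forall t, is_stable_integral alpha mu M (g t) (Y t)
      & fdd_eq P X Q Y].

(* Borel isomorphic to a Borel subset of a Polish space. *)
Definition standard_borel (R : realType) (d : measure_display)
    (V : measurableType d) : Prop :=
  exists E : completePseudoMetricType R,
    [/\ hausdorff_space E,
        exists2 D : set E, countable D & dense D
      & exists phi : V -> E,
          [/\ injective phi,
              forall B : set E, <<s open >> B -> measurable (phi @^-1` B)
            & forall A : set V, measurable A -> <<s open >> (phi @` A)]].

(* Main.v *)
From HB Require Import structures.
Require Import Defs.
From mathcomp Require Import all_boot all_order all_algebra.
From mathcomp Require Import complex.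
From mathcomp Require Import all_classical all_reals all_analysis.
From mathcomp Require Import measurable_realfun simple_functions ring lra.

Set Implicit Arguments.
Unset Strict Implicit.
Unset Printing Implicit Defensive.

Import Order.TTheory GRing.Theory Num.Theory.
Import numFieldNormedType.Exports HBSimple HBNNSimple.

Local Open Scope classical_set_scope.
Local Open Scope ring_scope.

(** A symmetric stable process is described by its exponent: the function [N]
    on linear combinations [a] of the coordinates for which
    [E cos (ev a X) = exp (- N a)]. Exponents determine finite-dimensional laws
    ([exponent_fdd_eq]), those of independent processes add
    ([independent_exponent_sum]), multiplying a process by [c] multiplies its
    exponent by [|c|^alpha], and a stable integral of the kernels [g_t] has
    exponent the integral of [|ev a g|^alpha] ([stable_int_exponent]). A
    component of [X] is therefore trivial exactly when its exponent is
    proportional to that of [X].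

    From indecomposability to a moving average. For a measurable set [A] of
    values of the mixing variable [v], the kernels [f 1_A] and [f 1_(~A)] give
    independent stationary components of [X], so the exponent of the first is
    [c_A N]. With [N_v] the exponent of the moving average with kernel
    [f (., v)], this says that [N_v a * N b] and [N a * N_v b] have the same
    integral over every [A], hence agree for almost every [v]. Rational linear
    combinations with rational times are countable and, translations being
    continuous in mean of order [alpha], they determine [N] and [N_v]; so a
    single [v] works for all [a] and [b] ([proportional_section]), and a
    multiple of [f (., v)] is the desired kernel.

    From a moving average to indecomposability. Let [N] be the exponent of the
    moving average with kernel [g], and [N = N_1 + ... + N_n] a decomposition
    into exponents of stationary processes. On cosine polynomials
    [p x = sum_b c_b cos (ev b x)] that vanish at the zero path, put
    [L p = - sum_b c_b N b], and define [L_1] from [N_1] in the same way. These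
    are derivatives at time [0] of expectations of [p] along small multiples of
    the processes, so nonnegative [p] satisfy [0 <= L_1 p <= L p]
    ([generator_ge0]). Because the integral of
    [(1 - cos (e^w y)) e^(- alpha w)] over all real [w] is a multiple of
    [|y|^alpha] ([integral_wave]), [L p] is, up to a constant [C], the integral
    over [(w, s)] of [p] along the path [e^w g (. + s)] with weight
    [e^(- alpha w)]. Approximating absolute values by cosine polynomials gives
    [C * L_1 p <= int |p (e^w g (. + s))| e^(- alpha w) dw ds]
    ([generator_dominated]). Translations of [(w, s)] act on [p] by scaling and
    time shifts, which preserve [L_1]. If [L p = 0], then the integrand has
    integral zero, so suitable averages of its translates tend to zero in mean
    ([mean_zero_averages_out], which is the ergodicity of translations in
    Euclidean space); hence [L_1 p = 0]. Thus [L_1] is proportional to [L], and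
    [N_1] to [N]. *)

(** * Bounded random variables *)

Section bounded_rv.
Context (R : realType) (dO : measure_display) (O : measurableType dO).
Variable P : probability O R.
Implicit Types F G : O -> R.

Definition brv F := measurable_fun [set: O] F /\ exists C, forall w, `|F w| <= C.

Lemma brv_integrable F : brv F -> P.-integrable setT (EFin \o F).
Proof.
move=> [mF [C FC]].
apply: (@le_integrable _ _ _ P setT measurableT _ (EFin \o cst C)) => //.
- exact/measurable_EFinP.
- move=> x _; rewrite /= lee_fin (le_trans (FC x))// ler_norm//.
- exact: finite_measure_integrable_cst.
Qed.

Lemma brv_cst c : brv (cst c).
Proof. by split; [exact: measurable_cst|exists `|c|]. Qed.

Lemma brvD F G : brv F -> brv G -> brv (fun w => F w + G w).
Proof.
move=> [mF [C FC]] [mG [D GD]]; split; first exact: measurable_funD.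
by exists (C + D) => w; rewrite (le_trans (ler_normD _ _))// lerD.
Qed.

Lemma brvM F G : brv F -> brv G -> brv (fun w => F w * G w).
Proof.
move=> [mF [C FC]] [mG [D GD]]; split; first exact: measurable_funM.
by exists (C * D) => w; rewrite normrM ler_pM.
Qed.

Lemma brvZ c F : brv F -> brv (fun w => c * F w).
Proof. by move=> bF; apply: brvM => //; exact: brv_cst. Qed.

Lemma brvB F G : brv F -> brv G -> brv (fun w => F w - G w).
Proof.
move=> bF bG; rewrite (_ : (fun w => _) = fun w => F w + (-1) * G w).
  by apply: brvD => //; exact: brvZ.
by apply/funext => w; rewrite mulN1r.
Qed.

Lemma brv_cos F : measurable_fun setT F -> brv (fun w => cos (F w)).
Proof.
move=> mF; split; last by exists 1 => w; rewrite ler_norml cos_geN1 cos_le1.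
apply: measurableT_comp mF; apply: continuous_measurable_fun; exact: continuous_cos.
Qed.

Lemma brv_sin F : measurable_fun setT F -> brv (fun w => sin (F w)).
Proof.
move=> mF; split; last by exists 1 => w; rewrite ler_norml sin_geN1 sin_le1.
apply: measurableT_comp mF; apply: continuous_measurable_fun; exact: continuous_sin.
Qed.

Lemma brv_indic (A : set O) : measurable A -> brv (\1_A).
Proof.
move=> mA; split; first exact: measurable_indic.
by exists 1 => w; rewrite indicE; case: (_ \in _); rewrite ?normr1 ?normr0.
Qed.

Lemma exp_add F G : brv F -> brv G ->
  \int[P]_w (F w + G w) = \int[P]_w F w + \int[P]_w G w.
Proof. by move=> bF bG; rewrite RintegralD//; exact: brv_integrable. Qed.

Lemma exp_sub F G : brv F -> brv G ->
  \int[P]_w (F w - G w) = \int[P]_w F w - \int[P]_w G w.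
Proof. by move=> bF bG; rewrite RintegralB//; exact: brv_integrable. Qed.

Lemma exp_scale c F : brv F -> \int[P]_w (c * F w) = c * \int[P]_w F w.
Proof. by move=> bF; rewrite RintegralZl//; exact: brv_integrable. Qed.

Lemma exp_cst c : \int[P]_w (cst c) w = c.
Proof.
rewrite (Rintegral_cst P measurableT c) -[RHS]mulr1; congr (_ * _).
by rewrite -[RHS]/(fine 1%:E); congr fine; exact: probability_setT.
Qed.

Lemma exp_le F G : brv F -> brv G -> (forall w, F w <= G w) ->
  \int[P]_w F w <= \int[P]_w G w.
Proof. by move=> bF bG FG; apply: le_Rintegral => //; exact: brv_integrable. Qed.

Lemma exp_indic (A : set O) : measurable A -> \int[P]_w \1_A w = fine (P A).
Proof. by move=> mA; rewrite /Rintegral integral_indic// setIT. Qed.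

Lemma exp_cvg (u : nat -> O -> R) F C :
  (forall n, measurable_fun setT (u n)) -> (forall n w, `|u n w| <= C) ->
  (forall w, u n w @[n --> \oo] --> F w) ->
  brv F /\ (\int[P]_w u n w) @[n --> \oo] --> \int[P]_w F w.
Proof.
move=> mu uC uF.
have mF : measurable_fun setT F by apply: (measurable_fun_cvg mu) => w _; exact: uF.
have FC w : `|F w| <= C.
  have /cvg_lim <- // : `|u n w| @[n --> \oo] --> `|F w| by apply: cvg_norm; exact: uF.
  apply: limr_le; last by apply: nearW => n; exact: uC.
  by apply/cvg_ex; exists `|F w|; apply: cvg_norm; exact: uF.
have bF : brv F by split => //; exists C.
split => //.
have [] := @dominated_convergence _ _ _ P setT measurableT (fun n => EFin \o u n)
  (EFin \o F) (EFin \o cst C).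
- by move=> n; exact/measurable_EFinP.
- exact/measurable_EFinP.
- by apply: aeW => w _; apply: cvg_EFin; [apply: nearW|exact: uF].
- exact: finite_measure_integrable_cst.
- by apply: aeW => w n _; rewrite /= lee_fin.
move=> iF _ h; apply: fine_cvg; rewrite fineK//.
exact: integrable_fin_num.
Qed.

End bounded_rv.

(** * Finite-dimensional laws are determined by characteristic functions *)

Section linear_combinations.
Context (R : realType) (T : Type).

(** A formal linear combination of the coordinates of a path indexed by [T]. *)
Definition lincomb := seq (R * T).

Definition ev (a : lincomb) (x : T -> R) : R := \sum_(p <- a) p.1 * x p.2.

Definition scale (c : R) (a : lincomb) : lincomb := [seq (c * p.1, p.2) | p <- a].

Lemma ev_tnth a x :
  ev a x = \sum_(j < size a) (tnth (in_tuple a) j).1 * x (tnth (in_tuple a) j).2.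
Proof. by rewrite /ev big_tnth. Qed.

Lemma ev_nil x : ev [::] x = 0. Proof. by rewrite /ev big_nil. Qed.

Lemma ev_cons p a x : ev (p :: a) x = p.1 * x p.2 + ev a x.
Proof. by rewrite /ev big_cons. Qed.

Lemma ev_cat a b x : ev (a ++ b) x = ev a x + ev b x.
Proof. by rewrite /ev big_cat. Qed.

Lemma ev_scale c a x : ev (scale c a) x = c * ev a x.
Proof. by rewrite /ev big_map big_distrr; apply: eq_bigr => p _ /=; rewrite mulrA. Qed.

Lemma ev1 t x : ev [:: (1, t)] x = x t.
Proof. by rewrite ev_cons ev_nil mul1r addr0. Qed.

Lemma measurable_ev d (S : measurableType d) (a : lincomb) (G : T -> S -> R) :
  (forall t, measurable_fun setT (G t)) ->
  measurable_fun setT (fun s => ev a (G^~ s)).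
Proof.
move=> mG; apply: measurable_sum => p.
by apply: measurable_funM => //; exact: measurable_cst.
Qed.

End linear_combinations.
Arguments ev {R T}.
Arguments scale {R T}.

Lemma generated_preimage (X Y : Type) (S : set (set X)) (f : X -> Y) (G : set (set Y)) :
  sigma_algebra setT S -> (forall B, G B -> S (f @^-1` B)) ->
  forall B, <<s G >> B -> S (f @^-1` B).
Proof.
move=> [S0 SC SU] GS; apply: smallest_sub => //; split => [|A SA|A SA] /=.
- by rewrite preimage_set0.
- by rewrite setTD preimage_setC -setTD; exact: SC.
- by rewrite preimage_bigcup; exact: SU.
Qed.

Section trigonometric_closure.
Context (R : realType) (T : Type).
Implicit Types (F G : (T -> R) -> R).

Inductive trigpoly : ((T -> R) -> R) -> Prop :=
| trigpoly0 : trigpoly (fun _ => 0)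
| trigpoly_cons c th a F : trigpoly F ->
    trigpoly (fun x => c * cos (th + ev a x) + F x).

(** The bounded pointwise closure of the trigonometric polynomials; it contains
    every bounded cylinder function of the path. *)
Inductive trig_closure : ((T -> R) -> R) -> Prop :=
| trig_closure_poly F : trigpoly F -> trig_closure F
| trig_closure_lim (u : nat -> (T -> R) -> R) F C :
    (forall n, trig_closure (u n)) -> (forall n x, `|u n x| <= C) ->
    (forall x, u n x @[n --> \oo] --> F x) -> trig_closure F.

Lemma trigpoly1 c th a : trigpoly (fun x => c * cos (th + ev a x)).
Proof.
have := @trigpoly_cons c th a _ trigpoly0.
by congr trigpoly; apply/funext => x; rewrite addr0.
Qed.

Lemma trigpolyD F G : trigpoly F -> trigpoly G -> trigpoly (fun x => F x + G x).
Proof.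
elim => [|c th a {}F _ IH] tG; first by under eq_fun do rewrite add0r.
by under eq_fun do rewrite -addrA; apply: trigpoly_cons; exact: IH.
Qed.

Lemma trigpolyM1 c th a F : trigpoly F ->
  trigpoly (fun x => c * cos (th + ev a x) * F x).
Proof.
elim => [|c' th' a' {}F _ IH]; first by under eq_fun do rewrite mulr0; exact: trigpoly0.
under eq_fun do rewrite mulrDr; apply: trigpolyD => //.
rewrite (_ : (fun x => _) = fun x =>
   c * c' / 2 * cos ((th + th') + ev (a ++ a') x) +
   c * c' / 2 * cos ((th - th') + ev (a ++ scale (-1) a') x)).
  by apply: trigpolyD; exact: trigpoly1.
apply/funext => x; rewrite !ev_cat ev_scale.
rewrite (_ : th + th' + _ = (th + ev a x) + (th' + ev a' x)); last by ring.
rewrite (_ : th - th' + _ = (th + ev a x) - (th' + ev a' x)); last by ring.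
move: (th + ev a x) (th' + ev a' x) => u v.
by rewrite cosD cosB; field.
Qed.

Lemma trigpolyM F G : trigpoly F -> trigpoly G -> trigpoly (fun x => F x * G x).
Proof.
elim => [|c th a {}F _ IH] tG; first by under eq_fun do rewrite mul0r; exact: trigpoly0.
under eq_fun do rewrite mulrDl; apply: trigpolyD; last exact: IH.
exact: trigpolyM1.
Qed.

Lemma trigpoly_cst c : trigpoly (fun _ => c).
Proof.
have := trigpoly1 c 0 [::]; congr trigpoly; apply/funext => x.
by rewrite ev_nil addr0 cos0 mulr1.
Qed.

Lemma trigpoly_bounded F : trigpoly F -> exists C, forall x, `|F x| <= C.
Proof.
elim => [|c th a {}F _ [C FC]]; first by exists 0 => x; rewrite normr0.
exists (`|c| + C) => x; rewrite (le_trans (ler_normD _ _))// lerD// normrM.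
by rewrite ler_piMr// ler_norml cos_geN1 cos_le1.
Qed.

Lemma trig_closure_bounded F : trig_closure F -> exists C, forall x, `|F x| <= C.
Proof.
case=> [{}F|u {}F C _ uC uF]; first exact: trigpoly_bounded.
exists C => x; have /cvg_lim <- // : `|u n x| @[n --> \oo] --> `|F x|.
  by apply: cvg_norm; exact: uF.
apply: limr_le; last by apply: nearW => n; exact: uC.
by apply/cvg_ex; exists `|F x|; apply: cvg_norm; exact: uF.
Qed.

Lemma trig_closureD F G : trig_closure F -> trig_closure G ->
  trig_closure (fun x => F x + G x).
Proof.
have H F' G' : trigpoly F' -> trig_closure G' -> trig_closure (fun x => F' x + G' x).
  move=> tF; elim => [G'' tG|u G'' C _ IH uC uG].
    by apply: trig_closure_poly; exact: trigpolyD.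
  have [D FD] := trigpoly_bounded tF.
  apply: (trig_closure_lim IH (C := D + C)) => [n x|x].
    by rewrite (le_trans (ler_normD _ _))// lerD.
  by apply: cvgD; [exact: cvg_cst|exact: uG].
move=> cF cG; elim: cF => [F' tF|u F' C _ IH uC uF]; first exact: H.
have [D GD] := trig_closure_bounded cG.
apply: (trig_closure_lim IH (C := C + D)) => [n x|x].
  by rewrite (le_trans (ler_normD _ _))// lerD.
by apply: cvgD; [exact: uF|exact: cvg_cst].
Qed.

Lemma trig_closureM F G : trig_closure F -> trig_closure G ->
  trig_closure (fun x => F x * G x).
Proof.
have H F' G' : trigpoly F' -> trig_closure G' -> trig_closure (fun x => F' x * G' x).
  move=> tF; elim => [G'' tG|u G'' C _ IH uC uG].
    by apply: trig_closure_poly; exact: trigpolyM.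
  have [D FD] := trigpoly_bounded tF.
  apply: (trig_closure_lim IH (C := D * C)) => [n x|x].
    by rewrite normrM ler_pM.
  by apply: cvgM; [exact: cvg_cst|exact: uG].
move=> cF cG; elim: cF => [F' tF|u F' C _ IH uC uF]; first exact: H.
have [D GD] := trig_closure_bounded cG.
apply: (trig_closure_lim IH (C := C * D)) => [n x|x].
  by rewrite normrM ler_pM.
by apply: cvgM; [exact: uF|exact: cvg_cst].
Qed.

Lemma trig_closure_cst c : trig_closure (fun _ => c).
Proof. exact/trig_closure_poly/trigpoly_cst. Qed.

Lemma trig_closureZ c F : trig_closure F -> trig_closure (fun x => c * F x).
Proof. by apply: trig_closureM; exact: trig_closure_cst. Qed.

Lemma trig_closureB F G : trig_closure F -> trig_closure G ->
  trig_closure (fun x => F x - G x).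
Proof.
move=> cF cG; rewrite (_ : (fun x => _) = fun x => F x + (-1) * G x).
  by apply: trig_closureD => //; exact: trig_closureZ.
by apply/funext => x; rewrite mulN1r.
Qed.

(** A cubic fixing -1, 0 and 1 whose iterates push [-1, 1] away from 0, so that
    they converge to the sign function. *)
Definition signstep (y : R) : R := (3 * y - y ^+ 3) / 2.

Lemma signstep_iter_gt0 n y : 0 < y <= 1 ->
  y <= iter n signstep y <= 1 /\ 1 - iter n signstep y <= (1 - y / 2) ^+ n.
Proof.
move=> /andP[y0 y1]; elim: n => [|n [/andP[]]].
  by rewrite /= lexx y1 expr0; split => //; lra.
rewrite iterS; set z := iter n signstep y; set b := (1 - y / 2) ^+ n => yz z1 IH.
have -> : signstep z = 1 - (1 - z) * ((2 - z - z ^+ 2) / 2) by rewrite /signstep; field.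
have h : 0 <= 1 - z by lra.
have k0 : 0 <= (2 - z - z ^+ 2) / 2.
  by rewrite (_ : _ / 2 = (1 - z) * (2 + z) / 2); [rewrite divr_ge0 ?mulr_ge0//; lra|field].
have k1 : (2 - z - z ^+ 2) / 2 <= 1 - y / 2 by nra.
split; last first.
  by rewrite subKr [X in _ <= X]exprSr ler_pM//.
apply/andP; split; last by rewrite gerBl mulr_ge0.
have : (1 - z) * ((2 - z - z ^+ 2) / 2) <= 1 - z by rewrite ler_piMr//; lra.
by lra.
Qed.

Lemma signstep_iterN n y : iter n signstep (- y) = - iter n signstep y.
Proof. by elim: n => // n IH; rewrite !iterS IH /signstep; field. Qed.

Lemma signstep_iter0 n : iter n signstep 0 = 0.
Proof. by elim: n => // n IH; rewrite !iterS IH /signstep; field. Qed.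

Lemma signstep_iter_bounded n y : `|y| <= 1 -> `|iter n signstep y| <= 1.
Proof.
wlog y0 : y / 0 <= y.
  move=> H; have [|y0] := leP 0 y; first exact: H.
  by rewrite -normrN => y1; rewrite -[y]opprK signstep_iterN normrN; apply: H => //; lra.
rewrite ger0_norm// => y1; move: y0; rewrite le_eqVlt => /predU1P[<-|y0].
  by rewrite signstep_iter0 normr0.
have [] := @signstep_iter_gt0 n y; first by rewrite y0.
by move=> /andP[h1 h2] _; rewrite ger0_norm//; lra.
Qed.

Lemma signstep_iter_cvg y : `|y| <= 1 ->
  iter n signstep y @[n --> \oo] --> (Num.sg y : R).
Proof.
wlog y0 : y / 0 <= y.
  move=> H; have [|y0] := leP 0 y; first exact: H.
  move=> y1; rewrite -[y]opprK sgrN; under eq_fun do rewrite signstep_iterN.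
  by apply: cvgN; apply: H; rewrite ?normrN//; lra.
rewrite ger0_norm// => y1; move: y0; rewrite le_eqVlt => /predU1P[<-|y0].
  by under eq_fun do rewrite signstep_iter0; rewrite sgr0; exact: cvg_cst.
rewrite gtr0_sg//.
have y01 : 0 < y <= 1 by rewrite y0.
apply: (@squeeze_cvgr _ _ _ _ (fun n => 1 - (1 - y / 2) ^+ n) (cst 1)).
- apply: nearW => n; have [/andP[h1 h2] h3] := signstep_iter_gt0 n y01.
  by rewrite /= h2 andbT; lra.
- rewrite -[X in _ --> X]subr0; apply: cvgB; first exact: cvg_cst.
  by apply: cvg_expr; rewrite ger0_norm; lra.
- exact: cvg_cst.
Qed.

Lemma trig_closure_sg F : trig_closure F -> (forall x, `|F x| <= 1) ->
  trig_closure (fun x => Num.sg (F x)).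
Proof.
move=> cF F1.
apply: (@trig_closure_lim (fun n x => iter n signstep (F x)) _ 1).
- elim => // n IH; rewrite /= /signstep.
  rewrite (_ : (fun x => _) = fun x => 3 / 2 * iter n signstep (F x) -
     (1 / 2) * (iter n signstep (F x) * (iter n signstep (F x) * iter n signstep (F x)))).
    by apply: trig_closureB; apply: trig_closureZ => //; do 2 apply: trig_closureM => //.
  by apply/funext => x; field.
- by move=> n x; exact: signstep_iter_bounded.
- by move=> x; exact: signstep_iter_cvg.
Qed.

(** Slowing the sine down makes its sign at any given point that of [y]. *)
Lemma sg_sin_near (y : R) : 
  (Num.sg (sin (n.+1%:R^-1 * y)) : R) @[n --> \oo] --> (Num.sg y : R).
Proof.
wlog y0 : y / 0 <= y.
  move=> H; have [|y0] := leP 0 y; first exact: H.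
  rewrite -[y]opprK sgrN; under eq_fun do rewrite mulrN sinN sgrN.
  by apply: cvgN; apply: H; lra.
move: y0; rewrite le_eqVlt => /predU1P[<-|y0].
  by rewrite sgr0; under eq_fun do rewrite mulr0 sin0 sgr0; exact: cvg_cst.
apply: cvg_near_cst; exists (Num.truncn y) => // n /= yn.
have ny : y < n.+1%:R.
  by rewrite (lt_le_trans (truncnS_gt y))// ler_nat.
have n0 : (0 : R) < n.+1%:R by rewrite ltr0n.
rewrite !gtr0_sg// sin_gt0_pi// mulr_gt0 ?invr_gt0//=.
rewrite mulrC ltr_pdivrMr// (lt_trans ny)// ltr_pMl//.
by rewrite (lt_le_trans _ (pi_ge2 R))// ltr1n.
Qed.

Lemma trig_closure_gt t (b : R) : trig_closure (fun x => \1_(`]b, +oo[) (x t)).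
Proof.
have cs : trig_closure (fun x => Num.sg (x t - b)).
  apply: (@trig_closure_lim (fun n x => Num.sg (sin (n.+1%:R^-1 * (x t - b)))) _ 1).
  - move=> n; apply: trig_closure_sg => [|x].
      apply: trig_closure_poly.
      rewrite (_ : (fun x => _) = fun x => 1 * cos ((- (n.+1%:R^-1 * b) - pi / 2)
        + ev [:: (n.+1%:R^-1, t)] x)); first exact: trigpoly1.
      apply/funext => x; rewrite mul1r ev_cons ev_nil addr0 /= -cosBpihalf.
      by congr cos; ring.
    by rewrite ler_norml sin_geN1 sin_le1.
  - by move=> n x; rewrite normr_sg; case: (_ != _); rewrite ?ler01.
  - by move=> x; exact: sg_sin_near.
rewrite (_ : (fun x => _) = fun x => (1 / 2) * (Num.sg (x t - b) +
   Num.sg (x t - b) * Num.sg (x t - b))).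
  by apply: trig_closureZ; apply: trig_closureD => //; exact: trig_closureM.
apply/funext => x; rewrite indicE mem_setE in_itv/= andbT -subr_gt0.
have [h|h|h] := ltgtP 0 (x t - b).
- by rewrite gtr0_sg//= mulr1n; field.
- by rewrite ltr0_sg//= mulr0n; field.
- by rewrite -h sgr0 mulr0n; field.
Qed.

Definition trig_set (A : set (T -> R)) := trig_closure (\1_A).

(** Products of indicators give intersections, and bounded limits give
    increasing unions. *)
Lemma trig_set_sigma_algebra : sigma_algebra setT trig_set.
Proof.
have tC A : trig_set A -> trig_set (~` A).
  rewrite /trig_set => cA; rewrite (_ : \1_ _ = fun x => 1 - \1_A x).
    by apply: trig_closureB => //; exact: trig_closure_cst.
  by apply/funext => x; rewrite !indicE in_setC; case: (_ \in _); rewrite ?subr0 ?subrr.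
have t0 : trig_set set0.
  by rewrite /trig_set indic0; exact: trig_closure_cst.
have tI A B : trig_set A -> trig_set B -> trig_set (A `&` B).
  move=> cA cB; rewrite /trig_set indicI.
  exact: trig_closureM.
split => // [A|A tA]; first by rewrite setTD; exact: tC.
have tU n : trig_set (\bigcup_(k < n) A k).
  elim: n => [|n IH]; first by rewrite bigcup_mkord big_ord0.
  rewrite bigcup_mkord big_ord_recr /= -bigcup_mkord.
  by rewrite -[_ `|` _]setCK setCU; apply/tC/tI; exact/tC.
apply: (@trig_closure_lim (fun n => \1_(\bigcup_(k < n) A k)) _ 1) => //.
- by move=> n x; rewrite indicE; case: (_ \in _); rewrite ?normr1 ?normr0 ?ler01.
- move=> x; rewrite indicE.
  have [|nx] := boolP (x \in _).
    rewrite inE => -[k _ Ak]; apply: cvg_near_cst; exists k.+1 => // n /= kn.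
    by rewrite indicE mem_set//; exists k.
  apply: cvg_near_cst; apply: nearW => n; rewrite indicE memNset// => -[k _ Ak].
  by move: nx; rewrite notin_setE; apply; exists k.
Qed.

Lemma trig_set_cylinder n (t : 'I_n -> T) (B : set (Rd R n)) : measurable B ->
  trig_set [set x | B [tuple x (t j) | j < n]].
Proof.
apply: (generated_preimage trig_set_sigma_algebra (f := fun x => [tuple x (t j) | j < n])).
move=> {}B; rewrite -bigcup_seq => -[i _ [C mC <-]]; rewrite setTI.
rewrite (_ : _ @^-1` _ = [set x | C (x (t i))]); last first.
  by apply/funext => x /=; rewrite tnth_mktuple.
move: C mC; rewrite RGenOInfty.measurableE.
apply: (generated_preimage trig_set_sigma_algebra (f := fun x => x (t i))).
by move=> _ [b ->]; exact: trig_closure_gt.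
Qed.

End trigonometric_closure.

(** * Exponents of symmetric stable processes *)

Lemma same_law_integral (R : realType) (dO dO' dS : measure_display)
    (O : measurableType dO) (O' : measurableType dO') (S : measurableType dS)
    (P : probability O R) (Q : probability O' R) (f : O -> S) (g : O' -> S) (h : S -> R) :
  measurable_fun setT f -> measurable_fun setT g -> measurable_fun setT h ->
  (exists C, forall s, `|h s| <= C) ->
  (forall B, measurable B -> P (f @^-1` B) = Q (g @^-1` B)) ->
  \int[P]_w h (f w) = \int[Q]_w h (g w).
Proof.
move=> mf mg mh [C hC] fg; rewrite /Rintegral; congr fine.
have mhE : measurable_fun setT (EFin \o h) by exact/measurable_EFinP.
have iP : P.-integrable setT ((EFin \o h) \o f).
  apply: (@brv_integrable _ _ _ P (h \o f)); split; first exact: measurableT_comp.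
  by exists C => w; exact: hC.
have iQ : Q.-integrable setT ((EFin \o h) \o g).
  apply: (@brv_integrable _ _ _ Q (h \o g)); split; first exact: measurableT_comp.
  by exists C => w; exact: hC.
have := @integral_pushforward _ _ _ _ _ _ mf P setT _ mhE iP measurableT.
have := @integral_pushforward _ _ _ _ _ _ mg Q setT _ mhE iQ measurableT.
rewrite !preimage_setT /= => <- <-.
by apply: eq_measure_integral => A mA _; exact: fg.
Qed.

Section cosine_of_process.
Context (R : realType) (T : Type).
Context (dO dO' : measure_display) (O : measurableType dO) (O' : measurableType dO').
Context (P : probability O R) (Q : probability O' R).
Variables (X : T -> O -> R) (Y : T -> O' -> R).
Hypothesis mX : forall t, measurable_fun setT (X t).
Hypothesis mY : forall t, measurable_fun setT (Y t).

Lemma brv_cos_ev th (a : lincomb R T) : brv (fun w => cos (th + ev a (X^~ w))).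
Proof.
by apply: brv_cos; apply: measurable_funD; [exact: measurable_cst|exact: measurable_ev].
Qed.

Lemma trig_closure_brv F : trig_closure F -> brv (fun w => F (X^~ w)).
Proof.
elim => [{}F|u {}F C _ IH uC uF].
  elim => [|c th a {}F _ bF]; first exact: brv_cst.
  by apply: brvD => //; apply: brvZ; exact: brv_cos_ev.
by have [] := @exp_cvg _ _ _ P (fun n w => u n (X^~ w)) (fun w => F (X^~ w)) C
  (fun n => (IH n).1) (fun n w => uC n _) (fun w => uF _).
Qed.

End cosine_of_process.

Section uniqueness.
Context (R : realType) (T : Type).
Context (dO dO' : measure_display) (O : measurableType dO) (O' : measurableType dO').
Context (P : probability O R) (Q : probability O' R).
Variables (X : T -> O -> R) (Y : T -> O' -> R).
Hypothesis mX : forall t, measurable_fun setT (X t).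
Hypothesis mY : forall t, measurable_fun setT (Y t).

(** Equality of the integrals of trigonometric polynomials passes to bounded
    pointwise limits, hence to the indicators of all cylinder sets. *)
Lemma char_fdd_eq :
  (forall th a, \int[P]_w cos (th + ev a (X^~ w)) = \int[Q]_w cos (th + ev a (Y^~ w))) ->
  fdd_eq P X Q Y.
Proof.
move=> XY.
have H F : trig_closure F -> \int[P]_w F (X^~ w) = \int[Q]_w F (Y^~ w).
  elim => [{}F|u {}F C cu IH uC uF].
    elim => [|c th a {}F tF E].
      by rewrite !Rintegral_cst//; rewrite !mul0r.
    have bX := trig_closure_brv P mX (trig_closure_poly tF).
    have bY := trig_closure_brv Q mY (trig_closure_poly tF).
    rewrite !exp_add// ?exp_scale ?XY ?E//; try exact: brv_cos_ev.
    - by apply: brvZ; exact: brv_cos_ev.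
    - by apply: brvZ; exact: brv_cos_ev.
  have bX n : brv (fun w => u n (X^~ w)) by exact: (trig_closure_brv P).
  have bY n : brv (fun w => u n (Y^~ w)) by exact: (trig_closure_brv Q).
  have [_ cX] := @exp_cvg _ _ _ P (fun n w => u n (X^~ w)) (fun w => F (X^~ w)) C
    (fun n => (bX n).1) (fun n w => uC n _) (fun w => uF _).
  have [_] := @exp_cvg _ _ _ Q (fun n w => u n (Y^~ w)) (fun w => F (Y^~ w)) C
    (fun n => (bY n).1) (fun n w => uC n _) (fun w => uF _).
  rewrite -(funext IH) => cY; exact: (cvg_unique _ cX cY).
move=> n t B mB.
have mtup d (S : measurableType d) (Z : T -> S -> R) : (forall t, measurable_fun setT (Z t)) ->
    measurable [set w | B [tuple Z (t j) w | j < n]].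
  move=> mZ; rewrite -[X in measurable X]setTI.
  apply: (_ : measurable_fun setT (fun w => [tuple Z (t j) w | j < n] : Rd R n)) => //.
  by apply/measurable_fun_tnthP => i; rewrite /comp; under eq_fun do rewrite tnth_mktuple; exact: mZ.
have := H _ (trig_set_cylinder t mB).
set A := [set x | _]; have E d (S : measurableType d) (Z : T -> S -> R) : 
   (fun w => \1_A (Z^~ w)) = \1_[set w | B [tuple Z (t j) w | j < n]] :> (S -> R).
  by [].
rewrite !E !exp_indic; [|exact: mtup..].
move=> e; rewrite -[LHS]fineK ?fin_num_measure ?e ?fineK ?fin_num_measure//; exact: mtup.
Qed.

Lemma fdd_eq_char th a : fdd_eq P X Q Y ->
  \int[P]_w cos (th + ev a (X^~ w)) = \int[Q]_w cos (th + ev a (Y^~ w)).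
Proof.
move=> XY; pose t j := (tnth (in_tuple a) j).2.
pose h (u : Rd R (size a)) : R :=
  cos (th + \sum_(j < size a) (tnth (in_tuple a) j).1 * tnth u j).
have hE d (S : measurableType d) (Z : T -> S -> R) :
    (fun w => cos (th + ev a (Z^~ w))) = fun w => h [tuple Z (t j) w | j < size a].
  apply/funext => w; rewrite /h ev_tnth; congr (cos (_ + _)).
  by apply: eq_bigr => j _; rewrite tnth_mktuple.
rewrite !hE.
have mt d (S : measurableType d) (Z : T -> S -> R) : (forall t, measurable_fun setT (Z t)) ->
    measurable_fun setT (fun w => [tuple Z (t j) w | j < size a] : Rd R (size a)).
  move=> mZ; apply/measurable_fun_tnthP => i; rewrite /comp.
  by under eq_fun do rewrite tnth_mktuple; exact: mZ.
have [mh hb] : brv h.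
  apply: brv_cos; apply: measurable_funD; first exact: measurable_cst.
  apply: measurable_sum => j; apply: measurable_funM; first exact: measurable_cst.
  exact: measurable_tnth.
apply: (same_law_integral (mt _ _ _ mX) (mt _ _ _ mY)) => //.
by move=> B mB; exact: XY.
Qed.

End uniqueness.

Section exponents.
Context (R : realType) (alpha : R) (alpha0 : 0 < alpha) (T : Type).

(** The characteristic function of a symmetric stable process on all linear
    combinations at once; the phase [th] records symmetry. *)
Definition sas_exponent (dO : measure_display) (O : measurableType dO)
    (P : probability O R) (X : T -> O -> R) (N : lincomb R T -> R) :=
  [/\ forall t, measurable_fun setT (X t), forall a, 0 <= N a,
      forall c a, N (scale c a) = `|c| `^ alpha * N a &
      forall th a, \int[P]_w cos (th + ev a (X^~ w)) = cos th * expR (- N a)].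

Context (dO dO' : measure_display) (O : measurableType dO) (O' : measurableType dO').
Context (P : probability O R) (Q : probability O' R).

Lemma exponent_fdd_eq (X : T -> O -> R) (Y : T -> O' -> R) N :
  sas_exponent P X N -> sas_exponent Q Y N -> fdd_eq P X Q Y.
Proof.
move=> [mX _ _ XN] [mY _ _ YN]; apply: char_fdd_eq => // th a.
by rewrite XN YN.
Qed.

Lemma fdd_eq_exponent (X : T -> O -> R) (Y : T -> O' -> R) N :
  (forall t, measurable_fun setT (X t)) ->
  fdd_eq P X Q Y -> sas_exponent Q Y N -> sas_exponent P X N.
Proof.
move=> mX XY [mY N0 Nh YN]; split => // th a.
by rewrite -YN; exact: fdd_eq_char.
Qed.

Lemma exponent_unique (X : T -> O -> R) N N' :
  sas_exponent P X N -> sas_exponent P X N' -> N =1 N'.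
Proof.
move=> [_ _ _ XN] [_ _ _ XN'] a; have := XN 0 a; rewrite XN' cos0 !mul1r.
by move=> /expR_inj /oppr_inj.
Qed.

(** The exponent collects the scale parameters of the linear combinations,
    raised to the power [alpha]; it is homogeneous because a law determines its
    scale. *)
Lemma SaS_process_exponent (X : T -> {RV P >-> R}) : SaS_process alpha X ->
  exists N, sas_exponent P X N.
Proof.
move=> SX.
have H (a : lincomb R T) : exists s : R, 0 <= s /\ forall c th,
    \int[P]_w cos (th + c * ev a (fun t => X t w)) = cos th * expR (- (`|c| `^ alpha * s)).
  have [s s0 sX] := SX _ (fun j => (tnth (in_tuple a) j).1) (fun j => (tnth (in_tuple a) j).2).
  exists (s `^ alpha); split=> [|c th]; first exact: powR_ge0.
  have mev : measurable_fun setT (fun w => c * ev a (fun t => X t w)).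
    apply: measurable_funM; first exact: measurable_cst.
    by apply: measurable_ev => t; exact: measurable_funPT.
  have [Ec Es] : \int[P]_w cos (c * ev a (fun t => X t w)) =
      expR (- (s `^ alpha * `|c| `^ alpha)) /\
      \int[P]_w sin (c * ev a (fun t => X t w)) = 0.
    case: (sX c) => E1 E2; split; [rewrite -[RHS]E1|rewrite -[RHS]E2];
      by apply: eq_Rintegral => w _; rewrite ev_tnth.
  under eq_Rintegral do rewrite cosD.
  rewrite exp_sub ?exp_scale ?Ec ?Es ?mulr0 ?subr0//.
  - by congr (_ * expR (- _)); rewrite mulrC.
  - exact: brv_sin.
  - exact: brv_cos.
  - by apply: brvZ; exact: brv_cos.
  - by apply: brvZ; exact: brv_sin.
pose N a := projT1 (cid (H a)).
have NP a : 0 <= N a /\ forall c th, 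
  \int[P]_w cos (th + c * ev a (fun t => X t w)) = cos th * expR (- (`|c| `^ alpha * N a)).
  by rewrite /N; case: cid.
have XN th a : \int[P]_w cos (th + ev a (fun t => X t w)) = cos th * expR (- N a).
  have [_ /(_ 1 th)] := NP a; rewrite normr1 powR1 mul1r => <-.
  by under [RHS]eq_Rintegral do rewrite mul1r.
exists N; split => //.
- by move=> a; have [] := NP a.
- move=> c a; have := XN 0 (scale c a).
  have [_ /(_ c 0) E] := NP a; under eq_Rintegral do rewrite ev_scale.
  by rewrite E cos0 !mul1r => /expR_inj/oppr_inj.
Qed.

Lemma exponent_SaS_process (X : T -> {RV P >-> R}) N : sas_exponent P X N ->
  SaS_process alpha X.
Proof.
move=> [mX N0 Nh XN] n a t; pose b : lincomb R T := [seq (a j, t j) | j <- index_enum 'I_n].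
have bE w : \sum_(j < n) a j * X (t j) w = ev b (fun t => X t w).
  by rewrite /ev big_map.
exists (N b `^ alpha^-1); first exact: powR_ge0.
move=> c; rewrite /charfun; congr Complex.
- have := XN 0 (scale c b); rewrite Nh cos0 mul1r -powRrM mulVf ?gt_eqF// powRr1// mulrC => <-.
  by apply: eq_Rintegral => w _; rewrite add0r ev_scale -bE.
- have := XN (- (pi / 2)) (scale c b); rewrite cosN cos_pihalf mul0r => E; rewrite -[RHS]E.
  by apply: eq_Rintegral => w _; rewrite ev_scale -bE [in RHS]addrC cosBpihalf.
Qed.

Lemma exponent_scale (X : T -> O -> R) N c : sas_exponent P X N ->
  sas_exponent P (fun t w => c * X t w) (fun a => `|c| `^ alpha * N a).
Proof.
move=> [mX N0 Nh XN].
have cE a w : ev a (fun t => c * X t w) = ev (scale c a) (X^~ w).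
  rewrite ev_scale /ev big_distrr/=; apply: eq_bigr => p _; rewrite mulrCA//.
split.
- by move=> t; apply: measurable_funM => //; exact: measurable_cst.
- by move=> a; rewrite mulr_ge0// powR_ge0.
- by move=> c' a; rewrite Nh mulrCA.
- by move=> th a; under eq_Rintegral do rewrite cE; rewrite XN Nh.
Qed.

End exponents.

(** * Independence and characteristic functions *)

Lemma sfun_approx (R : realType) d (S : measurableType d) (f : S -> R) :
  measurable_fun setT f -> exists h : nat -> {sfun S >-> measurableTypeR R},
    (forall n x, `|h n x| <= `|f x|) /\ forall x, h n x @[n --> \oo] --> f x.
Proof.
move=> mf; have mfE : measurable_fun setT (EFin \o f) by exact/measurable_EFinP.
pose p := nnsfun_approx measurableT (measurable_funepos mfE).
pose q := nnsfun_approx measurableT (measurable_funeneg mfE).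
pose h n : {sfun S >-> measurableTypeR R} := p n \+ cst (-1) \* q n.
have ple n x : p n x <= Num.max (f x) 0.
  rewrite -lee_fin EFin_max.
  have : ((p n x)%:E <= (EFin \o f)^\+ x)%E by rewrite nnsfun_approxE; apply: le_approx.
  by rewrite funeposE.
have qle n x : q n x <= Num.max (- f x) 0.
  rewrite -lee_fin EFin_max EFinN.
  have : ((q n x)%:E <= (EFin \o f)^\- x)%E by rewrite nnsfun_approxE; apply: le_approx.
  by rewrite funenegE.
have hE n x : h n x = p n x - q n x by rewrite /h /= mulN1r.
have cp x : p n x @[n --> \oo] --> Num.max (f x) 0.
  have := cvg_nnsfun_approx measurableT (measurable_funepos mfE) (fun x _ => funepos_ge0 _ x) (I : setT x).
  by rewrite funeposE /= -EFin_max => /fine_cvg.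
have cq x : q n x @[n --> \oo] --> Num.max (- f x) 0.
  have := cvg_nnsfun_approx measurableT (measurable_funeneg mfE) (fun x _ => funeneg_ge0 _ x) (I : setT x).
  by rewrite funenegE /= -EFin_max => /fine_cvg.
exists h; split=> [n x|x].
  have p0 : 0 <= p n x by [].
  have q0 : 0 <= q n x by [].
  have := ple n x; have := qle n x; rewrite hE.
  have /orP[f0|f0] := le_total 0 (f x).
    rewrite (max_idPl f0) (max_idPr _) ?oppr_le0// => q1 p1.
    by rewrite (ger0_norm f0) ler_norml; apply/andP; split; lra.
  rewrite (max_idPr f0) (max_idPl _) ?oppr_ge0// => q1 p1.
  by rewrite (ler0_norm f0) ler_norml; apply/andP; split; lra.
rewrite (_ : f x = Num.max (f x) 0 - Num.max (- f x) 0).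
  by under eq_fun do rewrite hE; apply: cvgB.
have /orP[f0|f0] := le_total 0 (f x).
  by rewrite (max_idPl f0) (max_idPr _) ?oppr_le0// subr0.
by rewrite (max_idPr f0) (max_idPl _) ?oppr_ge0// sub0r opprK.
Qed.

Lemma sfun_ind (R : realType) d (S : measurableType d) (h : {sfun S >-> measurableTypeR R})
    (K : (S -> R) -> Prop) :
  K (fun _ => 0) -> (forall f g, K f -> K g -> K (fun x => f x + g x)) ->
  (forall y : R, y != 0 -> K (fun x => y * \1_(h @^-1` [set y]) x)) -> K h.
Proof.
move=> K0 KD K1; rewrite (_ : (h : S -> R) = fun x =>
  \sum_(y <- finmap.enum_fset (fset_set (range h))) y * \1_(h @^-1` [set y]) x); last first.
  by apply/funext => x; rewrite -fsbig_finite//= -fimfunE.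
elim: (finmap.enum_fset _) => [|y s IH].
  by under eq_fun do rewrite big_nil.
under eq_fun do rewrite big_cons; apply: KD => //.
have [->|] := eqVneq y 0; last exact: K1.
by under eq_fun do rewrite mul0r.
Qed.

Section independence.
Context (R : realType) (dO : measure_display) (O : measurableType dO).
Variable P : probability O R.

(** Simple functions of [Z] reduce the claim to the events that [Z] defines. *)
Lemma indep_factor (U : O -> R) (Z : O -> R) (k : R) :
  brv U -> measurable_fun setT Z ->
  (forall C, measurable C -> \int[P]_w (U w * \1_C (Z w)) = k * \int[P]_w \1_C (Z w)) ->
  forall h : R -> R, brv (h : measurableTypeR R -> R) ->
    \int[P]_w (U w * h (Z w)) = k * \int[P]_w h (Z w).
Proof.
move=> bU mZ UZ h [mh [C hC]].
have bZ (g : R -> R) : brv (g : measurableTypeR R -> R) -> brv (fun w => g (Z w)).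
  move=> [mg [D gD]]; split; first exact: measurableT_comp.
  by exists D => w.
have [u [uh cu]] := sfun_approx mh.
pose K (g : R -> R) := brv (g : measurableTypeR R -> R) /\
  \int[P]_w (U w * g (Z w)) = k * \int[P]_w g (Z w).
have Ku n : K (u n).
  apply: sfun_ind => [|f g [bf Kf] [bg Kg]|y _]; split.
  - exact: brv_cst.
  - under eq_Rintegral do rewrite mulr0.
    by rewrite !Rintegral_cst// !mul0r mulr0.
  - exact: brvD.
  - under eq_Rintegral do rewrite mulrDr.
    rewrite !exp_add ?Kf ?Kg ?mulrDr//; try exact: bZ.
    + by apply: brvM => //; exact: bZ.
    + by apply: brvM => //; exact: bZ.
  - by apply: brvZ; apply: brv_indic.
  - under eq_Rintegral do rewrite mulrCA.
    have bI : brv (fun w => \1_(u n @^-1` [set y]) (Z w) : R).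
      by apply: (bZ (\1_(u n @^-1` [set y]))); exact: brv_indic.
    rewrite !exp_scale ?UZ//; [by rewrite mulrCA| |exact: brvM].
    exact: (measurable_funPTI (u n)).
have [D UD] := bU.2.
have uC n y : `|u n y| <= C by rewrite (le_trans (uh n y)).
have [_ c1] := @exp_cvg _ _ _ P (fun n w => u n (Z w)) (fun w => h (Z w)) C
  (fun n => (bZ _ (Ku n).1).1) (fun n w => uC n _) (fun w => cu _).
have [_ c2] := @exp_cvg _ _ _ P (fun n w => U w * u n (Z w)) (fun w => U w * h (Z w)) (D * C)
  (fun n => (brvM bU (bZ _ (Ku n).1)).1)
  (fun n w => ltac:(rewrite normrM; exact: ler_pM))
  (fun w => cvgM (cvg_cst _) (cu _)).
rewrite (funext (fun n => (Ku n).2)) in c2.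
exact: (cvg_unique _ c2 (cvgM (cvg_cst _) c1)).
Qed.

(** The variables are absorbed one at a time: with the first [m] already
    replaced by their characteristic functions and the others still tested by
    indicators, [indep_factor] treats the next one. *)
Lemma indep_cos_sum n (Z : 'I_n -> O -> R) (phi : 'I_n -> R) :
  (forall k, measurable_fun setT (Z k)) ->
  (forall B : 'I_n -> set R, (forall k, measurable (B k)) ->
     P (\bigcap_(k in [set: 'I_n]) (Z k @^-1` B k)) = (\prod_(k < n) P (Z k @^-1` B k))%E) ->
  (forall k th, \int[P]_w cos (th + Z k w) = cos th * phi k) ->
  forall th, \int[P]_w cos (th + \sum_(k < n) Z k w) = cos th * \prod_(k < n) phi k.
Proof.
move=> mZ iZ sZ.
have mpre k (C : set R) : measurable C -> measurable (Z k @^-1` C).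
  by move=> mC; rewrite -[X in measurable X]setTI; exact: mZ.
have bI k (C : set R) : measurable C -> brv (fun w => \1_C (Z k w) : R).
  by move=> mC; apply: (@brv_indic _ _ _ (Z k @^-1` C)); exact: mpre.
have bprod (A : pred 'I_n) (B : 'I_n -> set R) : (forall k, measurable (B k)) ->
    brv (fun w => \prod_(k < n | A k) \1_(B k) (Z k w) : R).
  move=> mB; elim: (index_enum _) => [|i s IH].
    by under eq_fun do rewrite big_nil; exact: brv_cst.
  under eq_fun do rewrite big_cons; case: (A i) => //.
  by apply: brvM => //; exact: bI.
have S m : (m <= n)%N -> forall (B : 'I_n -> set R), (forall k, measurable (B k)) ->
    forall th, \int[P]_w (cos (th + \sum_(k < n | (k < m)%N) Z k w) *
      \prod_(k < n | ~~ (k < m)%N) \1_(B k) (Z k w)) =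
    cos th * \prod_(k < n | (k < m)%N) phi k *
      \prod_(k < n | ~~ (k < m)%N) \int[P]_w \1_(B k) (Z k w).
  elim: m => [_ B mB th|m IH mn B mB th].
    under eq_Rintegral do rewrite big_pred0// addr0.
    rewrite [\prod_(k < n | (k < 0)%N) _]big_pred0// mulr1 exp_scale; last exact: bprod.
    congr (_ * _).
    rewrite (_ : (fun w => _) = \1_(\bigcap_(k in [set: 'I_n]) (Z k @^-1` B k))); last first.
      apply/funext => w; rewrite indicE; have [|nw] := boolP (w \in _).
        by rewrite inE => wB; rewrite big1// => k _; rewrite indicE mem_set//; exact: wB.
      have [k nk] : exists k, ~ B k (Z k w).
        apply/not_existsP => h; move: nw; rewrite notin_setE; apply => k _.
        by have := h k; rewrite not_notP.
      by rewrite (bigD1 k)//= indicE memNset// mul0r.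
    rewrite exp_indic; last first.
      by apply: fin_bigcap_measurable => // k _; exact: mpre.
    rewrite iZ//= (_ : (\prod_(k < n) _)%E = (\prod_(k < n) \int[P]_w \1_(B k) (Z k w))%:E)//.
    rewrite -prodEFin; apply: eq_bigr => k _; rewrite -[LHS]fineK ?fin_num_measure//; last exact: mpre.
    by rewrite -exp_indic//; exact: mpre.
  pose km := Ordinal mn.
  have splitC (F : 'I_n -> R) : \prod_(k < n | ~~ (k < m)%N) F k =
      F km * \prod_(k < n | ~~ (k < m.+1)%N) F k.
    rewrite (bigD1 km)/= ?ltnn//; congr (_ * _); apply: eq_bigl => k.
    by rewrite -!leqNgt ltn_neqAle andbC eq_sym.
  have splitL (V : nmodType) (F : 'I_n -> V) : \sum_(k < n | (k < m.+1)%N) F k =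
      F km + \sum_(k < n | (k < m)%N) F k.
    rewrite (bigD1 km)/= ?ltnS//; congr (_ + _); apply: eq_bigl => k.
    by rewrite ltnS ltn_neqAle andbC.
  have splitP (F : 'I_n -> R) : \prod_(k < n | (k < m.+1)%N) F k =
      F km * \prod_(k < n | (k < m)%N) F k.
    rewrite (bigD1 km)/= ?ltnS//; congr (_ * _); apply: eq_bigl => k.
    by rewrite ltnS ltn_neqAle andbC.
  set rest := fun w => \prod_(k < n | ~~ (k < m.+1)%N) \1_(B k) (Z k w) : R.
  pose U th w := cos (th + \sum_(k < n | (k < m)%N) Z k w) * rest w.
  set p := \prod_(k < n | ~~ (k < m.+1)%N) _.
  set q := \prod_(k < n | (k < m)%N) phi k in IH.
  have bU th' : brv (U th').
    apply: brvM; last exact: bprod.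
    apply: brv_cos; apply: measurable_funD; first exact: measurable_cst.
    under eq_fun do rewrite big_mkcond; apply: measurable_sum => k.
    by case: (k < m)%N => //; exact: measurable_cst.
  have UZ th' := @indep_factor (U th') (Z km) (cos th' * q * p) (bU th') (mZ km).
  have {}UZ th' (h : R -> R) : brv (h : measurableTypeR R -> R) ->
      \int[P]_w (U th' w * h (Z km w)) = cos th' * q * p * \int[P]_w h (Z km w).
    apply: UZ => C mC.
    pose B' k := if k == km then C else B k.
    have mB' k : measurable (B' k) by rewrite /B'; case: ifP.
    have := IH (ltnW mn) B' mB' th'; rewrite splitC /B' eqxx.
    rewrite [\prod_(k < n | ~~ (k < m.+1)%N) _](_ : _ = p); last first.
      by apply: eq_bigr => k; case: eqP => // ->; rewrite /= ltnS leqnn.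
    move=> E; transitivity (cos th' * q * (\int[P]_w \1_C (Z km w) * p)); last by ring.
    rewrite -E; apply: eq_Rintegral => w _.
    rewrite splitC eqxx /U -mulrA; congr (_ * _); rewrite mulrC; congr (_ * _).
    by apply: eq_bigr => k; case: eqP => // ->; rewrite /= ltnS leqnn.
  have bc : brv (cos : measurableTypeR R -> R) by apply: brv_cos.
  have bs : brv (sin : measurableTypeR R -> R) by apply: brv_sin.
  have Ec : \int[P]_w cos (Z km w) = phi km.
    by have := sZ km 0; rewrite cos0 mul1r => <-; apply: eq_Rintegral => w _; rewrite add0r.
  have Es : \int[P]_w sin (Z km w) = 0.
    have := sZ km (- (pi / 2)); rewrite cosN cos_pihalf mul0r => E; rewrite -[RHS]E.
    by apply: eq_Rintegral => w _; rewrite [in RHS]addrC cosBpihalf.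
  transitivity (\int[P]_w (U th w * cos (Z km w) - U (th - pi / 2) w * sin (Z km w))).
    apply: eq_Rintegral => w _; rewrite splitL /U.
    set s := \sum_(k < n | _) _.
    have -> : th + (Z km w + s) = (th + s) + Z km w by ring.
    rewrite cosD (_ : th - pi / 2 + s = (th + s) - pi / 2); last by ring.
    by rewrite cosBpihalf -/(rest w); ring.
  rewrite exp_sub; last 2 first.
  - by apply: brvM => //; exact: brv_cos.
  - by apply: brvM => //; exact: brv_sin.
  by rewrite !UZ// Ec Es mulr0 subr0 splitP -/q; ring.
move=> th; have := S n (leqnn n) (fun=> setT) (fun=> measurableT) th.
have H (A : pred 'I_n) (F : 'I_n -> R) : (forall k, A k = ~~ (k < n)%N) -> \prod_(k < n | A k) F k = 1.
  by move=> AE; rewrite big_pred0// => k; rewrite AE ltn_ord.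
rewrite (H (fun k : 'I_n => ~~ (k < n)%N))// mulr1 => E.
transitivity (cos th * \prod_(k < n | (k < n)%N) phi k); last first.
  by congr (_ * _); apply: eq_bigl => k; rewrite ltn_ord.
rewrite -E; apply: eq_Rintegral => w _; rewrite (H (fun k : 'I_n => ~~ (k < n)%N))// mulr1.
by congr (cos (_ + _)); apply: eq_bigl => k; rewrite ltn_ord.
Qed.

End independence.

(** * The space of functions with integrable power [alpha] *)

Section power_space.
Context (R : realType) (alpha : R) (alpha0 : 0 < alpha).
Context (dS : measure_display) (S : measurableType dS).
Variable mu : {measure set S -> \bar R}.
Implicit Types f g h : S -> R.

Definition inLp f := measurable_fun setT f /\
  mu.-integrable setT (EFin \o (fun x => `|f x| `^ alpha)).

(** The power [alpha] of the usual norm: for [alpha < 1] that norm satisfies no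
    triangle inequality, whereas this quantity obeys [amassD]. *)
Definition amass f : R := \int[mu]_x (`|f x| `^ alpha).

Lemma measurable_apow f : measurable_fun setT f ->
  measurable_fun setT (fun x => `|f x| `^ alpha).
Proof.
move=> mf; apply: (measurableT_comp (measurable_powR alpha)).
exact: measurableT_comp.
Qed.

Lemma inLp_Lfun f : f \in Lfun mu alpha%:E <-> inLp f.
Proof.
have E : (\int[mu]_x `|(`|f x| `^ alpha)%:E| = \int[mu]_x `|(f x)%:E| `^ alpha)%E.
  by apply: eq_integral => x _; rewrite gee0_abs ?lee_fin ?powR_ge0// poweR_EFin.
split=> [fL|[mf /integrableP[_ fi]]].
  have mf : measurable_fun setT f by have := sub_Lfun_mfun fL; rewrite inE.
  have := sub_Lfun_finLfun fL; rewrite inE /= /finite_norm => fin.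
  split=> //; apply/integrableP; split; first exact/measurable_EFinP/measurable_apow.
  rewrite [X in (X < _)%E]E -poweR_Lnorm ?gt_eqF//.
  by rewrite poweR_lty.
apply/andP; split; rewrite inE//= /finite_norm unlock.
by rewrite poweR_lty// -E.
Qed.

Lemma amass_ge0 f : 0 <= amass f.
Proof. by apply: Rintegral_ge0 => x _; exact: powR_ge0. Qed.

Lemma amassE f : inLp f -> (\int[mu]_x (`|f x| `^ alpha)%:E = (amass f)%:E)%E.
Proof. by move=> [mf fi]; rewrite /amass /Rintegral fineK//; exact: integrable_fin_num. Qed.

Lemma inLp_bound f g (c : R) : measurable_fun setT f -> inLp g ->
  (forall x, `|f x| `^ alpha <= c * `|g x| `^ alpha) -> inLp f.
Proof.
move=> mf [mg ig] fg; split => //.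
apply: (@le_integrable _ _ _ mu setT measurableT _ (fun x => c%:E * (`|g x| `^ alpha)%:E)%E).
- exact/measurable_EFinP/measurable_apow.
- move=> x _; rewrite -EFinM lee_fin ger0_norm ?powR_ge0//.
  by rewrite (le_trans (fg x))// ler_norm.
- exact: integrableZl.
Qed.

Lemma inLp_le f g : measurable_fun setT f -> inLp g ->
  (forall x, `|f x| <= `|g x|) -> inLp f.
Proof.
move=> mf Lg fg; apply: (@inLp_bound f g 1) => // x; rewrite mul1r.
by apply: ge0_ler_powR; rewrite ?nnegrE// ltW.
Qed.

Lemma inLp0 : inLp (fun _ => 0).
Proof.
split; first exact: measurable_cst.
rewrite (_ : _ \o _ = cst 0%E); first exact: integrable0.
by apply/funext => x /=; rewrite normr0 powR0// gt_eqF.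
Qed.

Lemma amass0 : amass (fun _ => 0) = 0.
Proof.
rewrite /amass; under eq_Rintegral do rewrite normr0 powR0 ?gt_eqF//.
by rewrite Rintegral_cst// mul0r.
Qed.

Lemma inLpZ c f : inLp f -> inLp (fun x => c * f x).
Proof.
move=> Lf; apply: (@inLp_bound _ f (`|c| `^ alpha)) => //.
  by apply: measurable_funM; [exact: measurable_cst|exact: Lf.1].
by move=> x; rewrite normrM powRM.
Qed.

Lemma amassZ c f : inLp f -> amass (fun x => c * f x) = `|c| `^ alpha * amass f.
Proof.
move=> [mf fi]; rewrite /amass -RintegralZl//.
by apply: eq_Rintegral => x _; rewrite normrM powRM.
Qed.

(** Distinguish [|y| <= dl * |x|] from the opposite case. The first factor tends
    to [1] with [dl], which is what continuity of [amass] requires. *)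
Lemma apow_add (dl x y : R) : 0 < dl ->
  `|x + y| `^ alpha <= (1 + dl) `^ alpha * `|x| `^ alpha + (1 + dl^-1) `^ alpha * `|y| `^ alpha.
Proof.
move=> d0; have d1 : 0 <= 1 + dl by rewrite addr_ge0// ltW.
have d2 : 0 <= 1 + dl^-1 by rewrite addr_ge0// invr_ge0 ltW.
have [h|h] := leP `|y| (dl * `|x|).
  rewrite -[leLHS]addr0 lerD ?mulr_ge0 ?powR_ge0// -powRM//.
  apply: ge0_ler_powR; rewrite ?nnegrE ?mulr_ge0//; first exact: ltW.
  by rewrite (le_trans (ler_normD _ _))// mulrDl mul1r lerD2l.
rewrite -[leLHS]add0r lerD ?mulr_ge0 ?powR_ge0// -powRM//.
apply: ge0_ler_powR; rewrite ?nnegrE ?mulr_ge0//; first exact: ltW.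
rewrite ltW// (le_lt_trans (ler_normD _ _))// mulrDl mul1r addrC ltrD2l.
by rewrite mulrC ltr_pdivlMr// mulrC.
Qed.

Lemma inLpD f g : inLp f -> inLp g -> inLp (fun x => f x + g x).
Proof.
move=> [mf fi] [mg gi]; have mfg : measurable_fun setT (fun x => f x + g x).
  exact: measurable_funD.
split => //.
apply: (@le_integrable _ _ _ mu setT measurableT _
   (fun x => ((1 + 1) `^ alpha)%:E * (`|f x| `^ alpha)%:E +
     ((1 + 1^-1) `^ alpha)%:E * (`|g x| `^ alpha)%:E)%E).
- exact/measurable_EFinP/measurable_apow.
- move=> x _; rewrite -!EFinM -EFinD lee_fin ger0_norm ?powR_ge0//.
  by rewrite (le_trans (apow_add _ _ ltr01))// ler_norm.
- by apply: integrableD => //; exact: integrableZl.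
Qed.

Lemma amassD dl f g : 0 < dl -> inLp f -> inLp g ->
  amass (fun x => f x + g x) <= (1 + dl) `^ alpha * amass f + (1 + dl^-1) `^ alpha * amass g.
Proof.
move=> d0 Lf Lg; have [_ fgi] := inLpD Lf Lg.
have [[mf fi] [mg gi]] := (Lf, Lg).
rewrite /amass -!RintegralZl// -RintegralD//; last 2 first.
- exact: (integrableZl measurableT ((1 + dl) `^ alpha) fi).
- exact: (integrableZl measurableT ((1 + dl^-1) `^ alpha) gi).
apply: le_Rintegral => //; last by move=> x _; exact: apow_add.
apply: (integrableD measurableT (integrableZl measurableT ((1 + dl) `^ alpha) fi)
  (integrableZl measurableT ((1 + dl^-1) `^ alpha) gi)).
Qed.

Lemma inLpB f g : inLp f -> inLp g -> inLp (fun x => f x - g x).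
Proof.
move=> Lf Lg; have := inLpD Lf (inLpZ (-1) Lg).
by under eq_fun do rewrite mulN1r.
Qed.

Lemma amass_distC f g : amass (fun x => f x - g x) = amass (fun x => g x - f x).
Proof. by apply: eq_Rintegral => x _; rewrite distrC. Qed.

Lemma amass_triangle f g h : inLp f -> inLp g -> inLp h ->
  amass (fun x => f x - h x) <=
  2 `^ alpha * (amass (fun x => f x - g x) + amass (fun x => g x - h x)).
Proof.
move=> Lf Lg Lh; have := amassD ltr01 (inLpB Lf Lg) (inLpB Lg Lh).
rewrite invr1 (_ : 1 + 1 = 2)// -mulrDr; apply: le_trans.
rewrite le_eqVlt; apply/orP; left; apply/eqP; apply: eq_Rintegral => x _.
by rewrite addrA subrK.
Qed.

Lemma inLp_ev (T : Type) (a : lincomb R T) (G : T -> S -> R) :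
  (forall t, inLp (G t)) -> inLp (fun x => ev a (G^~ x)).
Proof.
move=> LG; elim: a => [|p a IH].
  by under eq_fun do rewrite ev_nil; exact: inLp0.
under eq_fun do rewrite ev_cons; apply: inLpD => //; exact: inLpZ.
Qed.

Lemma amass_dominated (u : nat -> S -> R) f g :
  (forall n, measurable_fun setT (u n)) -> measurable_fun setT f -> inLp g ->
  (forall n x, `|u n x - f x| <= `|g x|) ->
  {ae mu, forall x, u n x @[n --> \oo] --> f x} ->
  amass (fun x => u n x - f x) @[n --> \oo] --> 0.
Proof.
move=> mu_ mf [mg ig] ug uf.
pose F n x := (`|u n x - f x| `^ alpha)%:E.
have mF n : measurable_fun setT (F n).
  by apply/measurable_EFinP/measurable_apow; exact: measurable_funB.
have [] := @dominated_convergence _ _ _ mu setT measurableT F (cst 0%E)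
  (fun x => (`|g x| `^ alpha)%:E) mF (measurable_cst _) _ ig _.
- apply: filterS uf => x ux _; apply: cvg_EFin; first exact: nearW.
  apply/(@cvgrPdist_lt _ R^o) => e e0.
  have ea : 0 < e `^ alpha^-1 by exact: powR_gt0.
  have /cvgrPdist_lt /(_ _ ea) := ux; apply: filterS => n /= un.
  rewrite sub0r normrN ger0_norm ?powR_ge0// distrC.
  have -> : e = (e `^ alpha^-1) `^ alpha by rewrite -powRrM mulVf ?gt_eqF// powRr1// ltW.
  by apply: gt0_ltr_powR; rewrite ?nnegrE// ltW.
- apply: aeW => x n _; rewrite /F gee0_abs ?lee_fin ?powR_ge0//.
  by apply: ge0_ler_powR; rewrite ?nnegrE// ltW.
move=> _ _; rewrite integral0 => h.
by rewrite /amass /Rintegral; exact: (fine_cvg h).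
Qed.

Lemma amass_cvg (u : nat -> S -> R) f : (forall n, inLp (u n)) -> inLp f -> alpha < 2 ->
  amass (fun x => u n x - f x) @[n --> \oo] --> 0 ->
  amass (u n) @[n --> \oo] --> amass f.
Proof.
move=> Lu Lf alpha2 h.
pose a := amass f; pose e n := amass (fun x => u n x - f x).
have a0 : 0 <= a by exact: amass_ge0.
have dE (dl : R) : 0 < dl -> dl <= 1 -> (1 + dl) `^ alpha <= 1 + 3 * dl.
  move=> d0 d1; apply: (@le_trans _ _ ((1 + dl) `^ 2)).
    by apply: ler_powR; [lra|exact: ltW].
  by rewrite -[2]/(2%:R) powR_mulrn; nra.
have H (dl : R) n : 0 < dl -> dl <= 1 ->
    amass (u n) <= (1 + 3 * dl) * a + (1 + dl^-1) `^ alpha * e n /\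
    a <= (1 + 3 * dl) * amass (u n) + (1 + dl^-1) `^ alpha * e n.
  move=> d0 d1; split.
    apply: (@le_trans _ _ ((1 + dl) `^ alpha * a + (1 + dl^-1) `^ alpha * e n)).
      apply: le_trans (amassD d0 Lf (inLpB (Lu n) Lf)).
      by rewrite le_eqVlt; apply/orP; left; apply/eqP; apply: eq_Rintegral => x _; rewrite addrC subrK.
    by rewrite lerD2r ler_wpM2r// dE.
  apply: (@le_trans _ _ ((1 + dl) `^ alpha * amass (u n) + (1 + dl^-1) `^ alpha * e n)).
    rewrite /e amass_distC; apply: le_trans (amassD d0 (Lu n) (inLpB Lf (Lu n))).
    by rewrite le_eqVlt; apply/orP; left; apply/eqP; apply: eq_Rintegral => x _; rewrite addrC subrK.
  by rewrite lerD2r ler_wpM2r ?amass_ge0// dE.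
apply/cvgrPdist_le => r r0.
pose dl := Num.min 1 (r / (6 * (4 * a + 1) )).
have k0 : 0 < 6 * (4 * a + 1) by lra.
have d0 : 0 < dl by rewrite lt_min ltr01 divr_gt0.
have d1 : dl <= 1 by rewrite ge_min lexx.
have d2 : dl * (6 * (4 * a + 1)) <= r by rewrite -ler_pdivlMr// ge_min lexx orbT.
pose C1 := (1 + 1^-1) `^ alpha : R; pose C := (1 + dl^-1) `^ alpha.
have C10 : 0 <= C1 by exact: powR_ge0.
have C0 : 0 <= C by exact: powR_ge0.
pose s := Num.min (1 / (C1 + 1)) (r / (2 * (C + 1))).
have s0 : 0 < s.
  by rewrite lt_min !divr_gt0//; lra.
have /cvgrPdist_le /(_ _ s0) := h; apply: filterS => n /=.
rewrite sub0r normrN ger0_norm ?amass_ge0// -/(e n) => es.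
have e0 : 0 <= e n by exact: amass_ge0.
have es1 : e n * (C1 + 1) <= 1.
  by rewrite -ler_pdivlMr; [rewrite (le_trans es)// ge_min lexx|lra].
have es2 : e n * (2 * (C + 1)) <= r.
  by rewrite -ler_pdivlMr; [rewrite (le_trans es)// ge_min lexx orbT|lra].
have [A1 _] := H 1 n ltr01 (lexx _); have [A2 A3] := H dl n d0 d1.
rewrite -/C1 -/C in A1 A2 A3.
have An : amass (u n) <= 4 * a + 1 by nra.
have An0 : 0 <= amass (u n) by exact: amass_ge0.
rewrite ler_norml; apply/andP; split.
  suff : amass (u n) - a <= r by rewrite -/a; lra.
  have : dl * a <= dl * (4 * a + 1) by rewrite ler_wpM2l; lra.
  by nra.
suff : a - amass (u n) <= r by rewrite -/a; lra.
have : dl * amass (u n) <= dl * (4 * a + 1) by rewrite ler_wpM2l; lra.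
by nra.
Qed.

Lemma inLp_sfun_dense f : inLp f -> exists h : nat -> {sfun S >-> measurableTypeR R},
  (forall n, inLp (h n)) /\ amass (fun x => f x - h n x) @[n --> \oo] --> 0.
Proof.
move=> Lf; have [h [hf ch]] := sfun_approx Lf.1.
have mh n : measurable_fun setT (h n) by exact: measurable_funPT.
exists h; split=> [n|]; first exact: inLp_le (mh n) Lf (hf n).
under eq_fun do rewrite amass_distC.
apply: (@amass_dominated _ _ (fun x => 2 * f x)) => //; first exact: Lf.1.
- exact: inLpZ.
- move=> n x; rewrite (le_trans (ler_normB _ _))// normrM ger0_norm// mulr_natl mulr2n.
  by rewrite lerD2r.
- by apply: aeW => x; exact: ch.
Qed.

End power_space.

(** * Stable integrals *)

Section simple_integrals.
Context (R : realType) (alpha : R) (alpha0 : 0 < alpha).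
Context (dS : measure_display) (S : measurableType dS).
Variable mu : {measure set S -> \bar R}.
Context (dO : measure_display) (O : measurableType dO) (P : probability O R).
Variable M : set S -> {RV P >-> R}.
Hypothesis MS : SaS_random_measure alpha mu M.

Local Notation sfn := ({sfun S >-> measurableTypeR R}).
Local Notation fm := (finite_measurable mu).

Lemma fm0 : fm set0.
Proof. by split; [exact: measurable0|rewrite measure0]. Qed.

Lemma fmU A B : fm A -> fm B -> fm (A `|` B).
Proof.
move=> [mA fA] [mB fB]; split; first exact: measurableU.
by rewrite (le_lt_trans (measureU2 _ mA mB))// lte_add_pinfty.
Qed.

Lemma fm_bigsetU (J : Type) (s : seq J) (A : J -> set S) : (forall j, fm (A j)) ->
  fm (\big[setU/set0]_(j <- s) A j).
Proof. by move=> fA; elim/big_ind: _ => //; [exact: fm0|exact: fmU]. Qed.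

(** Countable additivity along the empty sets makes [n * M set0] converge. *)
Lemma rm_set0 : {ae P, forall w, M set0 w = 0}.
Proof.
have [_ _ /(_ (fun=> set0) (fun=> fm0))] := MS.
have t0 : trivIset [set: nat] (fun=> set0 : set S).
  by move=> i j _ _; rewrite setI0 => -[].
rewrite bigcup0// => /(_ t0 fm0); apply: filterS => w h.
have h1 := h; rewrite -(cvg_shiftn 1 (fun n => \sum_(k < n) M set0 w)) in h1.
have : (fun n : nat => M set0 w) @ \oo --> (0 : R).
  rewrite -(subrr (M set0 w)) (_ : (fun n : nat => _) =
    fun n => \sum_(k < n + 1) M set0 w - \sum_(k < n) M set0 w); last first.
    by apply/funext => n; rewrite addn1 big_ord_recr /= addrAC subrr add0r.
  by apply: cvgB.
by move=> h2; exact: (cvg_unique _ (cvg_cst (M set0 w)) h2).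
Qed.

Lemma rm_setU A B : fm A -> fm B -> A `&` B = set0 ->
  {ae P, forall w, M (A `|` B) w = M A w + M B w}.
Proof.
move=> fA fB AB0; have [_ _ MC] := MS.
have fC k : fm (bigcup2 A B k) by case: k => [|[|k]]//=; exact: fm0.
have tC : trivIset [set: nat] (bigcup2 A B) by rewrite -trivIset_bigcup2.
have := MC _ fC tC; rewrite bigcup2E => /(_ (fmU fA fB)).
apply: filterS2 rm_set0 => w M0 h.
have h2 : (\sum_(k < n) M (bigcup2 A B k) w) @[n --> \oo] --> (M A w + M B w : R).
  apply: cvg_near_cst; exists 2 => // n /= n2.
  rewrite -(subnKC n2) big_split_ord /= big_ord_recr /= big_ord_recr /= big_ord0 add0r.
  by rewrite big1 ?addr0// => i _; rewrite M0.
exact: (cvg_unique _ h h2).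
Qed.

Lemma rm_bigsetU (J : choiceType) (s : seq J) (A : J -> set S) : uniq s ->
  (forall j, fm (A j)) -> trivIset setT A ->
  {ae P, forall w, M (\big[setU/set0]_(j <- s) A j) w = \sum_(j <- s) M (A j) w}.
Proof.
move=> us fA tA; elim: s us => [_|j s IH /= /andP[js us]].
  by rewrite big_nil; apply: filterS rm_set0 => w; rewrite big_nil.
have tJ : A j `&` \big[setU/set0]_(j <- s) A j = set0.
  rewrite -subset0 => x [Aj]; rewrite -bigcup_seq => -[k /= ks Ak].
  have jk := tA j k I I (ex_intro _ x (conj Aj Ak)).
  by rewrite jk ks in js.
have := rm_setU (fA j) (fm_bigsetU s fA) tJ; have := IH us.
by apply: filterS2 => w E1 E2; rewrite !big_cons E2 E1.
Qed.

Definition nzrange (h : sfn) : seq R :=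
  [seq y <- finmap.enum_fset (fset_set (range h)) | y != 0].

Lemma nzrangeP (h : sfn) (y : R) : (y \in nzrange h) = (y != 0) && (y \in range h).
Proof. by rewrite mem_filter in_fset_set. Qed.

Lemma nzrange_uniq (h : sfn) : uniq (nzrange h).
Proof. exact/filter_uniq/finmap.fset_uniq. Qed.

Lemma simple_integralE (h : sfn) w :
  simple_integral M h w = \sum_(y <- nzrange h) y * M (h @^-1` [set y]) w.
Proof.
rewrite /simple_integral fsbig_finite//= big_filter [LHS](bigID (fun y => y != 0))/=.
rewrite [X in _ + X]big1 ?addr0// => y; rewrite negbK => /eqP ->.
by rewrite mul0r.
Qed.

Lemma inLp_level (h : sfn) (y : R) : inLp alpha mu h -> y != 0 -> fm (h @^-1` [set y]).
Proof.
move=> [mh hi] y0; have mA : measurable (h @^-1` [set y]) by exact: measurable_funPTI.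
split => //.
have ya : 0 < `|y| `^ alpha by rewrite powR_gt0// normr_gt0.
have : mu.-integrable setT (EFin \o \1_(h @^-1` [set y])).
  apply: (@le_integrable _ _ _ mu setT measurableT _
    (fun x => ((`|y| `^ alpha)^-1)%:E * (`|h x| `^ alpha)%:E)%E).
  - by apply/measurable_EFinP; exact: measurable_indic.
  - move=> x _; rewrite -EFinM /= lee_fin [leRHS]ger0_norm; last first.
      by rewrite mulr_ge0 ?powR_ge0// invr_ge0 ltW.
    rewrite indicE; have [|] := boolP (x \in _); last first.
      by rewrite normr0 mulr_ge0 ?powR_ge0// invr_ge0 ltW.
    by rewrite inE /= => ->; rewrite normr1 mulVf// gt_eqF.
  - exact: integrableZl.
by move/(integrable_lty measurableT); rewrite integral_indic// setIT.
Qed.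

Lemma ae_seq (J : eqType) (s : seq J) (Q : J -> O -> Prop) :
  (forall j, j \in s -> {ae P, forall w, Q j w}) ->
  {ae P, forall w, forall j, j \in s -> Q j w}.
Proof.
elim: s => [_|j s IH h]; first by apply: aeW => w j.
have h1 := h j (mem_head _ _).
have h2 : {ae P, forall w, forall j, j \in s -> Q j w}.
  by apply: IH => k ks; apply: h; rewrite in_cons ks orbT.
apply: filterS2 h1 h2 => w H1 H2 k; rewrite in_cons => /predU1P[->//|]; exact: H2.
Qed.

Lemma sum_indic_eq (J : choiceType) (s : seq J) (F : J -> R) (A : J -> set S) j x :
  uniq s -> j \in s -> trivIset setT A -> A j x -> \sum_(i <- s) F i * \1_(A i) x = F j.
Proof.
move=> us js tA Aj; rewrite (bigD1_seq j)//= indicE mem_set// mulr1 big1 ?addr0//.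
move=> i ij; rewrite indicE memNset ?mulr0// => Ai.
by move/eqP: ij; apply; apply: (tA i j I I); exists x.
Qed.

(** The coefficients [c j] may repeat: each level set of [h] is the union of
    several sets [A j], which additivity of [M] merges. *)
Lemma simple_integral_partition (h : sfn) (J : choiceType) (s : seq J) (c : J -> R)
    (A : J -> set S) : inLp alpha mu h -> uniq s -> (forall j, fm (A j)) ->
  trivIset setT A -> (forall x, h x = \sum_(j <- s) c j * \1_(A j) x) ->
  {ae P, forall w, simple_integral M h w = \sum_(j <- s) c j * M (A j) w}.
Proof.
move=> Lh us fA tA hE.
have hA j x : j \in s -> A j x -> h x = c j.
  by move=> js Aj; rewrite hE; exact: sum_indic_eq.
have level y : y != 0 -> h @^-1` [set y] =
    \big[setU/set0]_(j <- [seq j <- s | c j == y]) A j.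
  move=> y0; apply/seteqP; split=> x /=.
    move=> hy; rewrite -bigcup_seq; apply: contrapT => nx.
    move: y0; rewrite -hy hE big1_seq ?eqxx// => j /= js.
    rewrite indicE memNset ?mulr0// => Aj; apply: nx; exists j => //=.
    by rewrite mem_filter js andbT -hy (hA j).
  rewrite -bigcup_seq => -[j /=]; rewrite mem_filter => /andP[/eqP <- js] Aj.
  exact: hA Aj.
have h1 : {ae P, forall w, forall y, y \in nzrange h ->
    M (h @^-1` [set y]) w = \sum_(j <- s | c j == y) M (A j) w}.
  apply: ae_seq => y; rewrite nzrangeP => /andP[y0 _]; rewrite level//.
  have := rm_bigsetU (filter_uniq (fun j => c j == y) us) fA tA.
  by apply: filterS => w ->; rewrite big_filter.
apply: filterS2 h1 rm_set0 => w E M0.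
rewrite simple_integralE (eq_big_seq _ (fun y ys => congr1 ( *%R y) (E y ys))).
under eq_bigr do rewrite big_distrr/=.
rewrite (exchange_big_dep predT)//=; apply: eq_big_seq => j js.
have [cn|cn] := boolP (c j \in nzrange h).
  rewrite -big_filter (_ : [seq _ <- _ | _] = [:: c j]) ?big_seq1//.
  rewrite -(@filter_pred1_uniq _ (nzrange h) (c j))//; last exact: nzrange_uniq.
  by apply: eq_filter => y /=; rewrite eq_sym.
rewrite big1_seq; last first.
  by move=> y /andP[/eqP <-]; rewrite (negbTE cn).
have [->|c0] := eqVneq (c j) 0; first by rewrite mul0r.
have Aj0 : A j = set0.
  rewrite -subset0 => x Aj; move: cn; rewrite nzrangeP c0 /= => /negP; apply.
  by rewrite inE; exists x => //; exact: hA.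
by rewrite Aj0 M0 mulr0.
Qed.

(** All three functions are constant on the common refinement of the level sets
    of [h] and [h']. *)
Lemma simple_integral_linear (c : R) (h h' k : sfn) : inLp alpha mu h -> inLp alpha mu h' ->
  inLp alpha mu k -> (forall x, k x = c * h x + h' x) ->
  {ae P, forall w, simple_integral M k w = c * simple_integral M h w + simple_integral M h' w}.
Proof.
move=> Lh Lh' Lk kE.
pose s := [seq p <- allpairs pair (finmap.enum_fset (fset_set (range h)))
   (finmap.enum_fset (fset_set (range h'))) | p != ((0, 0) : R * R)].
have us : uniq s.
  apply/filter_uniq/allpairs_uniq; [exact: finmap.fset_uniq|exact: finmap.fset_uniq|].
  by move=> [? ?] [? ?] _ _ /= [-> ->].
pose A (p : R * R) := if p == (0, 0) then set0 else h @^-1` [set p.1] `&` h' @^-1` [set p.2].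
have mpre (g : sfn) (y : R) : measurable (g @^-1` [set y]) by exact: measurable_funPTI.
have fA p : fm (A p).
  rewrite /A; case: ifPn => [_|]; first exact: fm0.
  case: p => y y'; rewrite xpair_eqE negb_and => /orP[y0|y0] /=.
    have [m1 f1] := inLp_level Lh y0; split; first exact: measurableI.
    by apply: le_lt_trans f1; apply: le_measure; rewrite ?inE//; exact: measurableI.
  have [m1 f1] := inLp_level Lh' y0; split; first exact: measurableI.
  by apply: le_lt_trans f1; apply: le_measure; rewrite ?inE//; exact: measurableI.
have AP p x : A p x -> p = (h x, h' x).
  by rewrite /A; case: ifP => // _ [/= -> ->]; case: p.
have tA : trivIset setT A.
  by move=> p q _ _ [x [/AP -> /AP ->]].
have EF (F : R * R -> R) : F (0, 0) = 0 -> forall x, 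
    F (h x, h' x) = \sum_(p <- s) F p * \1_(A p) x.
  move=> F0 x; have [e|ne] := eqVneq (h x, h' x) (0, 0).
    rewrite e F0 big1_seq// => p /=; rewrite mem_filter => /andP[p0 _].
    rewrite indicE memNset ?mulr0// => /AP pe.
    by move: p0; rewrite pe e eqxx.
  rewrite (@sum_indic_eq _ _ _ _ (h x, h' x))//.
    rewrite mem_filter ne /=; apply/allpairsP; exists (h x, h' x) => /=.
    by split => //; rewrite in_fset_set// inE; exists x.
  by rewrite /A (negbTE ne).
have F0 : (fun p : R * R => c * p.1 + p.2) (0, 0) = 0 by rewrite /= mulr0 addr0.
have := simple_integral_partition (c := fun p : R * R => c * p.1 + p.2) Lk us fA tA
   (fun x => etrans (kE x) (EF _ F0 x)).
have := simple_integral_partition Lh us fA tA (EF fst erefl).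
have := simple_integral_partition Lh' us fA tA (EF snd erefl).
apply: filterS3 => w E1 E2 E3; rewrite E1 E2 E3 big_distrr/= -big_split/=.
by apply: eq_bigr => p _; rewrite mulrDl mulrA.
Qed.

Lemma measurable_simple_integral (h : sfn) : measurable_fun setT (simple_integral M h).
Proof.
rewrite (funext (simple_integralE h)); apply: measurable_sum => y.
by apply: measurable_funM; [exact: measurable_cst|exact: measurable_funPT].
Qed.

Lemma amass_sfun (h : sfn) : inLp alpha mu h ->
  amass alpha mu h = \sum_(y <- nzrange h) `|y| `^ alpha * fine (mu (h @^-1` [set y])).
Proof.
move=> Lh; pose A (y : R) := if y == 0 then set0 else h @^-1` [set y].
have tA : trivIset setT A.
  move=> y z _ _ [x []]; rewrite /A; case: ifP => // _; case: ifP => // _ /=.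
  by move=> -> ->.
have E x : `|h x| `^ alpha = \sum_(y <- nzrange h) `|y| `^ alpha * \1_(A y) x.
  have [h0|h0] := eqVneq (h x) 0.
    rewrite h0 normr0 powR0 ?gt_eqF// big1_seq// => y.
    rewrite nzrangeP => /andP[_ /andP[y0 _]]; rewrite indicE memNset ?mulr0//.
    by rewrite /A (negbTE y0) /= h0 => e; rewrite -e eqxx in y0.
  rewrite (@sum_indic_eq _ _ _ _ (h x))//; first exact: nzrange_uniq.
    by rewrite nzrangeP h0 inE; exists x.
  by rewrite /A (negbTE h0).
have fA y : fm (A y).
  by rewrite /A; have [_|y0] := eqVneq y 0; [exact: fm0|exact: inLp_level].
rewrite /amass; under eq_Rintegral do rewrite E.
rewrite /Rintegral.
under eq_integral do rewrite -sumEFin.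
rewrite integral_sum//; last first.
  move=> y; under eq_fun do rewrite EFinM.
  apply: (integrableZl measurableT).
  apply/integrableP; split; first by apply/measurable_EFinP/measurable_indic; exact: (fA y).1.
  rewrite (_ : (fun x => _) = (fun x => (\1_(A y) x)%:E)); last first.
    by apply/funext => x; rewrite gee0_abs// lee_fin.
  by rewrite integral_indic// ?setIT; exact: (fA y).2 || exact: (fA y).1.
rewrite (eq_big_seq (fun y => (`|y| `^ alpha * fine (mu (h @^-1` [set y])))%:E)); last first.
  move=> y; rewrite nzrangeP => /andP[y0 _]; under eq_integral do rewrite EFinM.
  have AE : A y = h @^-1` [set y] by rewrite /A (negbTE y0).
  rewrite ge0_integralZl//; last first.
    by apply/measurable_EFinP/measurable_indic; exact: (fA y).1.
  rewrite integral_indic ?setIT//; last exact: (fA y).1.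
  by rewrite AE EFinM fineK// ge0_fin_numE//; have := (fA y).2; rewrite AE.
by rewrite sumEFin.
Qed.

Lemma simple_integral_char (h : sfn) th : inLp alpha mu h ->
  \int[P]_w cos (th + simple_integral M h w) = cos th * expR (- amass alpha mu h).
Proof.
move=> Lh; pose s := nzrange h; pose n := size s.
pose A (k : 'I_n) := h @^-1` [set s`_k].
have s0 (k : 'I_n) : s`_k != 0.
  by have := mem_nth 0 (ltn_ord k); rewrite nzrangeP => /andP[].
have fA k : fm (A k) by exact: inLp_level.
have tA : trivIset setT A.
  move=> i j _ _ [x []]; rewrite /A /= => -> /eqP.
  by rewrite (nth_uniq 0 (ltn_ord i) (ltn_ord j) (nzrange_uniq h)) => /eqP/val_inj.
have [Mc Mi _] := MS; have iM := Mi n A fA tA.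
have IE w : simple_integral M h w = \sum_(k < n) s`_k * M (A k) w.
  by rewrite simple_integralE (big_nth 0) big_mkord.
under eq_Rintegral do rewrite IE.
have mZ (k : 'I_n) : measurable_fun setT (fun w => s`_k * M (A k) w).
  by apply: measurable_funM; [exact: measurable_cst|exact: measurable_funPT].
rewrite (indep_cos_sum mZ (phi := fun k : 'I_n => expR (- (`|s`_k| `^ alpha * fine (mu (A k)))))).
- rewrite -expR_sum amass_sfun// (big_nth 0) big_mkord; congr (_ * expR _).
  by rewrite -sumrN.
- move=> B mB; pose B' (k : 'I_n) := ( *%R s`_k) @^-1` B k.
  have mB' k : measurable (B' k).
    rewrite -[X in measurable X]setTI.
    apply: (_ : measurable_fun setT (fun x : measurableTypeR R => s`_k * x)) => //.
    by apply: measurable_funM; [exact: measurable_cst|exact: measurable_id].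
  have := iM (fun k => M (A k) @^-1` B' k); apply => k.
  by exists (B' k) => //; rewrite setTI.
- move=> k t; under eq_Rintegral do rewrite cosD.
  have := Mc _ (fA k) s`_k; rewrite /charfun => -[Ec Es].
  have mk := mZ k.
  rewrite exp_sub; last 2 first.
  - by apply: brvZ; exact: brv_cos.
  - by apply: brvZ; exact: brv_sin.
  rewrite !exp_scale; [|exact: brv_sin|exact: brv_cos].
  by rewrite Ec Es mulr0 subr0 [X in expR (- X)]mulrC.
Qed.

End simple_integrals.

Lemma cos_lipschitz (R : realType) (x y : R) : `|cos x - cos y| <= `|x - y|.
Proof.
wlog xy : x y / y <= x.
  move=> H; have /orP[|yx] := le_total y x; first exact: H.
  by rewrite distrC [leRHS]distrC; exact: H.
have [c _ ->] := @MVT_segment R cos (fun z => - sin z) y x xy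
  (fun z _ => is_derive_cos z) (continuous_subspaceT (@continuous_cos R)).
by rewrite normrM normrN ler_piMl// sin_max.
Qed.

Lemma sin_lipschitz0 (R : realType) (x : R) : `|sin x| <= `|x|.
Proof.
have := cos_lipschitz (x - pi / 2) (- (pi / 2)).
by rewrite cosN cos_pihalf subr0 opprK subrK cosBpihalf.
Qed.

Section convergence_in_probability.
Context (R : realType) (dO : measure_display) (O : measurableType dO).
Variable P : probability O R.
Implicit Types (Z : nat -> O -> R) (Y : O -> R).

Lemma measurable_dev (F G : O -> R) e : measurable_fun setT F -> measurable_fun setT G ->
  measurable [set w | e <= `|F w - G w|].
Proof.
move=> mF mG; rewrite -[X in measurable X]setTI; apply: measurable_fun_le.
- exact: measurableT.
- exact: measurable_cst.
- by apply: measurableT_comp => //; exact: measurable_funB.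
Qed.

Lemma cvg_in_probabilityP Z Y : (forall n, measurable_fun setT (Z n)) -> measurable_fun setT Y ->
  cvg_in_probability P Z Y <->
  forall e : R, 0 < e -> forall r : R, 0 < r ->
    \forall n \near \oo, (P [set w | (e <= `|Z n w - Y w|)%R] <= r%:E)%E.
Proof.
move=> mZ mY; split=> [ZY e e0 r r0|ZY e e0].
  have /fine_cvgP[_ /cvgrPdist_le /(_ _ r0)] := ZY _ e0; apply: filterS => n /=.
  rewrite sub0r normrN ger0_norm ?fine_ge0// => h.
  by rewrite -[leLHS]fineK ?lee_fin// fin_num_measure//; exact: measurable_dev.
have E n : P [set w | e <= `|Z n w - Y w|] = (fine (P [set w | e <= `|Z n w - Y w|]))%:E.
  by rewrite fineK// fin_num_measure//; exact: measurable_dev.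
rewrite (funext E); apply: cvg_EFin; first exact: nearW.
apply/cvgrPdist_le => r r0; apply: filterS (ZY _ e0 _ r0) => n.
by rewrite E lee_fin => h; rewrite sub0r normrN /= ger0_norm ?fine_ge0.
Qed.

Lemma le_prob (A B : set O) : measurable A -> measurable B -> A `<=` B -> (P A <= P B)%E.
Proof. by move=> mA mB AB; apply: le_measure; rewrite ?inE. Qed.

Lemma cvg_in_probability_linear c Z Z' Y Y' :
  (forall n, measurable_fun setT (Z n)) -> (forall n, measurable_fun setT (Z' n)) ->
  measurable_fun setT Y -> measurable_fun setT Y' ->
  cvg_in_probability P Z Y -> cvg_in_probability P Z' Y' ->
  cvg_in_probability P (fun n w => c * Z n w + Z' n w) (fun w => c * Y w + Y' w).
Proof.
move=> mZ mZ' mY mY' ZY ZY'.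
have ml (F G : O -> R) : measurable_fun setT F -> measurable_fun setT G ->
    measurable_fun setT (fun w => c * F w + G w).
  by move=> mF mG; apply: measurable_funD => //; apply: measurable_funM => //; exact: measurable_cst.
apply/cvg_in_probabilityP => [n||e e0 r r0]; [exact: ml|exact: ml|].
have c0 : 0 < 2 * (`|c| + 1) by have := normr_ge0 c; lra.
have [h1 h2] : 0 < e / (2 * (`|c| + 1)) /\ 0 < r / 2 by rewrite !divr_gt0.
have h3 : 0 < e / 2 by rewrite divr_gt0.
have /cvg_in_probabilityP - /(_ mZ mY _ h1 _ h2) H1 := ZY.
have /cvg_in_probabilityP - /(_ mZ' mY' _ h3 _ h2) H2 := ZY'.
apply: filterS2 H1 H2 => n H1 H2.
rewrite (splitr r) EFinD (le_trans _ (leeD H1 H2))//.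
rewrite (le_trans _ (measureU2 _ _ _))//; try exact: measurable_dev.
apply: le_prob; [apply: measurable_dev; exact: ml|apply: measurableU; exact: measurable_dev|].
move=> w /= ew; apply: contrapT => /not_orP[/negP + /negP]; rewrite -!ltNge => k1 k2.
have k3 : `|c| * `|Z n w - Y w| <= e / 2.
  rewrite ltr_pdivlMr// in k1; have := normr_ge0 c; have := normr_ge0 (Z n w - Y w); nra.
move: ew; rewrite (_ : _ - _ = c * (Z n w - Y w) + (Z' n w - Y' w)); last by ring.
rewrite leNgt => /negP; apply.
by rewrite (le_lt_trans (ler_normD _ _))// normrM; lra.
Qed.

Lemma cvg_in_probability_ae Z Z' Y : 
  (forall n, measurable_fun setT (Z n)) -> (forall n, measurable_fun setT (Z' n)) ->
  measurable_fun setT Y -> (forall n, {ae P, forall w, Z n w = Z' n w}) ->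
  cvg_in_probability P Z Y -> cvg_in_probability P Z' Y.
Proof.
move=> mZ mZ' mY ZZ ZY e e0; have := ZY e e0.
rewrite (_ : (fun n => P _) = fun n => P [set w | (e <= `|Z' n w - Y w|)%R])//.
apply/funext => n.
have mA := measurable_dev e (mZ n) mY; have mB := measurable_dev e (mZ' n) mY.
rewrite -[in LHS](setIT [set w | _]) -[in RHS](setIT [set w | _]) -!integral_indic//.
apply: ae_eq_integral => //; try by apply/measurable_EFinP; exact: measurable_indic.
apply: filterS (ZZ n) => w Ew _; rewrite !indicE.
have -> // : (w \in [set w | e <= `|Z n w - Y w|]) = (w \in [set w | e <= `|Z' n w - Y w|]).
by apply/idP/idP; rewrite !inE /= Ew.
Qed.

(** The cosines differ by at most the distance of their arguments, and by at
    most [2] on the event of small probability where that distance is large. *)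
Lemma cvg_in_probability_cos th Z Y : (forall n, measurable_fun setT (Z n)) ->
  measurable_fun setT Y -> cvg_in_probability P Z Y ->
  \int[P]_w cos (th + Z n w) @[n --> \oo] --> \int[P]_w cos (th + Y w).
Proof.
move=> mZ mY ZY; apply/cvgrPdist_le => r r0.
have h2 : 0 < r / 2 by lra.
have h4 : 0 < r / 4 by lra.
have /cvg_in_probabilityP - /(_ mZ mY _ h2 _ h4) := ZY; apply: filterS => n H.
have bc (F : O -> R) : measurable_fun setT F -> brv (fun w => cos (th + F w)).
  by move=> mF; apply: brv_cos; apply: measurable_funD => //; exact: measurable_cst.
rewrite -exp_sub; [|exact: bc|exact: bc].
set A := [set w | _] in H; have mA : measurable A by exact: measurable_dev.
have bA : brv (fun w => 2 * \1_A w : R) by apply: brvZ; exact: brv_indic.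
have bB : brv (fun w => cos (th + Y w) - cos (th + Z n w)) by apply: brvB; exact: bc.
apply: le_trans (le_normr_Rintegral measurableT (brv_integrable P bB)) _.
apply: (@le_trans _ _ (\int[P]_w (cst (r / 2) w + 2 * \1_A w))).
  apply: exp_le.
  - split; first by apply: measurableT_comp => //; exact: bB.1.
    by have [_ [C hC]] := bB; exists C => w; rewrite normr_id.
  - by apply: brvD => //; exact: brv_cst.
  - move=> w; rewrite indicE /=; have [wA|wA] := boolP (w \in A).
      rewrite mulr1 (le_trans (ler_normB _ _))//.
      have c1 (x : R) : `|cos x| <= 1 by rewrite ler_norml cos_geN1 cos_le1.
      by have := c1 (th + Y w); have := c1 (th + Z n w); lra.
    rewrite mulr0 addr0 (le_trans (cos_lipschitz _ _))//.
    rewrite (_ : _ - _ = - (Z n w - Y w)); last by ring.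
    by rewrite normrN; move: wA; rewrite notin_setE /A /= => /negP; rewrite -ltNge => /ltW.
rewrite exp_add//; last exact: brv_cst.
rewrite exp_cst exp_scale; last exact: brv_indic.
rewrite exp_indic//; have : fine (P A) <= r / 4.
  by rewrite -lee_fin fineK// fin_num_measure.
lra.
Qed.

End convergence_in_probability.

Section stable_integrals.
Context (R : realType) (alpha : R) (alpha0 : 0 < alpha) (alpha2 : alpha < 2).
Context (dS : measure_display) (S : measurableType dS).
Variable mu : {measure set S -> \bar R}.
Context (dO : measure_display) (O : measurableType dO) (P : probability O R).
Variable M : set S -> {RV P >-> R}.
Hypothesis MS : SaS_random_measure alpha mu M.

Local Notation sfn := ({sfun S >-> measurableTypeR R}).
Local Notation Lp := (inLp alpha mu).
Local Notation mass := (amass alpha mu).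

(** [is_stable_integral] for raw functions, with the convergence in mean of
    order [alpha] expressed in the reals. *)
Definition stable_int (g : S -> R) (Y : O -> R) := [/\ Lp g, measurable_fun setT Y &
  exists h : nat -> sfn, [/\ forall n, Lp (h n),
    mass (fun x => g x - h n x) @[n --> \oo] --> 0 &
    cvg_in_probability P (fun n => simple_integral M (h n)) Y]].

Lemma stable_intP g (Y : {RV P >-> R}) :
  is_stable_integral alpha mu M g Y <-> stable_int g Y.
Proof.
have E (h : nat -> sfn) : Lp g -> (forall n, Lp (h n)) ->
    (fun n => \int[mu]_x (`|g x - h n x| `^ alpha)%:E)%E =
    fun n => (mass (fun x => g x - h n x))%:E.
  by move=> Lg Lh; apply/funext => n; rewrite amassE//; exact: inLpB.
split=> [[/(inLp_Lfun alpha0) Lg [h [Lh gh hY]]]|[Lg mY [h [Lh gh hY]]]].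
  have {}Lh n : Lp (h n) by exact/(inLp_Lfun alpha0).
  split => //; exists h; split => //.
  by rewrite (E h Lg Lh) in gh; exact: (fine_cvg gh).
split; first exact/(inLp_Lfun alpha0).
exists h; split => //; first by move=> n; exact/(inLp_Lfun alpha0).
by rewrite (E h Lg Lh); apply: cvg_EFin => //; exact: nearW.
Qed.

Lemma stable_int_linear c g g' Y Y' : stable_int g Y -> stable_int g' Y' ->
  stable_int (fun x => c * g x + g' x) (fun w => c * Y w + Y' w).
Proof.
move=> [Lg mY [h [Lh gh hY]]] [Lg' mY' [h' [Lh' gh' hY']]].
pose k n : sfn := cst c \* h n \+ h' n.
have kE n x : k n x = c * h n x + h' n x by [].
have Lk n : Lp (k n) by apply: (inLpD alpha0) => //; exact: inLpZ.
split.
- by apply: inLpD => //; exact: inLpZ.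
- by apply: measurable_funD => //; apply: measurable_funM => //; exact: measurable_cst.
exists k; split; first exact: Lk.
- pose e n := 2 `^ alpha * (`|c| `^ alpha * mass (fun x => g x - h n x) +
     mass (fun x => g' x - h' n x)).
  apply: (@squeeze_cvgr _ _ _ _ (cst 0) e).
  + apply: nearW => n; rewrite amass_ge0 /=.
    have L1 : Lp (fun x => c * (g x - h n x)) by apply: inLpZ => //; exact: inLpB.
    have L2 : Lp (fun x => g' x - h' n x) by exact: inLpB.
    rewrite /e -amassZ//; last exact: inLpB.
    have := amassD alpha0 ltr01 L1 L2; rewrite invr1 (_ : 1 + 1 = 2)// -mulrDr.
    apply: le_trans; rewrite le_eqVlt; apply/orP; left; apply/eqP.
    by apply: eq_Rintegral => x _; congr (`|_| `^ _); ring.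
  + exact: cvg_cst.
  + rewrite -(mulr0 (2 `^ alpha)) -[X in _ * X](addr0 0) -{1}(mulr0 (`|c| `^ alpha)).
    apply: cvgM; first exact: cvg_cst.
    by apply: cvgD; [apply: cvgM; [exact: cvg_cst|exact: gh]|exact: gh'].
- have mI (f : sfn) : measurable_fun setT (simple_integral M f).
    exact: measurable_simple_integral.
  apply: (@cvg_in_probability_ae _ _ _ _
     (fun n w => c * simple_integral M (h n) w + simple_integral M (h' n) w)) => //.
  + by move=> n; apply: measurable_funD => //; apply: measurable_funM => //; exact: measurable_cst.
  + by apply: measurable_funD => //; apply: measurable_funM => //; exact: measurable_cst.
  + move=> n; have := simple_integral_linear MS (Lh n) (Lh' n) (Lk n) (kE n).
    by apply: filterS => w ->.
  + by apply: cvg_in_probability_linear.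
Qed.

Lemma stable_int0 : stable_int (fun _ => 0) (fun _ => 0).
Proof.
have L0 : Lp (fun=> 0) by exact: inLp0.
split => //; exists (fun=> cst 0 : sfn); split => //.
- have -> : mass (fun x => 0 - (cst 0 : sfn) x) = 0.
    by rewrite -[RHS](amass0 alpha0 mu); apply: eq_Rintegral => x _; rewrite /= subr0.
  exact: cvg_cst.
- move=> e e0; rewrite (_ : (fun n => _) = cst 0%E); first exact: cvg_cst.
  apply/funext => n; rewrite (_ : [set w | _] = set0) ?measure0//.
  rewrite -subset0 => w /=; rewrite simple_integralE big1_seq.
    by rewrite subrr normr0 leNgt e0.
  by move=> y /=; rewrite nzrangeP => /andP[y0]; rewrite inE => -[x _ /= xy]; rewrite -xy eqxx in y0.
Qed.

Lemma stable_int_ev (T : Type) (G : T -> S -> R) (Y : T -> O -> R) a :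
  (forall t, stable_int (G t) (Y t)) ->
  stable_int (fun x => ev a (G^~ x)) (fun w => ev a (Y^~ w)).
Proof.
move=> GY; elim: a => [|p a IH].
  under eq_fun do rewrite ev_nil; under [X in stable_int _ X]eq_fun do rewrite ev_nil.
  exact: stable_int0.
under eq_fun do rewrite ev_cons; under [X in stable_int _ X]eq_fun do rewrite ev_cons.
exact: stable_int_linear.
Qed.

Lemma stable_int_char g Y th : stable_int g Y ->
  \int[P]_w cos (th + Y w) = cos th * expR (- mass g).
Proof.
move=> [Lg mY [h [Lh gh hY]]].
have mI n : measurable_fun setT (simple_integral M (h n)) by exact: measurable_simple_integral.
have := @cvg_in_probability_cos _ _ _ P th _ _ mI mY hY.
rewrite (funext (fun n => simple_integral_char alpha0 MS th (Lh n))) => c1.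
have hg : mass (fun x => h n x - g x) @[n --> \oo] --> 0.
  by under eq_fun do rewrite amass_distC.
have c2 := amass_cvg alpha0 Lh Lg alpha2 hg.
have c3 : cos th * expR (- mass (h n)) @[n --> \oo] --> cos th * expR (- mass g).
  apply: cvgM; first exact: cvg_cst.
  by apply: continuous_cvg; [exact: continuous_expR|exact: cvgN].
exact: (cvg_unique _ c1 c3).
Qed.

Lemma stable_int_exponent (T : Type) (G : T -> S -> R) (Y : T -> O -> R) :
  (forall t, stable_int (G t) (Y t)) ->
  sas_exponent alpha P Y (fun a => mass (fun x => ev a (G^~ x))).
Proof.
move=> GY; have Lev a : Lp (fun x => ev a (G^~ x)) by have [] := stable_int_ev a GY.
split.
- by move=> t; have [] := GY t.
- by move=> a; exact: amass_ge0.
- by move=> c a; rewrite -(amassZ c (Lev a)); apply: eq_Rintegral => x _; rewrite ev_scale.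
- by move=> th a; apply: stable_int_char; exact: stable_int_ev.
Qed.

End stable_integrals.

Section existence_of_integrals.
Context (R : realType) (alpha : R) (alpha0 : 0 < alpha) (alpha2 : alpha < 2).
Context (dO : measure_display) (O : measurableType dO) (P : probability O R).

Lemma mkRV (F : O -> R) : measurable_fun setT F -> exists Y : {RV P >-> R}, Y = F :> (O -> R).
Proof.
move=> mF; pose Y : {RV P >-> R} := HB.pack F (isMeasurableFun.Build _ _ _ _ F mF).
by exists Y.
Qed.

(** All symmetric stable laws are rescalings of a single one, so small scale
    forces small tails. *)
Lemma stable_tail (Z0 : O -> R) : measurable_fun setT Z0 ->
  (forall c th, \int[P]_w cos (th + c * Z0 w) = cos th * expR (- (`|c| `^ alpha))) ->
  forall e r : R, 0 < e -> 0 < r -> exists2 dl : R, 0 < dl &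
    forall (Z : O -> R) m, measurable_fun setT Z -> 0 <= m <= dl ->
      (forall c th, \int[P]_w cos (th + c * Z w) = cos th * expR (- (`|c| `^ alpha * m))) ->
      (P [set w | (e <= `|Z w|)%R] <= r%:E)%E.
Proof.
move=> mZ0 Z0c e r e0 r0.
have mset (F : O -> R) c : measurable_fun setT F -> measurable [set w | c <= `|F w|].
  move=> mF; rewrite -[X in measurable X]setTI; apply: measurable_fun_le => //.
  exact: measurableT_comp.
have [K K0 HK] : exists2 K : R, 0 < K & (P [set w | (K <= `|Z0 w|)%R] <= r%:E)%E.
  pose A n := [set w | n.+1%:R <= `|Z0 w|].
  have mA n : measurable (A n) by exact: mset.
  have [] := @exp_cvg _ _ _ P (fun n => \1_(A n)) (cst 0) 1.
  - by move=> n; exact: measurable_indic.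
  - by move=> n w; rewrite indicE; case: (_ \in _); rewrite ?normr1 ?normr0.
  - move=> w; apply: cvg_near_cst; exists (Num.truncn `|Z0 w|) => // n /= nw.
    rewrite indicE memNset// /A /= => h; have := le_lt_trans h (truncnS_gt _).
    by rewrite ltr_nat ltnS ltnNge nw.
  move=> _; rewrite (exp_cst P 0) => /cvgrPdist_le /(_ _ r0) [n _ /(_ n (leqnn n)) /=].
  rewrite sub0r normrN exp_indic// ger0_norm ?fine_ge0// => h.
  exists n.+1%:R => //; rewrite -[leLHS]fineK ?lee_fin// fin_num_measure//; exact: mset.
exists ((e / K) `^ alpha); first by rewrite powR_gt0// divr_gt0.
move=> Z m mZ /andP[m0 md] Zc; pose s := m `^ alpha^-1.
have s0 : 0 <= s by exact: powR_ge0.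
have sa : s `^ alpha = m by rewrite /s -powRrM mulVf ?gt_eqF// powRr1.
have se : s <= e / K.
  rewrite -[leRHS](_ : ((e / K) `^ alpha) `^ alpha^-1 = _).
    by apply: ge0_ler_powR; rewrite ?nnegrE ?powR_ge0// invr_ge0 ltW.
  by rewrite -powRrM mulfV ?gt_eqF// powRr1// divr_ge0// ltW.
pose X (t : unit) := Z; pose Y (t : unit) w := s * Z0 w.
have mY : measurable_fun setT (fun w => s * Z0 w).
  by apply: measurable_funM => //; exact: measurable_cst.
have evE (a : lincomb R unit) (F : O -> R) w :
    ev a (fun=> F w) = (\sum_(p <- a) p.1) * F w by rewrite /ev big_distrl.
have XY : fdd_eq P X P Y.
  apply: char_fdd_eq => //= th a; rewrite /X /Y.
  under eq_Rintegral do rewrite evE.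
  under [RHS]eq_Rintegral do rewrite (evE a (fun w => s * Z0 w)) mulrA.
  by rewrite Zc Z0c normrM powRM// (ger0_norm s0) sa.
have := XY 1%N (fun=> tt) [set u | e <= `|tnth u ord0|].
have mB : measurable [set u : Rd R 1 | e <= `|tnth u ord0|].
  rewrite -[X in measurable X]setTI; apply: measurable_fun_le => //.
  by apply: measurableT_comp => //; exact: measurable_tnth.
move=> /(_ mB) /=; rewrite /X /Y.
under eq_set do rewrite tnth_mktuple.
under [X in _ = P X]eq_set do rewrite tnth_mktuple.
move=> ->; apply: le_trans HK; apply: le_prob; [exact: mset|exact: mset|].
move=> w /=; rewrite normrM (ger0_norm s0) => h.
have := le_trans h (ler_wpM2r (normr_ge0 _) se).
by rewrite mulrAC ler_pdivlMr// ler_pM2l.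
Qed.

(** By the Borel-Cantelli lemma the increments are almost surely eventually
    below a geometric sequence, so [W] converges almost surely. *)
Lemma summable_dev_cvg (W : nat -> O -> R) : (forall n, measurable_fun setT (W n)) ->
  (forall k, (P [set w | ((2^-1) ^+ k <= `|W k.+1 w - W k w|)%R] <= ((2^-1) ^+ k)%:E)%E) ->
  exists Y : {RV P >-> R}, cvg_in_probability P W Y.
Proof.
move=> mW PW; pose F k := [set w | (2^-1) ^+ k <= `|W k.+1 w - W k w|].
have mF k : measurable (F k) by exact: measurable_dev.
pose N := lim_sup_set F.
have mN : measurable N by apply: bigcap_measurable => // n _; apply: bigcup_measurable.
have N0 : P N = 0%E.
  apply: lim_sup_set_cvg0 => //.
  apply: (@le_lt_trans _ _ (\sum_(0 <= k <oo) (2 / (2 ^ (k + 1))%:R)%:E)%E).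
    apply: lee_nneseries => // k _; rewrite (le_trans (PW k))// lee_fin.
    by rewrite addn1 natrX exprS invfM mulrA mulfV// mul1r exprVn.
  have := @cvg_geometric_eseries_half R 2 0; rewrite expr0 divr1.
  by move/cvg_lim => -> //; exact: ltry.
have cW w : ~ N w -> cvgn (W^~ w).
  move=> /existsNP[n /not_implyP[_ nF]].
  have small j : (n <= j)%N -> `|W j.+1 w - W j w| < (2^-1) ^+ j.
    move=> nj; rewrite ltNge; apply/negP => h; apply: nF; exists j => //.
  have : cvgn (fun k => W (k + n)%N w).
    have := @telescopeK R (fun k => W (k + n)%N w).
    have : cvgn (series (telescope (fun k => W (k + n)%N w))).
      apply: normed_cvg; apply: (@series_le_cvg _ _ (geometric 1 (2^-1))).
      - by move=> k; exact: normr_ge0.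
      - by move=> k; rewrite /= mul1r exprn_ge0.
      - move=> k; rewrite /= mul1r /telescope /= addSn ltW// (lt_le_trans (small _ _)) ?leq_addl//.
        by rewrite exprD ler_piMr ?exprn_ge0// exprn_ile1//; lra.
      - by apply: is_cvg_geometric_series; rewrite ger0_norm; lra.
    move=> h E; rewrite E in h.
    rewrite (_ : (fun k => _) = (fun k => (W (k + n)%N w - W (0 + n)%N w) + W (0 + n)%N w)).
      by apply: is_cvgD => //; exact: is_cvg_cst.
    by apply/funext => k; rewrite subrK.
  by move=> /cvg_ex[l h]; apply/cvg_ex; exists l; rewrite -(cvg_shiftn n).
pose W' k w := W k w * \1_(~` N) w.
have mW' k : measurable_fun setT (W' k).
  by apply: measurable_funM => //; apply: measurable_indic; exact: measurableC.
have cW' w : cvgn (W'^~ w).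
  have [Nw|Nw] := pselect (N w).
    rewrite (_ : W'^~ w = cst 0); first exact: is_cvg_cst.
    by apply/funext => k; rewrite /W' indicE in_setC mem_set// mulr0.
  rewrite (_ : W'^~ w = W^~ w); first exact: cW.
  by apply/funext => k; rewrite /W' indicE mem_set// mulr1.
pose Y0 w := limn (W'^~ w).
have mY0 : measurable_fun setT Y0.
  by apply: (measurable_fun_cvg mW') => w _; exact: cW'.
have [Y YE] := mkRV mY0; exists Y => e e0; rewrite YE.
pose A n := [set w | e <= `|W n w - Y0 w|].
have mA n : measurable (A n) by exact: measurable_dev.
have [] := @dominated_convergence _ _ _ P setT measurableT
  (fun n w => (\1_(A n) w)%:E) (cst 0%E) (cst 1%E).
- by move=> n; apply/measurable_EFinP; exact: measurable_indic.
- exact: measurable_cst.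
- exists N; split => // w /= /not_implyP[_ h]; apply: contrapT => Nw; apply: h.
  have : W k w @[k --> \oo] --> Y0 w.
    have := cW' w; rewrite /Y0 (_ : W'^~ w = W^~ w)//.
    by apply/funext => k; rewrite /W' indicE mem_set// mulr1.
  move=> /cvgrPdist_lt /(_ _ e0) h; apply: cvg_near_cst; apply: filterS h => n.
  rewrite distrC => h; rewrite indicE memNset// /A /=.
  by apply/negP; rewrite -ltNge.
- exact: finite_measure_integrable_cst.
- apply: aeW => w n _; rewrite /= lee_fin indicE.
  by case: (_ \in _); rewrite ?normr1 ?normr0.
have E : (fun n => \int[P]_w (\1_(A n) w)%:E)%E = fun n => P (A n).
  by apply/funext => n; rewrite integral_indic// setIT.
by move=> _ _; rewrite integral0 E.
Qed.

Section random_measure_integral.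
Context (dS : measure_display) (S : measurableType dS).
Variable mu : {measure set S -> \bar R}.
Variable M : set S -> {RV P >-> R}.
Hypothesis MS : SaS_random_measure alpha mu M.

Local Notation sfn := ({sfun S >-> measurableTypeR R}).

(** Simple functions that approximate [g] fast enough have integrals that
    satisfy the hypothesis of [summable_dev_cvg]. The set [A0] of measure one
    supplies the reference variable of [stable_tail]. *)
Lemma stable_int_exists (A0 : set S) (g : S -> R) : measurable A0 -> mu A0 = 1%E ->
  inLp alpha mu g -> exists Y : {RV P >-> R}, is_stable_integral alpha mu M g Y.
Proof.
move=> mA0 muA0 Lg.
have [Mc _ _] := MS.
have fA0 : finite_measurable mu A0 by split => //; rewrite muA0 ltry.
have mZ0 : measurable_fun setT (M A0) by exact: measurable_funPT.
have Z0c c th : \int[P]_w cos (th + c * M A0 w) = cos th * expR (- (`|c| `^ alpha)).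
  have := Mc _ fA0 c; rewrite /charfun muA0 mul1r => -[Ec Es].
  have mk : measurable_fun setT (fun w => c * M A0 w).
    by apply: measurable_funM => //; exact: measurable_cst.
  under eq_Rintegral do rewrite cosD.
  rewrite exp_sub; last 2 first.
  - by apply: brvZ; exact: brv_cos.
  - by apply: brvZ; exact: brv_sin.
  rewrite !exp_scale; [|exact: brv_sin|exact: brv_cos].
  by rewrite Ec Es mulr0 subr0.
have half k : (0 : R) < (2^-1) ^+ k by exact: exprn_gt0.
have T k : exists dl : R, 0 < dl /\ forall (Z : O -> R) m, measurable_fun setT Z ->
    0 <= m <= dl ->
    (forall c th, \int[P]_w cos (th + c * Z w) = cos th * expR (- (`|c| `^ alpha * m))) ->
    (P [set w | ((2^-1) ^+ k <= `|Z w|)%R] <= ((2^-1) ^+ k)%:E)%E.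
  by have [dl d0 H] := stable_tail mZ0 Z0c (half k) (half k); exists dl.
pose dl k := projT1 (cid (T k)).
have dl0 k : 0 < dl k by exact: (projT2 (cid (T k))).1.
have dlP k (Z : O -> R) m : measurable_fun setT Z -> 0 <= m <= dl k ->
    (forall c th, \int[P]_w cos (th + c * Z w) = cos th * expR (- (`|c| `^ alpha * m))) ->
    (P [set w | ((2^-1) ^+ k <= `|Z w|)%R] <= ((2^-1) ^+ k)%:E)%E.
  exact: (projT2 (cid (T k))).2.
pose C : R := 2 `^ alpha * 2.
have C0 : 0 < C by rewrite mulr_gt0// powR_gt0.
(* [dm] is decreasing and below [dl k / C], so that [stable_tail] applies to
   the increments, and it tends to [0]. *)
pose dm := fix f k := if k is j.+1 then Num.min (f j) (Num.min (dl k / C) ((2^-1) ^+ k))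
   else Num.min (dl 0 / C) 1.
have dm0 k : 0 < dm k.
  elim: k => [|k IH] /=; rewrite !lt_min ?IH ?half ?ltr01 ?andbT divr_gt0//.
have dmS k : dm k.+1 <= dm k by rewrite /= ge_min lexx.
have dmdl k : dm k <= dl k / C by case: k => [|k] /=; rewrite !ge_min lexx ?orbT.
have dmh k : dm k <= (2^-1) ^+ k.
  by case: k => [|k] /=; rewrite !ge_min ?expr0 lexx ?orbT.
have Hh k : exists h : sfn, inLp alpha mu h /\ amass alpha mu (fun x => g x - h x) <= dm k.
  have [u [Lu /cvgrPdist_le /(_ _ (dm0 k)) [n _ /(_ n (leqnn n)) /=]]] := inLp_sfun_dense alpha0 Lg.
  by rewrite sub0r normrN ger0_norm ?amass_ge0// => hn; exists (u n).
pose h k := projT1 (cid (Hh k)).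
have Lh k : inLp alpha mu (h k) by exact: (projT2 (cid (Hh k))).1.
have gh k : amass alpha mu (fun x => g x - h k x) <= dm k by exact: (projT2 (cid (Hh k))).2.
pose W k := simple_integral M (h k).
have mW k : measurable_fun setT (W k) by exact: measurable_simple_integral.
have WP k : (P [set w | ((2^-1) ^+ k <= `|W k.+1 w - W k w|)%R] <= ((2^-1) ^+ k)%:E)%E.
  apply: (@dlP k _ (amass alpha mu (fun x => h k.+1 x - h k x))).
  - exact: measurable_funB.
  - rewrite amass_ge0/= (le_trans (amass_triangle alpha0 (Lh k.+1) Lg (Lh k)))//.
    rewrite [X in _ * (X + _)]amass_distC.
    apply: (@le_trans _ _ (2 `^ alpha * (dm k + dm k))).
      rewrite ler_wpM2l ?powR_ge0// lerD//; exact: le_trans (gh _) (dmS _).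
    have := dmdl k; rewrite ler_pdivlMr// /C => e.
    by rewrite (_ : _ * (_ + _) = dm k * (2 `^ alpha * 2))//; ring.
  - move=> c th.
    pose f : sfn := cst c \* (h k.+1 \+ cst (-1) \* h k).
    have fE x : f x = c * (h k.+1 x - h k x) by rewrite /f /= mulN1r.
    have Ld : inLp alpha mu (fun x => h k.+1 x - h k x) by exact: inLpB.
    have Lf : inLp alpha mu f by rewrite (funext fE : (f : S -> R) = _); exact: inLpZ.
    pose q : sfn := h k.+1 \+ cst (-1) \* h k.
    have qE x : q x = -1 * h k x + h k.+1 x by rewrite /q /= addrC.
    have Lq : inLp alpha mu q.
      rewrite (_ : (q : S -> R) = fun x => h k.+1 x - h k x)//.
      by apply/funext => x; rewrite qE mulN1r addrC.
    pose z : sfn := cst 0.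
    have Lz : inLp alpha mu z by exact: inLp0.
    have fq x : f x = c * q x + z x by rewrite fE qE /z /= addr0 mulN1r [in RHS]addrC.
    have z0 w : simple_integral M z w = 0.
      rewrite simple_integralE big1_seq// => y /=; rewrite nzrangeP => /andP[y0].
      by rewrite inE => -[x _ /= xy]; rewrite -xy eqxx in y0.
    have ae1 := simple_integral_linear MS Lq Lz Lf fq.
    have ae2 := simple_integral_linear MS (Lh k) (Lh k.+1) Lq qE.
    have := simple_integral_char alpha0 MS th Lf.
    have mI (g' : sfn) : measurable_fun setT (simple_integral M g').
      exact: measurable_simple_integral.
    rewrite (_ : amass alpha mu f = `|c| `^ alpha * amass alpha mu (fun x => h k.+1 x - h k x)); last first.
      by rewrite -(amassZ c Ld); apply: eq_Rintegral => x _; rewrite fE.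
    move=> <-; rewrite /Rintegral; congr fine; apply: ae_eq_integral => //.
    + apply/measurable_EFinP; apply: (brv_cos _).1; apply: measurable_funD; first exact: measurable_cst.
      by apply: measurable_funM; [exact: measurable_cst|exact: measurable_funB].
    + by apply/measurable_EFinP; apply: (brv_cos _).1; apply: measurable_funD => //; exact: measurable_cst.
    + apply: filterS2 ae1 ae2 => w E1 E2 _; congr (cos (_ + _))%:E.
      by rewrite E1 E2 z0 /W addr0 mulN1r [in RHS]addrC.
have [Y WY] := summable_dev_cvg mW WP.
exists Y; apply/(stable_intP alpha0); split => //; exists h; split => //.
apply: (@squeeze_cvgr _ _ _ _ (cst 0) (fun k => (2^-1) ^+ k)).
- by apply: nearW => k; rewrite amass_ge0 /= (le_trans (gh k)).
- exact: cvg_cst.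
- by apply: cvg_expr; rewrite ger0_norm; lra.
Qed.

End random_measure_integral.

End existence_of_integrals.

(** * Boxes and translations in Euclidean space *)

Section boxes.
Context (R : realType) (d : nat).
Implicit Types (b c : 'I_d -> R) (t u : Rd R d).

Definition box b c : set (Rd R d) := [set u | forall i, b i <= tnth u i < c i].

Definition boxes : set (set (Rd R d)) := [set A | exists b c, A = box b c].

Lemma measurable_coord (A : 'I_d -> set (measurableTypeR R)) : (forall i, measurable (A i)) ->
  measurable [set u : Rd R d | forall i, A i (tnth u i)].
Proof.
move=> mA; rewrite (_ : [set u | _] =
    \bigcap_(i in [set: 'I_d]) ((fun u : Rd R d => tnth u i) @^-1` A i)).
  apply: fin_bigcap_measurable => // i _; rewrite -[X in measurable X]setTI.
  exact: measurable_tnth.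
by apply/seteqP; split => t /= h i; [move=> _|]; exact: h.
Qed.

Lemma boxE b c : box b c = [set u | forall i, `[b i, c i[%classic (tnth u i)].
Proof. by apply/seteqP; split => u /= h i; have := h i; rewrite in_itv. Qed.

Lemma measurable_box b c : measurable (box b c).
Proof.
rewrite boxE; apply: (measurable_coord (A := fun i => `[b i, c i[%classic)) => i.
exact: measurable_itv.
Qed.

Lemma lebesgue_box b c :
  lebesgue_Rd R d (box b c) = (\prod_(i < d) (Num.max 0 (c i - b i)))%:E.
Proof.
rewrite boxE (lebesgue_Rd_rectangle (B := fun i => `[b i, c i[%classic)) => [|i]; last first.
  exact: measurable_itv.
rewrite -prodEFin; apply: eq_bigr => i _; rewrite lebesgue_measure_itv/= lte_fin.
have [bc|cb] := ltP (b i) (c i).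
  by rewrite (max_idPr _)// subr_ge0 ltW.
by rewrite (max_idPl _)// subr_le0.
Qed.

Lemma boxI b c b' c' : box b c `&` box b' c' =
  box (fun i => Num.max (b i) (b' i)) (fun i => Num.min (c i) (c' i)).
Proof.
apply/seteqP; split => u /=.
  by move=> [h h'] i; have /andP[h1 h2] := h i; have /andP[h3 h4] := h' i;
    rewrite ge_max lt_min h1 h2 h3 h4.
move=> h; split=> i; have := h i; rewrite ge_max lt_min.
  by move=> /andP[/andP[-> _] /andP[-> _]].
by move=> /andP[/andP[_ ->] /andP[_ ->]].
Qed.

Lemma boxes_setI : setI_closed boxes.
Proof. by move=> _ _ [b [c ->]] [b' [c' ->]]; rewrite boxI; do 2 eexists. Qed.

Definition cube n := box (fun=> - n%:R) (fun=> n%:R).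

Lemma finord_ub (v : 'I_d -> R) : exists n : nat, forall i, `|v i| < n%:R.
Proof.
exists (\max_(i < d) (Num.truncn `|v i|).+1)%N => i.
rewrite (lt_le_trans (truncnS_gt `|v i|))// ler_nat.
exact: (leq_bigmax (F := fun i => (Num.truncn `|v i|).+1)).
Qed.

Lemma cube_cover : \bigcup_n cube n = setT.
Proof.
rewrite -subTset => u _; have [n nu] := finord_ub (tnth u).
exists n => // i; have := nu i; rewrite ltr_norml => /andP[h1 h2].
by rewrite h2 ltW.
Qed.

Lemma cube_ndecr n m : (n <= m)%N -> cube n `<=` cube m.
Proof.
move=> nm u h i; have /andP[h1 h2] := h i; apply/andP; split.
  by rewrite (le_trans _ h1)// lerN2 ler_nat.
by rewrite (lt_le_trans h2)// ler_nat.
Qed.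

Lemma measurable_boxes : measurable = <<s boxes >> :> set (set (Rd R d)).
Proof.
apply/seteqP; split; last first.
  apply: smallest_sub; first exact: sigma_algebra_measurable.
  by move=> _ [b [c ->]]; exact: measurable_box.
apply: smallest_sub; first exact: smallest_sigma_algebra.
move=> B; rewrite -bigcup_seq => -[i _ [C mC <-]]; rewrite setTI.
move: C mC; rewrite RGenCInfty.measurableE.
apply: (generated_preimage (smallest_sigma_algebra setT boxes) (f := fun u => tnth u i)).
move=> _ [x ->].
rewrite (_ : _ @^-1` _ = \bigcup_n
    box (fun j => if j == i then x else - n%:R) (fun=> n%:R)).
  have [_ _ SU] := smallest_sigma_algebra setT boxes.
  apply: SU => n; apply: sub_gen_smallest; do 2 eexists; reflexivity.
apply/seteqP; split => u /=.
  rewrite in_itv /= andbT => xu; have [n nu] := finord_ub (tnth u).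
  exists n => // j; have := nu j; rewrite ltr_norml => /andP[h1 h2]; rewrite h2 andbT.
  by case: eqP => [->|_]//; exact: ltW.
by move=> [n _ /(_ i)]; rewrite eqxx in_itv /= andbT => /andP[].
Qed.

Lemma tnth_addRd t u i : tnth (addRd t u) i = tnth t i + tnth u i.
Proof. by rewrite tnth_mktuple. Qed.

Lemma addRdA t u v : addRd t (addRd u v) = addRd (addRd t u) v.
Proof. by apply: eq_from_tnth => i; rewrite !tnth_addRd addrA. Qed.

Lemma addRdC t u : addRd t u = addRd u t.
Proof. by apply: eq_from_tnth => i; rewrite !tnth_addRd addrC. Qed.

Definition zeroRd : Rd R d := [tuple 0 | i < d].

Lemma add0Rd t : addRd zeroRd t = t.
Proof. by apply: eq_from_tnth => i; rewrite tnth_addRd tnth_mktuple add0r. Qed.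

Lemma measurable_addRd t : measurable_fun setT (addRd t).
Proof.
apply/measurable_fun_tnthP => i; rewrite /comp.
under eq_fun do rewrite tnth_addRd.
by apply: measurable_funD; [exact: measurable_cst|exact: measurable_tnth].
Qed.

Lemma addRd_box t b c :
  addRd t @^-1` box b c = box (fun i => b i - tnth t i) (fun i => c i - tnth t i).
Proof.
apply/seteqP; split => u /= h i; have := h i.
  by rewrite tnth_addRd lerBlDl ltrBrDl.
by rewrite tnth_addRd lerBlDl ltrBrDl.
Qed.

Lemma lebesgue_addRd t (A : set (Rd R d)) : measurable A ->
  lebesgue_Rd R d (addRd t @^-1` A) = lebesgue_Rd R d A.
Proof.
move=> mA.
pose T : {mfun Rd R d >-> Rd R d} :=
  HB.pack (addRd t) (isMeasurableFun.Build _ _ _ _ _ (measurable_addRd t)).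
apply: (@measure_unique _ R _ boxes cube measurable_boxes boxes_setI _ cube_cover
  (pushforward (lebesgue_Rd R d) T) (lebesgue_Rd R d)) => //.
- by move=> n; do 2 eexists; reflexivity.
- move=> _ [b [c ->]]; rewrite -[LHS]/(lebesgue_Rd R d (addRd t @^-1` box b c)) addRd_box lebesgue_box [RHS]lebesgue_box.
  by congr EFin; apply: eq_bigr => i _; congr (Num.max _ _); ring.
- move=> n; rewrite -[X in (X < _)%E]/(lebesgue_Rd R d (addRd t @^-1` cube n)).
  by rewrite addRd_box lebesgue_box ltry.
Qed.

Lemma ge0_integral_addRd t (f : Rd R d -> \bar R) :
  measurable_fun setT f -> (forall u, (0 <= f u)%E) ->
  (\int[lebesgue_Rd R d]_u f (addRd t u) = \int[lebesgue_Rd R d]_u f u)%E.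
Proof.
move=> mf f0.
have := @ge0_integral_pushforward _ _ _ _ _ _ (measurable_addRd t) (lebesgue_Rd R d) setT f
  measurableT mf (fun y _ => f0 y).
rewrite preimage_setT => <-.
apply: eq_measure_integral => [|? A mA _]; first exact: measurable_addRd.
exact: lebesgue_addRd.
Qed.

Lemma lebesgue_unit_cube : lebesgue_Rd R d (box (fun=> 0) (fun=> 1)) = 1%E.
Proof.
rewrite lebesgue_box big1// => i _; rewrite subr0 (max_idPr _)//.
Qed.

End boxes.

(** * Density of a generating family of sets *)

Section density.
Context (R : realType) (alpha : R) (alpha0 : 0 < alpha).
Context (dS : measure_display) (S : measurableType dS).
Variable mu : {measure set S -> \bar R}.
Local Notation Lp := (inLp alpha mu).
Local Notation mass := (amass alpha mu).

Lemma inLp_indic (A : set S) : measurable A -> (mu A < +oo)%E -> Lp (\1_A).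
Proof.
move=> mA fA; split; first exact: measurable_indic.
rewrite (_ : _ \o _ = fun x => (\1_A x)%:E); last first.
  apply/funext => x /=; rewrite indicE; case: (_ \in _).
    by rewrite normr1 powR1.
  by rewrite normr0 powR0// gt_eqF.
apply/integrableP; split; first by apply/measurable_EFinP; exact: measurable_indic.
under eq_integral do rewrite gee0_abs ?lee_fin//.
by rewrite integral_indic// setIT.
Qed.

(** A class stable under linear combinations and limits in mean of order
    [alpha] that contains the indicators of a generating pi-system exhausting
    the space contains everything, by Dynkin's theorem. *)
Lemma Lp_density (G : set (set S)) (E : nat -> set S) (K : (S -> R) -> Prop) :
  measurable = <<s G >> -> setI_closed G -> (forall n, G (E n)) ->
  (forall n m, (n <= m)%N -> E n `<=` E m) -> \bigcup_n E n = setT ->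
  (forall n, (mu (E n) < +oo)%E) ->
  (forall f g c, Lp f -> Lp g -> K f -> K g -> K (fun x => c * f x + g x)) ->
  (forall f, Lp f -> (forall e, 0 < e -> exists g, [/\ Lp g, K g &
     mass (fun x => f x - g x) <= e]) -> K f) ->
  (forall A, G A -> (mu A < +oo)%E -> K (\1_A)) ->
  forall f, Lp f -> K f.
Proof.
move=> mG GI GE ndE UE fE Klin Klim KG.
have mGA A : G A -> measurable A by move=> GA; rewrite mG; exact: sub_gen_smallest.
have mE n : measurable (E n) by exact: mGA.
have finI A n : measurable A -> (mu (A `&` E n) < +oo)%E.
  move=> mA; apply: le_lt_trans (fE n); apply: le_measure; rewrite ?inE//.
  exact: measurableI.
have LI A n : measurable A -> Lp (\1_(A `&` E n)).
  by move=> mA; apply: inLp_indic; [exact: measurableI|exact: finI].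
have KE n : K (\1_(E n)) by exact: KG.
have LE n : Lp (\1_(E n)) by exact: inLp_indic.
have K0 : K (fun=> 0).
  have := Klin _ _ (-1) (LE 0%N) (LE 0%N) (KE 0%N) (KE 0%N).
  by congr K; apply/funext => x; rewrite mulN1r addNr.
have KA A n : measurable A -> K (\1_(A `&` E n)).
  move=> mA; have : <<s G >> A by rewrite -mG.
  move: A {mA}; apply: (dynkin_induction mG) => //.
  - by rewrite setTI.
  - move=> A GA; apply: KG; first exact: GI.
    by apply: finI; exact: mGA.
  - move=> A mA KA.
    have := Klin _ _ (-1) (LI A n mA) (LE n) KA (KE n).
    congr K; apply/funext => x; rewrite !indicE !in_setI in_setC.
    by case: (x \in A); case: (x \in E n); rewrite /= ?mulr0 ?mulr1 ?add0r ?addNr.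
  - move=> F mF tF KF.
    pose D m := (\bigcup_(k < m) F k).
    have mD m : measurable (D m) by apply: bigcup_measurable.
    have KD m : K (\1_(D m `&` E n)).
      elim: m => [|m IH].
        by rewrite /D bigcup_mkord big_ord0 set0I indic0.
      have := Klin _ _ 1 (LI _ n (mF m)) (LI _ n (mD m)) (KF m) IH.
      have DS : D m.+1 = D m `|` F m by rewrite /D bigcup_mkord big_ord_recr /= -bigcup_mkord.
      congr K; apply/funext => x; rewrite DS mul1r !indicE !in_setI in_setU.
      have [xF|] := boolP (x \in F m); last by rewrite orbF add0r.
      have -> : (x \in D m) = false.
        apply/negbTE/negP; rewrite inE => -[k /= km Fk]; rewrite inE in xF.
        have kk := tF k m I I (ex_intro _ x (conj Fk xF)).
        by rewrite kk ltnn in km.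
      by rewrite addr0.
    apply: Klim; first by apply: LI; exact: bigcup_measurable.
    move=> e e0.
    have [||||N _ /(_ N (leqnn N))] :=
      (cvgrPdist_le _ _).1 (@amass_dominated _ _ alpha0 _ _ mu (fun m => \1_(D m `&` E n))
      (\1_(\bigcup_k F k `&` E n)) (\1_(E n)) _ _ (LE n) _ _) e e0.
    + by move=> m; exact: (LI _ n (mD m)).1.
    + by apply: measurable_indic; apply: measurableI => //; exact: bigcup_measurable.
    + move=> m x; rewrite !indicE !in_setI; case: (x \in E n); last by rewrite !andbF subrr.
      rewrite !andbT normr1; case: (_ \in _); case: (_ \in _) => //=;
        by rewrite ?subrr ?normr0 ?subr0 ?sub0r ?normrN ?normr1.
    + apply: aeW => x; apply: cvg_near_cst.
      have [|nx] := boolP (x \in \bigcup_k F k).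
        rewrite inE => -[k _ Fk]; exists k.+1 => // m /= km.
        rewrite !indicE !in_setI; congr ((_ && _)%:R).
        by rewrite !mem_set//; exists k.
      apply: nearW => m; rewrite !indicE !in_setI; congr ((_ && _)%:R).
      rewrite (negbTE nx); apply/negbTE; apply: contra nx; rewrite !inE.
      by move=> [k _ Fk]; exists k.
    rewrite sub0r normrN ger0_norm ?amass_ge0// amass_distC => h.
    by exists (\1_(D N `&` E n)); split => //; exact: LI.
move=> f Lf.
have Kh (h : {sfun S >-> measurableTypeR R}) n :
    Lp (fun x => h x * \1_(E n) x) /\ K (fun x => h x * \1_(E n) x).
  apply: (@sfun_ind _ _ _ h (fun g => Lp (fun x => g x * \1_(E n) x) /\
      K (fun x => g x * \1_(E n) x))).
  - by under eq_fun do rewrite mul0r; split => //; exact: inLp0.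
  - move=> g g' [Lg Kg] [Lg' Kg']; under eq_fun do rewrite mulrDl.
    split; first exact: inLpD.
    by have := Klin _ _ 1 Lg Lg' Kg Kg'; under eq_fun do rewrite mul1r.
  - move=> y _; have mA : measurable (h @^-1` [set y]) by exact: measurable_funPTI.
    rewrite (_ : (fun x => _) = fun x => y * \1_(h @^-1` [set y] `&` E n) x); last first.
      by apply/funext => x; rewrite -mulrA indicI.
    split; first by apply: inLpZ => //; exact: LI.
    have := Klin _ _ y (LI _ n mA) (inLp0 alpha0 mu) (KA _ n mA) K0.
    by under eq_fun do rewrite addr0.
have [h [hf ch]] := sfun_approx Lf.1.
apply: Klim => // e e0.
have [|||N _ /(_ N (leqnn N))] :=
  (cvgrPdist_le _ _).1 (@amass_dominated _ _ alpha0 _ _ mu (fun m x => h m x * \1_(E m) x)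
  f (fun x => 2 * f x) _ Lf.1 (inLpZ 2 Lf) _ _) e e0.
- by move=> m; exact: (Kh (h m) m).1.1.
- move=> m x; rewrite (le_trans (ler_normB _ _))// [leRHS]normrM ger0_norm// mulr_natl mulr2n.
  rewrite lerD2r normrM (le_trans _ (hf m x))// ler_piMr//.
  by rewrite indicE; case: (_ \in _); rewrite ?normr1 ?normr0.
- apply: aeW => x; have [k _ Ek] : (\bigcup_n E n) x by rewrite UE.
  apply: cvg_trans (ch x); apply: near_eq_cvg; exists k => // m /= km.
  by rewrite indicE mem_set ?mulr1//; exact: (ndE k m).
rewrite sub0r normrN ger0_norm ?amass_ge0// amass_distC => hN.
by exists (fun x => h N x * \1_(E N) x); have [] := Kh (h N) N.
Qed.

End density.

(** * Continuity of translations in mean of order [alpha] *)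

Lemma three_term_bound (R : realType) (k q m1 m2 m3 m4 x : R) : 1 <= k -> 0 <= q ->
  m1 <= q -> m3 <= q -> m4 <= q -> m2 <= k * (m3 + m4) -> x <= k * (m1 + m2) ->
  x <= q * (4 * (k * k)).
Proof.
move=> k1 q0 h1 h3 h4 h2 hx.
have A5 : m2 <= k * (q + q).
  by apply: (le_trans h2); apply: ler_wpM2l; [lra|exact: lerD].
have A6 : m1 + m2 <= k * (3 * q) by nra.
have : k * (m1 + m2) <= k * (k * (3 * q)) by apply: ler_wpM2l => //; lra.
by nra.
Qed.

Section translations.
Context (R : realType) (alpha : R) (alpha0 : 0 < alpha) (d : nat).
Context (dV : measure_display) (V : measurableType dV).
Variable nu : {finite_measure set V -> \bar R}.

Local Notation lam := (lebesgue_Rd R d).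
Local Notation mu := (lam \x nu)%E.
Local Notation Lp := (inLp alpha mu).
Local Notation mass := (amass alpha mu).
Local Notation SV := (Rd R d * V)%type.

Definition shift (t : Rd R d) (x : SV) : SV := (addRd t x.1, x.2).

Lemma measurable_shift t : measurable_fun setT (shift t).
Proof.
apply/measurable_fun_pairP; split => /=.
  by apply: (measurableT_comp (measurable_addRd t)); exact: measurable_fst.
exact: measurable_snd.
Qed.

Lemma ge0_integral_shift t (f : SV -> \bar R) : measurable_fun setT f ->
  (forall x, (0 <= f x)%E) -> (\int[mu]_x f (shift t x) = \int[mu]_x f x)%E.
Proof.
move=> mf f0.
have mft : measurable_fun setT (fun x => f (shift t x)).
  exact: measurableT_comp (measurable_shift t).
rewrite (fubini_tonelli1 (fun x => f (shift t x)))// (fubini_tonelli1 f)//.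
have mF := measurable_fun_fubini_tonelli_F (m2 := nu) f mf f0.
rewrite -(ge0_integral_addRd t mF)// => u; exact: integral_ge0.
Qed.

Lemma inLp_shift t f : Lp f -> Lp (fun x => f (shift t x)).
Proof.
move=> [mf /integrableP[m1 i1]]; have mft : measurable_fun setT (fun x => f (shift t x)).
  exact: measurableT_comp (measurable_shift t).
split => //; apply/integrableP; split; first by apply/measurable_EFinP; exact: measurable_apow.
move: i1; rewrite -(ge0_integral_shift t (f := fun x => `|(`|f x| `^ alpha)%:E|%E))//.
exact: measurableT_comp.
Qed.

Lemma amass_shift t f : Lp f -> mass (fun x => f (shift t x)) = mass f.
Proof.
move=> [mf _]; rewrite /amass /Rintegral; congr fine.
apply: (ge0_integral_shift t (f := fun x => (`|f x| `^ alpha)%:E)).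
  by apply/measurable_EFinP; exact: measurable_apow.
by move=> x; rewrite lee_fin powR_ge0.
Qed.

Lemma amass_indicB (A B : set SV) : measurable A -> measurable B ->
  (mu A < +oo)%E -> (mu B < +oo)%E ->
  mass (fun x => \1_A x - \1_B x) = fine (mu A) + fine (mu B) - 2 * fine (mu (A `&` B)).
Proof.
move=> mA mB fA fB.
have mAB : measurable (A `&` B) by exact: measurableI.
have fAB : (mu (A `&` B) < +oo)%E.
  by apply: le_lt_trans fA; apply: le_measure; rewrite ?inE.
have iI (C : set SV) : measurable C -> (mu C < +oo)%E -> mu.-integrable setT (EFin \o \1_C).
  move=> mC fC; apply/integrableP; split; first by apply/measurable_EFinP; exact: measurable_indic.
  under eq_integral do rewrite gee0_abs ?lee_fin//.
  by rewrite integral_indic// setIT.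
have EI (C : set SV) : measurable C -> \int[mu]_x \1_C x = fine (mu C).
  by move=> mC; rewrite /Rintegral integral_indic// setIT.
rewrite -!EI// -RintegralZl ?iI// -RintegralD ?iI// -RintegralB; last 3 first.
- exact: measurableT.
- exact: (integrableD measurableT (iI A mA fA) (iI B mB fB)).
- exact: (integrableZl measurableT 2 (iI _ mAB fAB)).
apply: eq_Rintegral => x _; rewrite !indicE in_setI.
case: (x \in A); case: (x \in B) => /=; rewrite ?subrr ?subr0 ?sub0r ?normrN ?normr1 ?normr0 ?powR1 ?powR0 ?gt_eqF//; ring.
Qed.

Definition box_rectangles : set (set SV) :=
  [set A | exists b c B, measurable B /\ A = box b c `*` B].

Lemma mu_box_rectangle b c B : measurable B ->
  mu (box b c `*` B) = ((\prod_(i < d) (Num.max 0 (c i - b i)))%:E * nu B)%E.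
Proof.
move=> mB; rewrite product_measure1E//; last exact: measurable_box.
by congr (_ * _)%E; exact: lebesgue_box.
Qed.

Lemma mu_box_rectangle_fin b c B : measurable B -> (mu (box b c `*` B) < +oo)%E.
Proof.
move=> mB; rewrite mu_box_rectangle// lte_mul_pinfty//.
  by rewrite lee_fin; apply: prodr_ge0 => i _; rewrite le_max lexx.
by rewrite -ge0_fin_numE// fin_num_measure.
Qed.

Lemma measurable_box_rectangle (b c : 'I_d -> R) (B : set V) : measurable B -> measurable (box b c `*` B).
Proof. by move=> mB; apply: measurableX => //; exact: measurable_box. Qed.

Lemma measurable_box_rectangles : measurable = <<s box_rectangles >>.
Proof.
apply/seteqP; split; last first.
  apply: smallest_sub; first exact: sigma_algebra_measurable.
  by move=> _ [b [c [B [mB ->]]]]; exact: measurable_box_rectangle.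
rewrite measurable_prod_measurableType; apply: smallest_sub.
  exact: smallest_sigma_algebra.
move=> _ [A mA [B mB <-]].
have SS := smallest_sigma_algebra setT box_rectangles.
have [S0 SC SU] := SS.
have SI X Y : <<s box_rectangles >> X -> <<s box_rectangles >> Y ->
    <<s box_rectangles >> (X `&` Y).
  move=> SX SY; rewrite -[_ `&` _]setCK setCI -setTD; refine (SC _ _).
  rewrite -bigcup2E; apply: SU => -[|[|n]] /=; last exact: S0.
  - by rewrite -setTD; exact: SC.
  - by rewrite -setTD; exact: SC.
have gen (b c : 'I_d -> R) (C : set V) : measurable C -> <<s box_rectangles >> (box b c `*` C).
  by move=> mC; apply: sub_gen_smallest; exists b, c, C.
have cyl (C : set V) : measurable C -> <<s box_rectangles >> (setT `*` C).
  move=> mC; rewrite -(cube_cover R d) setX_bigcupl; apply: SU => n; exact: gen.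
rewrite (_ : A `*` B = (fst @^-1` A) `&` (setT `*` B)); last first.
  by apply/seteqP; split => -[u v] /=; [move=> []|move=> [? []]].
apply: SI; last exact: cyl.
move: A mA; rewrite measurable_boxes; apply: (generated_preimage SS (f := fst)).
move=> _ [b [c ->]]; rewrite (_ : fst @^-1` _ = box b c `*` setT); first exact: gen.
by apply/seteqP; split => -[u v] /=; [move=> ?; split|move=> []].
Qed.

Definition cvgRd (t_ : nat -> Rd R d) (t : Rd R d) :=
  forall i, tnth (t_ n) i @[n --> \oo] --> (tnth t i : R).

Lemma shift_box t b c (B : set V) : shift t @^-1` (box b c `*` B) =
  box (fun i => b i - tnth t i) (fun i => c i - tnth t i) `*` B.
Proof. by rewrite -addRd_box; apply/seteqP; split => -[u v]. Qed.

(** The symmetric difference of two translates of a box has an explicit measure,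
    which depends continuously on the translation. *)
Lemma shift_cvg_box b c (B : set V) t_ t : measurable B -> cvgRd t_ t ->
  mass (fun x => \1_(box b c `*` B) (shift (t_ n) x) - \1_(box b c `*` B) (shift t x))
    @[n --> \oo] --> 0.
Proof.
move=> mB tt; pose w i := c i - b i.
pose p (e : 'I_d -> R) := \prod_(i < d) Num.max 0 (w i - `|e i|).
have E n : mass (fun x => \1_(box b c `*` B) (shift (t_ n) x) - \1_(box b c `*` B) (shift t x)) =
    2 * fine (nu B) * (p (fun=> 0) - p (fun i => tnth (t_ n) i - tnth t i)).
  have fB : nu B \is a fin_num by rewrite fin_num_measure.
  have PE u : (fun x => \1_(box b c `*` B) (shift u x) : R) = \1_(shift u @^-1` (box b c `*` B)).
    by [].
  have ME := amass_indicB (A := shift (t_ n) @^-1` (box b c `*` B))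
    (B := shift t @^-1` (box b c `*` B)).
  rewrite !shift_box in ME; rewrite -[LHS]/(mass (fun x =>
    \1_(shift (t_ n) @^-1` (box b c `*` B)) x - \1_(shift t @^-1` (box b c `*` B)) x)).
  rewrite !shift_box ME; [|exact: measurable_box_rectangle|exact: measurable_box_rectangle
    |exact: mu_box_rectangle_fin|exact: mu_box_rectangle_fin].
  rewrite -setXI setIid boxI !mu_box_rectangle// !fineM//=.
  have e1 u : \prod_(i < d) Num.max 0 (c i - tnth u i - (b i - tnth u i)) = p (fun=> 0).
    by apply: eq_bigr => i _; rewrite normr0; congr (Num.max _ _); rewrite /w; ring.
  rewrite !e1.
  have -> : \prod_(i < d) Num.max 0 (Num.min (c i - tnth (t_ n) i) (c i - tnth t i) -
      Num.max (b i - tnth (t_ n) i) (b i - tnth t i)) = p (fun i => tnth (t_ n) i - tnth t i).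
    apply: eq_bigr => i _; congr (Num.max _ _); rewrite /w.
    have [h|h] := lerP (tnth (t_ n) i) (tnth t i).
      rewrite (min_idPr _) ?lerD2l ?lerN2// (max_idPl _) ?lerD2l ?lerN2//.
      by ring.
    rewrite (min_idPl _) ?lerD2l ?lerN2 1?ltW// (max_idPr _) ?lerD2l ?lerN2 1?ltW//.
    by ring.
  by ring.
suff cp : p (fun i => tnth (t_ n) i - tnth t i) @[n --> \oo] --> p (fun=> 0).
  rewrite (funext E).
  have c2 : 2 * fine (nu B) * (p (fun=> 0) - p (fun i => tnth (t_ n) i - tnth t i))
      @[n --> \oo] --> 2 * fine (nu B) * (p (fun=> 0) - p (fun=> 0)).
    by apply: cvgM; [exact: cvg_cst|apply: cvgB => //; exact: cvg_cst].
  by rewrite subrr mulr0 in c2.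
rewrite /p; elim: (index_enum _) => [|i s IH].
  by rewrite big_nil; under eq_fun do rewrite big_nil; exact: cvg_cst.
rewrite big_cons; under eq_fun do rewrite big_cons; apply: cvgM => //.
have c1 : w i - `|tnth (t_ n) i - tnth t i| @[n --> \oo] --> (w i - `|(0 : R)|).
  have c0 : tnth (t_ n) i - tnth t i @[n --> \oo] --> (tnth t i - tnth t i : R).
    by apply: cvgB; [exact: tt|exact: cvg_cst].
  rewrite subrr in c0.
  by apply: cvgB; [exact: cvg_cst|exact: cvg_norm].
apply/cvgrPdist_le => e e0; move/cvgrPdist_le : c1 => /(_ e e0); apply: filterS => n /=.
apply: le_trans; move: (w i - `|(0 : R)|) => x.
move: (w i - `|_|) => y.
have [h1|h1] := leP 0 x; have [h2|h2] := leP 0 y => //.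
- by rewrite subr0 !ger0_norm//; lra.
- by rewrite sub0r normrN [leLHS]ger0_norm// [leRHS]ltr0_norm; lra.
- by rewrite subrr normr0.
Qed.

Lemma shift_cvg f t_ t : Lp f -> cvgRd t_ t ->
  mass (fun x => f (shift (t_ n) x) - f (shift t x)) @[n --> \oo] --> 0.
Proof.
move=> Lf tt; move: f Lf.
pose K f := mass (fun x => f (shift (t_ n) x) - f (shift t x)) @[n --> \oo] --> 0.
apply: (@Lp_density _ _ alpha0 _ _ mu box_rectangles
  (fun n => cube n `*` setT) K measurable_box_rectangles).
- move=> _ _ [b [c [B [mB ->]]]] [b' [c' [B' [mB' ->]]]].
  by rewrite -setXI boxI; do 3 eexists; split; last reflexivity; exact: measurableI.
- by move=> n; do 3 eexists; split; last reflexivity; exact: measurableT.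
- by move=> n m nm [u v] [/= cu _]; split => //; exact: (cube_ndecr nm).
- by rewrite -setX_bigcupl cube_cover setXTT.
- by move=> n; exact: mu_box_rectangle_fin.
- move=> f g c Lf Lg Kf Kg.
  apply: (@squeeze_cvgr _ _ _ _ (cst 0) (fun n => 2 `^ alpha * (
     `|c| `^ alpha * mass (fun x => f (shift (t_ n) x) - f (shift t x)) +
     mass (fun x => g (shift (t_ n) x) - g (shift t x))))).
  + apply: nearW => n; rewrite amass_ge0 /=.
    have L1 : Lp (fun x => f (shift (t_ n) x) - f (shift t x)).
      by apply: inLpB => //; exact: inLp_shift.
    have L2 : Lp (fun x => g (shift (t_ n) x) - g (shift t x)).
      by apply: inLpB => //; exact: inLp_shift.
    rewrite -amassZ//; have := amassD alpha0 ltr01 (inLpZ c L1) L2.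
    rewrite invr1 (_ : 1 + 1 = 2)// -mulrDr; apply: le_trans.
    rewrite le_eqVlt; apply/orP; left; apply/eqP.
    by apply: eq_Rintegral => x _; congr (`|_| `^ _); ring.
  + exact: cvg_cst.
  + rewrite -(mulr0 (2 `^ alpha)) -[X in _ * X](addr0 0) -{1}(mulr0 (`|c| `^ alpha)).
    apply: cvgM; first exact: cvg_cst.
    by apply: cvgD; [apply: cvgM; [exact: cvg_cst|exact: Kf]|exact: Kg].
- move=> f Lf Hf; apply/cvgrPdist_le => e e0.
  pose C : R := 2 `^ alpha * 2 `^ alpha.
  have C1 : 0 < 2 `^ alpha :> R by exact: powR_gt0.
  have C0 : 0 < C by rewrite mulr_gt0.
  have e1 : 0 < e / (4 * C) by rewrite divr_gt0// mulr_gt0.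
  have [g [Lg /cvgrPdist_le /(_ _ e1) Kg fg]] := Hf _ e1.
  apply: filterS Kg => n; rewrite !sub0r !normrN !ger0_norm ?amass_ge0// => Kg.
  have Ls (h : SV -> R) u : Lp h -> Lp (fun x => h (shift u x)) by exact: inLp_shift.
  have A1 := amass_triangle alpha0 (Ls _ (t_ n) Lf) (Ls _ (t_ n) Lg) (Ls _ t Lf).
  have A2 := amass_triangle alpha0 (Ls _ (t_ n) Lg) (Ls _ t Lg) (Ls _ t Lf).
  have A3 : mass (fun x => f (shift (t_ n) x) - g (shift (t_ n) x)) <= e / (4 * C).
    by apply: le_trans fg; rewrite -(amass_shift (t_ n) (inLpB alpha0 Lf Lg)).
  have A4 : mass (fun x => g (shift t x) - f (shift t x)) <= e / (4 * C).
    by apply: le_trans fg; rewrite amass_distC -(amass_shift t (inLpB alpha0 Lf Lg)).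
  have C2 : 1 <= 2 `^ alpha :> R.
    by rewrite -[leLHS](powRr0 2); apply: ler_powR; [rewrite ler1n|exact: ltW].
  have qe : e / (4 * C) * (4 * C) = e by rewrite divfK// gt_eqF// mulr_gt0.
  rewrite -[leRHS]qe; exact: (three_term_bound C2 (ltW e1) A3 Kg A4 A2 A1).
- by move=> _ [b [c [B [mB ->]]]] _; exact: shift_cvg_box.
Qed.

End translations.

(** * Sums of independent stable processes *)

Section independent_sums.
Context (R : realType) (alpha : R) (alpha0 : 0 < alpha) (T : Type).
Context (dO : measure_display) (O : measurableType dO) (Q : probability O R).

Lemma process_sigma_ev (X : T -> {RV Q >-> R}) (a : lincomb R T) (B : set R) :
  measurable B -> process_sigma X ((fun w => ev a (fun t => X t w)) @^-1` B).
Proof.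
move=> mB; set G := \bigcup_(t in [set: T]) preimage_set_system [set: O] (X t) measurable.
have mX t : measurable_fun setT (X t : g_sigma_algebraType G -> R).
  move=> _ C mC; apply: sub_gen_smallest; exists t => //.
  by exists C.
have := measurable_ev a mX measurableT mB.
by rewrite setTI.
Qed.

Lemma independent_exponent_sum n (Y : 'I_n -> T -> {RV Q >-> R}) (N : 'I_n -> lincomb R T -> R) :
  independent_processes Y -> (forall k, sas_exponent alpha Q (Y k) (N k)) ->
  sas_exponent alpha Q (fun t w => \sum_(k < n) Y k t w) (fun a => \sum_(k < n) N k a).
Proof.
move=> iY NY; split.
- by move=> t; apply: measurable_sum => k; exact: measurable_funPT.
- by move=> a; apply: sumr_ge0 => k _; have [_ h _ _] := NY k.
- move=> c a; rewrite big_distrr/=; apply: eq_bigr => k _.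
  by have [_ _ h _] := NY k.
move=> th a.
have evE w : ev a (fun t => \sum_(k < n) Y k t w) = \sum_(k < n) ev a (fun t => Y k t w).
  by rewrite /ev exchange_big/=; apply: eq_bigr => p _; rewrite big_distrr.
under eq_Rintegral do rewrite evE.
rewrite (@indep_cos_sum _ _ _ Q n (fun k w => ev a (fun t => Y k t w))
  (fun k => expR (- N k a))).
- by rewrite -expR_sum sumrN.
- by move=> k; apply: measurable_ev => t; exact: measurable_funPT.
- by move=> B mB; apply: iY => k; exact: process_sigma_ev.
- by move=> k t; have [_ _ _ ->] := NY k.
Qed.

End independent_sums.

Section product_space.
Context (R : realType) (alpha : R) (alpha0 : 0 < alpha) (T : Type).
Context (dO : measure_display) (O : measurableType dO) (Q : probability O R).

Definition prodP : probability (O * O)%type R := (Q \x Q)%E.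

Lemma prodPE (A B : set O) : measurable A -> measurable B ->
  prodP (A `*` B) = (Q A * Q B)%E.
Proof. by move=> mA mB; exact: (product_measure1E Q Q). Qed.

Definition proj (b : bool) (w : O * O) : O := if b then w.2 else w.1.

Lemma measurable_proj b : measurable_fun setT (proj b).
Proof. by case: b; [exact: measurable_snd|exact: measurable_fst]. Qed.

Lemma prodP_proj b (A : set O) : measurable A -> prodP (proj b @^-1` A) = Q A.
Proof.
move=> mA; case: b; rewrite /proj.
  rewrite (_ : _ @^-1` _ = setT `*` A) ?prodPE// ?probability_setT ?mul1e//.
  by apply/seteqP; split => -[u v] //= [].
rewrite (_ : _ @^-1` _ = A `*` setT) ?prodPE// ?probability_setT ?mule1//.
by apply/seteqP; split => -[u v] //= [].
Qed.

Lemma exponent_proj b (X : T -> O -> R) N : sas_exponent alpha Q X N ->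
  sas_exponent alpha prodP (fun t w => X t (proj b w)) N.
Proof.
move=> [mX N0 Nh XN]; split => //.
  by move=> t; apply: (measurableT_comp (mX t)); exact: measurable_proj.
move=> th a; rewrite -XN.
have [mc cb] := brv_cos_ev mX th a.
apply: (@same_law_integral _ _ _ _ _ _ _ prodP Q (proj b) id
  (fun w => cos (th + ev a (X^~ w)))) => //.
- exact: measurable_proj.
- by move=> B mB; rewrite prodP_proj.
Qed.

Lemma process_sigma_proj b (X : T -> {RV prodP >-> R}) (F : T -> O -> R) :
  (forall t, measurable_fun setT (F t)) ->
  (forall t w, X t w = F t (proj b w)) ->
  process_sigma X `<=` [set A | exists2 B, measurable B & A = proj b @^-1` B].
Proof.
move=> mF XF; apply: smallest_sub.
  split => [|A [B mB ->]|A mA].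
  - by exists set0 => //; rewrite preimage_set0.
  - by exists (~` B); [exact: measurableC|rewrite setTD preimage_setC].
  - pose B n := projT1 (cid2 (mA n)).
    have BP n : measurable (B n) /\ A n = proj b @^-1` B n by rewrite /B; case: cid2.
    exists (\bigcup_n B n); first by apply: bigcup_measurable => n _; exact: (BP n).1.
    by rewrite preimage_bigcup; apply: eq_bigcupr => n _; exact: (BP n).2.
move=> _ [t _ [C mC <-]]; exists (F t @^-1` C).
  by rewrite -[X in measurable X]setTI; exact: mF.
by rewrite setTI; apply/seteqP; split => w /=; rewrite XF.
Qed.

Lemma independent_proj (Y : 'I_2 -> T -> {RV prodP >-> R}) (F : 'I_2 -> T -> O -> R) :
  (forall k t, measurable_fun setT (F k t)) ->
  (forall k t w, Y k t w = F k t (proj (k != ord0) w)) -> independent_processes Y.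
Proof.
move=> mF YF A AY.
have H k := process_sigma_proj (mF k) (YF k) (AY k).
have [B0 mB0 E0] := H ord0; have [B1 mB1 E1] := H ord_max.
rewrite big_ord_recl big_ord1 (_ : lift ord0 ord0 = ord_max); last exact/val_inj.
rewrite (_ : \bigcap_(k in [set: 'I_2]) A k = B0 `*` B1); last first.
  apply/seteqP; split => [w h|w [h0 h1] k _].
    by split; [have := h ord0 I; rewrite E0|have := h ord_max I; rewrite E1].
  have [->|k1] := eqVneq k ord0; first by rewrite E0.
  by rewrite (_ : k = ord_max) ?E1//; apply/val_inj; case: k k1 => -[|[|]].
by rewrite E0 E1 !prodP_proj// prodPE.
Qed.

End product_space.

(** * Rational linear combinations of translates *)

Lemma cvg_apow0 (R : realType) (alpha : R) (u : nat -> R) : 0 < alpha ->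
  u n @[n --> \oo] --> (0 : R) -> `|u n| `^ alpha @[n --> \oo] --> (0 : R).
Proof.
move=> alpha0 u0; apply/cvgrPdist_lt => e e0.
have ea : 0 < e `^ alpha^-1 by exact: powR_gt0.
move/cvgrPdist_lt : u0 => /(_ _ ea); apply: filterS => n /= un.
rewrite sub0r normrN ger0_norm ?powR_ge0//.
have -> : e = (e `^ alpha^-1) `^ alpha by rewrite -powRrM mulVf ?gt_eqF// powRr1// ltW.
apply: gt0_ltr_powR; rewrite ?nnegrE ?powR_ge0//.
by move: un; rewrite sub0r normrN.
Qed.

Lemma rat_approx (R : realType) (x : R) : exists q : nat -> rat, ratr (q n) @[n --> \oo] --> x.
Proof.
have H n : exists q : rat, x < ratr q < x + n.+1%:R^-1.
  have h : x < x + n.+1%:R^-1 by rewrite ltrDl invr_gt0.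
  by have [q] := rat_in_itvoo h; rewrite in_itv; exists q.
exists (fun n => projT1 (cid (H n))).
apply: (@squeeze_cvgr _ _ _ _ (cst x) (fun n => x + n.+1%:R^-1)).
- apply: nearW => n /=; have /andP[h1 h2] := projT2 (cid (H n)).
  by rewrite !ltW.
- exact: cvg_cst.
- have h : x + n.+1%:R^-1 @[n --> \oo] --> (x + 0 : R).
    by apply: cvgD; [exact: cvg_cst|exact: cvg_harmonic].
  by rewrite addr0 in h.
Qed.

Section rational_combinations.
Context (R : realType) (alpha : R) (alpha0 : 0 < alpha) (d : nat).
Context (dV : measure_display) (V : measurableType dV).
Local Notation SV := (Rd R d * V)%type.
Local Notation mu nu := (lebesgue_Rd R d \x nu)%E.

Definition ratcomb := seq (rat * d.-tuple rat).

Definition of_ratcomb (i : ratcomb) : lincomb R (Rd R d) :=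
  [seq (ratr p.1, [tuple ratr (tnth p.2 j) | j < d]) | p <- i].

(** One sequence of rational combinations serves all kernels and all mixing
    measures, so that the same one can be used for a point mass and for [nu]. *)
Lemma ratcomb_approx (a : lincomb R (Rd R d)) : exists i : nat -> ratcomb,
  forall (nu : {finite_measure set V -> \bar R}) (f : SV -> R), inLp alpha (mu nu) f ->
    amass alpha (mu nu) (fun x => ev (of_ratcomb (i n)) (fun t => f (shift t x)) -
      ev a (fun t => f (shift t x))) @[n --> \oo] --> 0.
Proof.
elim: a => [|[c t] a [i IH]].
  exists (fun=> [::]) => nu f Lf.
  rewrite (_ : (fun n => amass _ _ _) = cst 0); first exact: cvg_cst.
  apply/funext => n; rewrite -[RHS](amass0 alpha0 (mu nu)); apply: eq_Rintegral => x _.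
  by rewrite !ev_nil subrr.
have [q qc] := rat_approx c.
pose s n : d.-tuple rat := [tuple projT1 (cid (rat_approx (tnth t j))) n | j < d].
pose t_ n : Rd R d := [tuple ratr (tnth (s n) j) | j < d].
have tt : cvgRd t_ t.
  move=> j; have := projT2 (cid (rat_approx (tnth t j))).
  rewrite (_ : (fun n => _) = fun n => tnth (t_ n) j)//.
  by apply/funext => n; rewrite !tnth_mktuple.
exists (fun n => (q n, s n) :: i n) => nu f Lf.
have rc : amass alpha (mu nu) (fun x => ev (of_ratcomb (i n)) (fun t => f (shift t x)) -
  ev a (fun t => f (shift t x))) @[n --> \oo] --> 0 by exact: IH.
have fc := shift_cvg alpha0 Lf tt.
have q0 : ratr (q n) - c @[n --> \oo] --> (c - c : R) by apply: cvgB => //; exact: cvg_cst.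
rewrite subrr in q0.
have qa := cvg_apow0 alpha0 q0.
have Ls u : inLp alpha (mu nu) (fun x => f (shift u x)) by exact: inLp_shift.
have Le (b : lincomb R (Rd R d)) : inLp alpha (mu nu) (fun x => ev b (fun t => f (shift t x))).
  exact: (inLp_ev alpha0 (mu := mu nu) b (G := fun t x => f (shift t x))).
pose K : R := 2 `^ alpha.
pose m := amass alpha (mu nu) (fun x => f (shift t x)).
pose e n := amass alpha (mu nu) (fun x => f (shift (t_ n) x) - f (shift t x)).
pose r n := amass alpha (mu nu) (fun x => ev (of_ratcomb (i n)) (fun t => f (shift t x)) -
  ev a (fun t => f (shift t x))).
pose b n := K * (K * ((K * (`|c| `^ alpha + `|ratr (q n) - c| `^ alpha)) * e n +
  `|ratr (q n) - c| `^ alpha * m) + r n).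
apply: (@squeeze_cvgr _ _ _ _ (cst 0) b).
- apply: nearW => n; rewrite amass_ge0 /=.
  have add2 (F G : SV -> R) : inLp alpha (mu nu) F -> inLp alpha (mu nu) G ->
      amass alpha (mu nu) (fun x => F x + G x) <= K * (amass alpha (mu nu) F + amass alpha (mu nu) G).
    move=> LF LG; have := amassD alpha0 ltr01 LF LG.
    by rewrite invr1 (_ : 1 + 1 = 2)// -mulrDr.
  pose F1 x := ratr (q n) * (f (shift (t_ n) x) - f (shift t x)).
  pose F2 x := (ratr (q n) - c) * f (shift t x).
  pose F3 x := ev (of_ratcomb (i n)) (fun t => f (shift t x)) - ev a (fun t => f (shift t x)).
  have L1 : inLp alpha (mu nu) F1 by apply: inLpZ; exact: inLpB.
  have L2 : inLp alpha (mu nu) F2 by exact: inLpZ.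
  have L3 : inLp alpha (mu nu) F3 by exact: inLpB.
  rewrite (_ : amass _ _ _ = amass alpha (mu nu) (fun x => (F1 x + F2 x) + F3 x)); last first.
    apply: eq_Rintegral => x _; rewrite !ev_cons/= -/(t_ n) /F1 /F2 /F3.
    by congr (`|_| `^ _); ring.
  apply: (le_trans (add2 _ _ (inLpD alpha0 L1 L2) L3)).
  rewrite /b ler_pM2l ?powR_gt0// lerD2r.
  apply: (le_trans (add2 _ _ L1 L2)); rewrite ler_pM2l ?powR_gt0//.
  rewrite /F1 /F2 amassZ; last exact: inLpB.
  rewrite amassZ// lerD2r ler_wpM2r ?amass_ge0//.
  have := apow_add alpha0 c (ratr (q n) - c) ltr01.
  by rewrite addrC subrK invr1 (_ : 1 + 1 = 2)// -mulrDr.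
- exact: cvg_cst.
- have h : b n @[n --> \oo] --> K * (K * ((K * (`|c| `^ alpha + 0)) * 0 + 0 * m) + 0).
    apply: cvgM; [exact: cvg_cst|apply: cvgD; [|exact: rc]].
    apply: cvgM; [exact: cvg_cst|apply: cvgD; apply: cvgM; [|exact: fc|exact: qa|exact: cvg_cst]].
    by apply: cvgM; [exact: cvg_cst|apply: cvgD; [exact: cvg_cst|exact: qa]].
  by rewrite mulr0 mul0r !addr0 !mulr0 in h.
Qed.

Lemma ratcomb_mass_approx (alpha2 : alpha < 2) (a : lincomb R (Rd R d)) : exists i : nat -> ratcomb,
  forall (nu : {finite_measure set V -> \bar R}) (f : SV -> R), inLp alpha (mu nu) f ->
    amass alpha (mu nu) (fun x => ev (of_ratcomb (i n)) (fun t => f (shift t x))) @[n --> \oo] -->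
    amass alpha (mu nu) (fun x => ev a (fun t => f (shift t x))).
Proof.
have [i H] := ratcomb_approx a; exists i => nu f Lf.
have Ls u : inLp alpha (mu nu) (fun x => f (shift u x)) by exact: inLp_shift.
have Le (b : lincomb R (Rd R d)) : inLp alpha (mu nu) (fun x => ev b (fun t => f (shift t x))).
  exact: (inLp_ev alpha0 (mu := mu nu) b (G := fun t x => f (shift t x))).
by apply: (amass_cvg alpha0) => //; exact: H.
Qed.

End rational_combinations.

(** * Indecomposable mixed moving averages *)

Lemma integral_representation_exponent (R : realType) (alpha : R) (alpha0 : 0 < alpha)
    (alpha2 : alpha < 2) (T : Type) dO (O : measurableType dO) (P : probability O R)
    (X : T -> {RV P >-> R}) dS (S : measurableType dS) (mu : {measure set S -> \bar R})
    (g : T -> S -> R) : integral_representation alpha X mu g ->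
  sas_exponent alpha P X (fun a => amass alpha mu (fun s => ev a (g^~ s))).
Proof.
move=> [dQ [OQ [Q [M [Y [MS gY XY]]]]]].
apply: (fdd_eq_exponent _ XY); first by move=> t; exact: measurable_funPT.
apply: (stable_int_exponent alpha0 alpha2 MS) => t.
exact/(stable_intP alpha0).
Qed.

Section stationarity.
Context (R : realType) (alpha : R) (d : nat).
Context (dO : measure_display) (O : measurableType dO) (P : probability O R).

Definition translate (h : Rd R d) (a : lincomb R (Rd R d)) : lincomb R (Rd R d) :=
  [seq (p.1, addRd p.2 h) | p <- a].

Lemma ev_translate h a x : ev (translate h a) x = ev a (fun t => x (addRd t h)).
Proof. by rewrite /ev big_map. Qed.

Lemma exponent_stationary (X : Rd R d -> {RV P >-> R}) N : sas_exponent alpha P X N ->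
  (forall h a, N (translate h a) = N a) -> stationary X.
Proof.
move=> NX NT h; apply: (exponent_fdd_eq (alpha := alpha) (N := N)) => //.
have [mX N0 Nh XN] := NX; split => // th a.
by rewrite -(NT h) -XN; apply: eq_Rintegral => w _; rewrite ev_translate.
Qed.

Lemma stationary_exponent (X : Rd R d -> {RV P >-> R}) N : sas_exponent alpha P X N ->
  stationary X -> forall h a, N (translate h a) = N a.
Proof.
move=> [mX N0 Nh XN] sX h a.
have := fdd_eq_char (fun t => mX (addRd t h)) mX 0 a (sX h).
rewrite XN cos0 mul1r => E; apply: oppr_inj; apply: expR_inj.
rewrite -[RHS]E -[LHS]mul1r -[X in X * _](cos0 R) -XN.
by apply: eq_Rintegral => w _; rewrite ev_translate.
Qed.

End stationarity.

Section mixed_moving_average.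
Context (R : realType) (alpha : R) (alpha0 : 0 < alpha) (alpha2 : alpha < 2) (d : nat).
Context (dV : measure_display) (V : measurableType dV).
Local Notation SV := (Rd R d * V)%type.
Local Notation mu nu := (lebesgue_Rd R d \x nu)%E.

Implicit Types (nu : {finite_measure set V -> \bar R}) (f : SV -> R) (A : set V).
Implicit Type a : lincomb R (Rd R d).

Definition mma_exponent (nu : {finite_measure set V -> \bar R}) (f : SV -> R)
    (a : lincomb R (Rd R d)) : R :=
  amass alpha (mu nu) (fun x => ev a (fun t => f (shift t x))).

Lemma inLp_mma nu f a : inLp alpha (mu nu) f ->
  inLp alpha (mu nu) (fun x => ev a (fun t => f (shift t x))).
Proof.
move=> Lf; apply: (inLp_ev alpha0 (mu := mu nu) a (G := fun t x => f (shift t x))) => t.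
exact: inLp_shift.
Qed.

Lemma mma_exponent_translate nu f h a : inLp alpha (mu nu) f ->
  mma_exponent nu f (translate h a) = mma_exponent nu f a.
Proof.
move=> Lf; rewrite -[RHS](amass_shift h (inLp_mma a Lf)).
apply: eq_Rintegral => x _; rewrite ev_translate; congr (`|ev a _| `^ _).
by apply/funext => t; rewrite /shift /= addRdA.
Qed.

Definition restrictV (A : set V) (f : SV -> R) (x : SV) : R := f x * \1_A x.2.

Lemma ev_restrictV A f a x :
  ev a (fun t => restrictV A f (shift t x)) = ev a (fun t => f (shift t x)) * \1_A x.2.
Proof.
by rewrite /ev big_distrl; apply: eq_bigr => p _ /=; rewrite mulrA.
Qed.

Lemma inLp_restrictV nu A f : measurable A -> inLp alpha (mu nu) f ->
  inLp alpha (mu nu) (restrictV A f).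
Proof.
move=> mA Lf; apply: (inLp_le alpha0 _ Lf) => [|x].
  apply: measurable_funM; first exact: Lf.1.
  have m1 : measurable_fun setT (\1_A : V -> R) by exact: measurable_indic.
  by apply: (measurableT_comp m1); exact: measurable_snd.
rewrite normrM ler_piMr//.
by rewrite indicE; case: (_ \in _); rewrite ?normr1 ?normr0.
Qed.

Lemma mma_exponent_split nu A f a : measurable A -> inLp alpha (mu nu) f ->
  mma_exponent nu f a =
  mma_exponent nu (restrictV A f) a + mma_exponent nu (restrictV (~` A) f) a.
Proof.
move=> mA Lf.
have [_ L1] := inLp_mma a (inLp_restrictV mA Lf).
have [_ L2] := inLp_mma a (inLp_restrictV (measurableC mA) Lf).
rewrite /mma_exponent /amass -RintegralD//; apply: eq_Rintegral => x _.
rewrite !ev_restrictV !indicE in_setC.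
by case: (_ \in _); rewrite /= mulr1 mulr0 normr0 (powR0 (lt0r_neq0 alpha0)) ?addr0 ?add0r.
Qed.

Lemma mma_unit_set (nu : probability V R) :
  measurable (box (fun _ : 'I_d => 0 : R) (fun=> 1) `*` [set: V]) /\
  mu nu (box (fun _ : 'I_d => 0 : R) (fun=> 1) `*` [set: V]) = 1%E.
Proof.
have mB := measurable_box (fun _ : 'I_d => 0 : R) (fun=> 1).
split; first exact: measurableX.
rewrite product_measure1E// -[RHS](mule1 1%E); congr (_ * _)%E.
  exact: lebesgue_unit_cube.
exact: probability_setT.
Qed.

Lemma mma_process_exists (nu : probability V R) dO (O : measurableType dO)
    (Q : probability O R) (M : set SV -> {RV Q >-> R}) f :
  SaS_random_measure alpha (mu nu) M -> inLp alpha (mu nu) f ->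
  exists Y : Rd R d -> {RV Q >-> R}, sas_exponent alpha Q Y (mma_exponent nu f).
Proof.
move=> MS Lf; have [mA A1] := mma_unit_set nu.
have H t : exists Y : {RV Q >-> R},
    is_stable_integral alpha (mu nu) M (fun x => f (shift t x)) Y.
  by apply: (stable_int_exists alpha0 MS mA A1); exact: inLp_shift.
exists (fun t => projT1 (cid (H t))).
apply: (stable_int_exponent alpha0 alpha2 MS (G := fun t x => f (shift t x))) => t.
by apply/(stable_intP alpha0); exact: (projT2 (cid (H t))).
Qed.

(** Restricting the mixing variable to [A] and to its complement splits the
    process into two independent stationary pieces, realised on a product of
    two copies of the probability space. *)
Lemma indecomposable_restrictV dO (O : measurableType dO) (P : probability O R)
    (X : Rd R d -> {RV P >-> R}) (nu : probability V R) f (A : set V) :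
  inLp alpha (mu nu) f ->
  integral_representation alpha X (mu nu) (fun t x => f (shift t x)) ->
  indecomposable alpha X -> measurable A ->
  exists c, forall a, mma_exponent nu (restrictV A f) a = c * mma_exponent nu f a.
Proof.
move=> Lf rX iX mA.
have NX : sas_exponent alpha P X (mma_exponent nu f).
  exact: (integral_representation_exponent alpha0 alpha2 rX).
have [dQ [OQ [Q [M [_ [MS _ _]]]]]] := rX.
pose B (k : 'I_2) := if k == ord0 then A else ~` A.
have mB k : measurable (B k) by rewrite /B; case: ifP => // _; exact: measurableC.
have LB k : inLp alpha (mu nu) (restrictV (B k) f) by exact: inLp_restrictV.
pose F k := projT1 (cid (mma_process_exists MS (LB k))).
have FN k : sas_exponent alpha Q (F k) (mma_exponent nu (restrictV (B k) f)).
  exact: (projT2 (cid (mma_process_exists MS (LB k)))).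
have mF k t : measurable_fun setT (fun w => F k t (proj (k != ord0) w)).
  by apply: (measurableT_comp (measurable_funPT _)); exact: measurable_proj.
pose Y k t := projT1 (cid (mkRV (prodP Q) (mF k t))).
have YE k t : Y k t = (fun w => F k t (proj (k != ord0) w)) :> (_ -> _).
  exact: (projT2 (cid (mkRV (prodP Q) (mF k t)))).
have YN k : sas_exponent alpha (prodP Q) (Y k) (mma_exponent nu (restrictV (B k) f)).
  have := exponent_proj (k != ord0) (FN k).
  by congr sas_exponent; apply/funext => t; rewrite YE.
have iY : independent_processes Y.
  apply: (@independent_proj _ _ _ _ Q Y (fun k t => F k t)).
    by move=> k t; exact: measurable_funPT.
  by move=> k t w; rewrite YE.
have dec : stationary_decomposition alpha X Y.
  split => //.
  - by move=> k; exact: (exponent_SaS_process alpha0 (YN k)).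
  - move=> k; apply: (exponent_stationary (YN k)) => h a.
    exact: mma_exponent_translate.
  - apply: (exponent_fdd_eq NX); have := independent_exponent_sum iY YN.
    congr sas_exponent; apply/funext => a.
    by rewrite big_ord_recl big_ord1 /B /= -mma_exponent_split.
have [c Yc] : trivial_component X (Y ord0) by apply: iX; exists 2, Y, ord0.
exists (`|c| `^ alpha) => a.
have E1 := exponent_scale c NX.
have mY t : measurable_fun setT (Y ord0 t) by exact: measurable_funPT.
have E2 := fdd_eq_exponent mY Yc E1.
have := exponent_unique E2 (YN ord0) a.
by rewrite /B eqxx.
Qed.

End mixed_moving_average.

(** * An indecomposable mixed moving average is a moving average *)

Lemma ae_countable (R : realType) d (S : measurableType d) (mu : {measure set S -> \bar R})
    (J : countType) (Q : J -> S -> Prop) :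
  (forall j, {ae mu, forall x, Q j x}) -> {ae mu, forall x, forall j, Q j x}.
Proof.
move=> H.
have : {ae mu, forall x, forall n : nat, if unpickle n is Some j then Q j x else True}.
  apply: ae_foralln => n; case: (unpickle n) => [j|]; first exact: H.
  exact: aeW.
by apply: filterS => x h j; have := h (pickle j); rewrite pickleK.
Qed.

Section sections.
Context (R : realType) (alpha : R) (alpha0 : 0 < alpha) (alpha2 : alpha < 2) (d : nat).
Context (dV : measure_display) (V : measurableType dV).
Local Notation SV := (Rd R d * V)%type.
Local Notation lam := (lebesgue_Rd R d).
Local Notation mu nu := (lebesgue_Rd R d \x nu)%E.
Implicit Types (nu : {finite_measure set V -> \bar R}) (f h : SV -> R) (A : set V).

Definition section_mass h (v : V) : \bar R :=
  (\int[lam]_s (`|h (s, v)| `^ alpha)%:E)%E.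

Lemma measurable_apowE h : measurable_fun setT h ->
  measurable_fun setT (fun x => (`|h x| `^ alpha)%:E).
Proof. by move=> mh; apply/measurable_EFinP; exact: measurable_apow. Qed.

Lemma section_mass_ge0 h v : (0 <= section_mass h v)%E.
Proof. by apply: integral_ge0 => s _; rewrite lee_fin powR_ge0. Qed.

Lemma measurable_section_mass h : measurable_fun setT h ->
  measurable_fun setT (section_mass h).
Proof.
move=> mh; apply: (measurable_fun_fubini_tonelli_G (m1 := lam)
  (fun x => (`|h x| `^ alpha)%:E)); first exact: measurable_apowE.
by move=> x; rewrite lee_fin powR_ge0.
Qed.

Lemma integral_section_mass nu h : measurable_fun setT h ->
  (\int[mu nu]_x (`|h x| `^ alpha)%:E = \int[nu]_v section_mass h v)%E.
Proof.
move=> mh; rewrite (fubini_tonelli2 (fun x => (`|h x| `^ alpha)%:E))//.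
exact: measurable_apowE.
Qed.

Lemma amass_section nu h : inLp alpha (mu nu) h ->
  ((amass alpha (mu nu) h)%:E = \int[nu]_v section_mass h v)%E.
Proof. by move=> Lh; rewrite -amassE// integral_section_mass//; exact: Lh.1. Qed.

Lemma amass_section_restrict nu h A : measurable A -> inLp alpha (mu nu) h ->
  ((amass alpha (mu nu) (restrictV A h))%:E = \int[nu]_(v in A) section_mass h v)%E.
Proof.
move=> mA Lh; rewrite amass_section; last exact: inLp_restrictV.
rewrite [RHS]integral_mkcond; apply: eq_integral => v _; rewrite patchE /section_mass.
case: ifPn => vA; first by apply: eq_integral => s _; rewrite /restrictV indicE vA mulr1.
under eq_integral do rewrite /restrictV indicE (negbTE vA) mulr0 normr0 (powR0 (lt0r_neq0 alpha0)).
by rewrite integral0.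
Qed.

(** A section is a mixed moving average whose mixing measure is a point mass, so
    that [mma_exponent] covers both. *)
Lemma inLp_dirac v h : measurable_fun setT h -> (section_mass h v < +oo)%E ->
  inLp alpha (mu \d_v) h.
Proof.
move=> mh hv; split => //; apply/integrableP; split; first exact: measurable_apowE.
under eq_integral do rewrite gee0_abs ?lee_fin ?powR_ge0//.
rewrite integral_section_mass// integral_dirac//; last exact: measurable_section_mass.
by rewrite diracT mul1e.
Qed.

Lemma amass_dirac v h : inLp alpha (mu \d_v) h ->
  ((amass alpha (mu \d_v) h)%:E = section_mass h v)%E.
Proof.
move=> Lh; rewrite amass_section// integral_dirac//; last exact: measurable_section_mass Lh.1.
by rewrite diracT mul1e.
Qed.

(** If all pieces are proportional to the whole, so are almost all sections;
    rational combinations of translates and continuity of translations make the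
    exceptional null set independent of the combination. *)
Lemma proportional_section (nu : probability V R) f b : inLp alpha (mu nu) f ->
  (forall A, measurable A -> exists c, forall a,
     mma_exponent alpha nu (restrictV A f) a = c * mma_exponent alpha nu f a) ->
  mma_exponent alpha nu f b != 0 ->
  exists v, [/\ inLp alpha (mu \d_v) f, 0 < mma_exponent alpha \d_v f b &
    forall a, mma_exponent alpha nu f b * mma_exponent alpha \d_v f a =
              mma_exponent alpha nu f a * mma_exponent alpha \d_v f b].
Proof.
move=> Lf prop b0.
pose N := mma_exponent alpha nu f.
pose F (a : lincomb R (Rd R d)) := section_mass (fun x => ev a (fun t => f (shift t x))).
have La a : inLp alpha (mu nu) (fun x => ev a (fun t => f (shift t x))) by exact: inLp_mma.
have mF a : measurable_fun setT (F a) by apply: measurable_section_mass; exact: (La a).1.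
have F0 a v : (0 <= F a v)%E by exact: section_mass_ge0.
have IF a : (\int[nu]_v F a v = (N a)%:E)%E by rewrite -amass_section.
have iF a : nu.-integrable setT (F a).
  apply/integrableP; split => //; under eq_integral do rewrite gee0_abs//.
  by rewrite IF ltry.
have IA A a : measurable A -> (\int[nu]_(v in A) F a v =
    (mma_exponent alpha nu (restrictV A f) a)%:E)%E.
  move=> mA; rewrite -(amass_section_restrict mA (La a)); congr EFin.
  by apply: eq_Rintegral => x _; rewrite ev_restrictV.
have Fdef a : F a = section_mass (fun x => ev a (fun t => f (shift t x))) by [].
have Ndef a : N a = mma_exponent alpha nu f a by [].
clearbody F N.
have aeF a : {ae nu, forall v, ((N b)%:E * F a v = (N a)%:E * F b v)%E}.
  have : ae_eq nu setT (fun v => (N b)%:E * F a v)%E (fun v => (N a)%:E * F b v)%E.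
    have i1 : nu.-integrable setT (fun v => (N b)%:E * F a v)%E.
      exact: (integrableZl measurableT (N b) (iF a)).
    have m2 : measurable_fun setT (fun v => (N a)%:E * F b v)%E.
      exact: measurable_funeM.
    apply: (integral_ae_eq measurableT i1 m2) => E _ mE; have [c cE] := prop E mE.
    have iE a' : nu.-integrable E (F a') by exact: (integrableS measurableT mE (@subsetT _ E) (iF a')).
    rewrite (integralZl mE (iE a) (N b)).
    rewrite (integralZl mE (iE b) (N a)).
    rewrite (IA E a mE).
    rewrite (IA E b mE).
    rewrite (cE a) (cE b) -!Ndef.
    by rewrite -EFinM -EFinM; congr EFin; ring.
  by apply: filterS => v; apply.
have aeA := ae_countable (fun i : ratcomb d => aeF (of_ratcomb R i)).
have aefin : {ae nu, forall v, F [:: (1, zeroRd R d)] v \is a fin_num}.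
  by have := integrable_ae measurableT (iF [:: (1, zeroRd R d)]); apply: filterS => v; apply.
have fE : (fun x => ev [:: (1, zeroRd R d)] (fun t => f (shift t x))) = f.
  by apply/funext => -[s v]; rewrite ev1 /shift /= add0Rd.
have good : {ae nu, forall v, (forall i : ratcomb d,
     ((N b)%:E * F (of_ratcomb R i) v = (N (of_ratcomb R i))%:E * F b v)%E) /\
     (section_mass f v < +oo)%E}.
  apply: filterS2 aeA aefin => v h1 h2; split => //.
  by move: h2; rewrite Fdef fE => h2; rewrite -ge0_fin_numE// section_mass_ge0.
have [v [[gv1 gv2] Fb0]] : exists v, ((forall i : ratcomb d,
     ((N b)%:E * F (of_ratcomb R i) v = (N (of_ratcomb R i))%:E * F b v)%E) /\
     (section_mass f v < +oo)%E) /\ F b v != 0%E.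
  apply: contrapT => h; move: b0; rewrite -Ndef.
  suff -> : N b = 0 by rewrite eqxx.
  apply: EFin_inj; rewrite -IF.
  transitivity (\int[nu]_v (cst 0 v : \bar R))%E; last exact: integral0.
  apply: ae_eq_integral => //.
  apply: filterS good => v gv _; apply: contrapT => /eqP Fv; apply: h.
  by exists v.
have mfv : measurable_fun setT f := Lf.1.
have Lv : inLp alpha (mu \d_v) f by exact: inLp_dirac.
have Ev a : ((mma_exponent alpha \d_v f a)%:E = F a v)%E.
  by rewrite Fdef -amass_dirac//; exact: inLp_mma.
pose N0 := mma_exponent alpha \d_v f.
have N0def a : N0 a = mma_exponent alpha \d_v f a by [].
have EN0 a : (N0 a)%:E = F a v by rewrite N0def.
clearbody N0.
have rat_eq i : N b * N0 (of_ratcomb R i) = N (of_ratcomb R i) * N0 b.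
  by apply: EFin_inj; rewrite 2!EFinM 2!EN0 gv1.
have N0b : 0 < N0 b.
  have N00 : 0 <= N0 b by rewrite N0def; exact: amass_ge0.
  rewrite lt_neqAle N00 andbT; apply: contra Fb0 => /eqP e.
  by rewrite -EN0 -e.
have lim a : N b * N0 a = N a * N0 b.
  have [i ia] := ratcomb_mass_approx alpha0 V alpha2 a.
  have c1 : N (of_ratcomb R (i n)) @[n --> \oo] --> N a.
    by rewrite Ndef (funext (fun n => Ndef (of_ratcomb R (i n)))); exact: ia.
  have c2 : N0 (of_ratcomb R (i n)) @[n --> \oo] --> N0 a.
    by rewrite N0def (funext (fun n => N0def (of_ratcomb R (i n)))); exact: (ia \d_v f Lv).
  have c3 : N b * N0 (of_ratcomb R (i n)) @[n --> \oo] --> N b * N0 a.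
    by apply: cvgM; [exact: cvg_cst|exact: c2].
  have c4 : N (of_ratcomb R (i n)) * N0 b @[n --> \oo] --> N a * N0 b.
    by apply: cvgM; [exact: c1|exact: cvg_cst].
  rewrite (funext (fun n => rat_eq (i n))) in c3.
  exact: (cvg_unique _ c3 c4).
exists v; split; [exact: Lv|by rewrite -N0def|].
by move=> a; rewrite -!Ndef -!N0def.
Qed.

End sections.

Section section_kernel.
Context (R : realType) (alpha : R) (alpha0 : 0 < alpha) (alpha2 : alpha < 2) (d : nat).
Local Notation lam := (lebesgue_Rd R d).

Lemma inLp_addRd g t : inLp alpha lam g -> inLp alpha lam (fun s => g (addRd t s)).
Proof.
move=> [mg /integrableP[m1 i1]].
have mgt : measurable_fun setT (fun s => g (addRd t s)).
  exact: measurableT_comp (measurable_addRd t).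
split => //; apply/integrableP; split; first by apply/measurable_EFinP; exact: measurable_apow.
move: i1; rewrite -(ge0_integral_addRd t (f := fun x => `|(`|g x| `^ alpha)%:E|%E))//.
exact: measurableT_comp.
Qed.

Lemma marginal_random_measure dV (V : measurableType dV) (nu : probability V R)
    dO (O : measurableType dO) (Q : probability O R) (M : set (Rd R d * V) -> {RV Q >-> R}) :
  SaS_random_measure alpha (lam \x nu)%E M ->
  SaS_random_measure alpha lam (fun B => M (B `*` setT)).
Proof.
pose mu : {measure set (Rd R d * V) -> \bar R} := (lam \x nu)%E.
have muE B : measurable B -> mu (B `*` setT) = (lam : {measure set _ -> \bar R}) B.
  move=> mB; rewrite [LHS]product_measure1E// -[RHS]mule1; congr (_ * _)%E.
  exact: probability_setT.
rewrite -/mu; clearbody mu; move: (lam : {measure set _ -> \bar R}) muE => la muE.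
have fmX B : finite_measurable la B -> finite_measurable mu (B `*` [set: V]).
  by move=> [mB fB]; split; [exact: measurableX|rewrite muE].
have tX J (A : J -> set (Rd R d)) : trivIset setT A -> trivIset setT (fun j => A j `*` [set: V]).
  move=> tA i j _ _ [[s v] [[/= h1 _] [/= h2 _]]].
  by apply: (tA i j I I); exists s.
move=> [M1 M2 M3]; split.
- by move=> B fB t; rewrite (M1 _ (fmX B fB)) muE//; exact: fB.1.
- by move=> n A fA tA; apply: M2 => [k|]; [exact: fmX|exact: tX].
- move=> A fA tA fU; rewrite setX_bigcupl; apply: M3 => [k||].
  + exact: fmX.
  + exact: tX.
  + by rewrite -setX_bigcupl; exact: fmX.
Qed.

(** A section whose exponent is proportional to that of the process, rescaled so
    that the exponents agree. *)
Lemma indecomposable_moving_average dO (O : measurableType dO) (P : probability O R)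
    (X : Rd R d -> {RV P >-> R}) dV (V : measurableType dV) (nu : probability V R)
    (f : Rd R d * V -> R) :
  inLp alpha (lam \x nu)%E f ->
  integral_representation alpha X (lam \x nu)%E (fun t x => f (shift t x)) ->
  indecomposable alpha X ->
  exists2 g : Rd R d -> R, inLp alpha lam g &
    integral_representation alpha X lam (fun t s => g (addRd t s)).
Proof.
move=> Lf rX iX.
have NX : sas_exponent alpha P X (mma_exponent alpha nu f).
  exact: (integral_representation_exponent alpha0 alpha2 rX).
suff [g Lg gN] : exists2 g : Rd R d -> R, inLp alpha lam g &
    forall a, amass alpha lam (fun s => ev a (fun t => g (addRd t s))) = mma_exponent alpha nu f a.
  have [dQ [OQ [Q [M [_ [MS _ _]]]]]] := rX.
  have MS' := marginal_random_measure MS.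
  exists g => //; exists dQ, OQ, Q, (fun B => M (B `*` setT)).
  have H t : exists Y : {RV Q >-> R},
      is_stable_integral alpha lam (fun B => M (B `*` setT)) (fun s => g (addRd t s)) Y.
    apply: (stable_int_exists alpha0 MS' (measurable_box (fun=> 0) (fun=> 1))).
      exact: lebesgue_unit_cube.
    exact: inLp_addRd.
  exists (fun t => projT1 (cid (H t))); split => //.
    by move=> t; exact: (projT2 (cid (H t))).
  apply: (exponent_fdd_eq NX).
  have := stable_int_exponent alpha0 alpha2 MS' (G := fun t s => g (addRd t s))
    (fun t => proj1 (stable_intP alpha0 _ _ _ _) (projT2 (cid (H t)))).
  by congr sas_exponent; apply/funext => a; rewrite gN.
have [allz|] := pselect (forall b, mma_exponent alpha nu f b = 0).
  exists (fun=> 0); first exact: inLp0.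
  move=> a; rewrite allz -[RHS](amass0 alpha0 lam); apply: eq_Rintegral => s _.
  by rewrite /ev big1// => p _; rewrite mulr0.
move=> /existsNP[b /eqP b0].
have [v [Lv vb vE]] := proportional_section alpha0 alpha2 Lf
  (fun A mA => indecomposable_restrictV alpha0 alpha2 Lf rX iX mA) b0.
pose k := mma_exponent alpha nu f b / mma_exponent alpha \d_v f b.
have k0 : 0 <= k by rewrite divr_ge0 ?amass_ge0.
pose c := k `^ alpha^-1.
have ck : `|c| `^ alpha = k.
  by rewrite ger0_norm ?powR_ge0// -powRrM mulVf ?gt_eqF// powRr1.
have mf : measurable_fun setT f := Lf.1.
pose g s := c * f (s, v).
have sec a : inLp alpha lam (fun s => ev a (fun t => f (shift t (s, v)))) /\
    amass alpha lam (fun s => ev a (fun t => f (shift t (s, v)))) = mma_exponent alpha \d_v f a.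
  have La := inLp_mma alpha0 a Lv; have E := amass_dirac La.
  have mh : measurable_fun setT (fun s => ev a (fun t => f (shift t (s, v)))).
    exact: (measurableT_comp La.1 (pair2_measurable v)).
  have Lh : inLp alpha lam (fun s => ev a (fun t => f (shift t (s, v)))).
    split => //; apply/integrableP; split; first by apply/measurable_EFinP; exact: measurable_apow.
    under eq_integral do rewrite gee0_abs ?lee_fin ?powR_ge0//.
    by move: E; rewrite /section_mass => <-; rewrite ltry.
  by split => //; apply: EFin_inj; rewrite -amassE// E.
exists g => [|a].
  have [L0 _] := sec [:: (1, zeroRd R d)]; apply: inLpZ; move: L0.
  by congr inLp; apply/funext => s; rewrite ev1 /shift /= add0Rd.
rewrite (_ : amass _ _ _ = amass alpha lam (fun s => c * ev a (fun t => f (shift t (s, v))))).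
  have [La Ea] := sec a; rewrite amassZ// ck Ea /k mulrAC vE mulfK// gt_eqF//.
apply: eq_Rintegral => s _; congr (`|_| `^ _).
by rewrite /ev big_distrr; apply: eq_bigr => p _ /=; rewrite mulrCA.
Qed.

End section_kernel.

(** * Averages of translates of an integrable function of mean zero *)

Section averages.
Context (R : realType) (d : nat).
Local Notation lam := (lebesgue_Rd R d).
Local Notation L1 := (inLp 1 (lebesgue_Rd R d)).
Implicit Types (f g : Rd R d -> R) (v : Rd R d) (l : seq (Rd R d)).

Definition L1mass := locked (amass 1 (lebesgue_Rd R d)).

Lemma L1massE f : L1mass f = amass 1 lam f.
Proof. by rewrite /L1mass -lock. Qed.

Definition half_translate v f s := (f s + f (addRd v s)) / 2.

Definition average l f := foldr half_translate f l.

Lemma L1mass_ge0 f : 0 <= L1mass f.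
Proof. by rewrite L1massE amass_ge0. Qed.

Lemma L1mass_triangle f g : L1 f -> L1 g -> L1mass (fun s => f s + g s) <= L1mass f + L1mass g.
Proof.
move=> Lf Lg; have [_ ifg] := inLpD (@ltr01 R) Lf Lg; have [[_ i_f] [_ ig]] := (Lf, Lg).
rewrite !L1massE /amass -RintegralD//; apply: le_Rintegral => //.
  exact: (integrableD measurableT i_f ig).
by move=> s _; rewrite !powRr1//; exact: ler_normD.
Qed.

Lemma L1massZ c f : L1 f -> L1mass (fun s => c * f s) = `|c| * L1mass f.
Proof. by move=> Lf; rewrite !L1massE amassZ// powRr1. Qed.

Lemma L1mass_translate v f : L1 f -> L1mass (fun s => f (addRd v s)) = L1mass f.
Proof.
move=> [mf _]; rewrite !L1massE; congr fine.
apply: (ge0_integral_addRd v (f := fun x => (`|f x| `^ 1)%:E)).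
  by apply/measurable_EFinP; exact: measurable_apow.
by move=> x; rewrite lee_fin powR_ge0.
Qed.

Lemma L1D f g : L1 f -> L1 g -> L1 (fun s => f s + g s).
Proof. exact: inLpD. Qed.

Lemma L1_half_translate v f : L1 f -> L1 (half_translate v f).
Proof.
move=> Lf; have := inLpZ (2^-1) (L1D Lf (inLp_addRd v Lf)).
by congr inLp; apply/funext => s; rewrite mulrC.
Qed.

Lemma L1mass_half_translate v f : L1 f -> L1mass (half_translate v f) <= L1mass f.
Proof.
move=> Lf; have Lv := inLp_addRd v Lf.
rewrite (_ : half_translate v f = fun s => 2^-1 * (f s + f (addRd v s))).
  rewrite L1massZ; last exact: L1D.
  have := L1mass_triangle Lf Lv; rewrite L1mass_translate// ger0_norm//; lra.
by apply/funext => s; rewrite mulrC.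
Qed.

Lemma L1_average l f : L1 f -> L1 (average l f).
Proof. by move=> Lf; elim: l => //= v l IH; exact: L1_half_translate. Qed.

Lemma L1mass_average l f : L1 f -> L1mass (average l f) <= L1mass f.
Proof.
move=> Lf; elim: l => //= v l IH; apply: le_trans IH.
exact/L1mass_half_translate/L1_average.
Qed.

Lemma averageD l f g s : average l (fun s => f s + g s) s = average l f s + average l g s.
Proof. by elim: l s => //= v l IH s; rewrite /half_translate !IH; ring. Qed.

Lemma averageZ l c f s : average l (fun s => c * f s) s = c * average l f s.
Proof. by elim: l s => //= v l IH s; rewrite /half_translate !IH; ring. Qed.

Lemma average_cat l l' f : average (l ++ l') f = average l (average l' f).
Proof. exact: foldr_cat. Qed.

Lemma half_translateC v w f : half_translate v (half_translate w f) =
  half_translate w (half_translate v f).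
Proof.
by apply/funext => s; rewrite /half_translate !addRdA (addRdC v w); ring.
Qed.

Lemma averageC l l' f : average l (average l' f) = average l' (average l f).
Proof.
elim: l => //= v l ->; elim: l' => //= w l' <-.
by rewrite half_translateC.
Qed.

Definition averages_out f := L1 f /\ forall e : R, 0 < e -> exists l, L1mass (average l f) <= e.

Lemma averages_outD f g : averages_out f -> averages_out g ->
  averages_out (fun s => f s + g s).
Proof.
move=> [Lf Af] [Lg Ag]; split; first exact: L1D.
move=> e e0; have e2 : 0 < e / 2 by rewrite divr_gt0.
have [l lf] := Af _ e2; have [l' lg] := Ag _ e2; exists (l' ++ l).
rewrite average_cat (_ : average l (fun s => f s + g s) = fun s => average l f s + average l g s).
  rewrite (_ : average l' _ = fun s => average l' (average l f) s + average l' (average l g) s).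
    apply: (le_trans (L1mass_triangle (L1_average l' (L1_average l Lf))
      (L1_average l' (L1_average l Lg)))).
    rewrite (splitr e); apply: lerD.
      exact: le_trans (L1mass_average l' (L1_average l Lf)) lf.
    by rewrite averageC; exact: le_trans (L1mass_average l (L1_average l' Lg)) lg.
  by apply/funext => s; exact: averageD.
by apply/funext => s; exact: averageD.
Qed.

Lemma averages_outZ c f : averages_out f -> averages_out (fun s => c * f s).
Proof.
move=> [Lf Af]; split; first exact: inLpZ.
move=> e e0; have c0 : 0 < `|c| + 1 by have := normr_ge0 c; lra.
have [l lf] := Af _ (divr_gt0 e0 c0); exists l.
rewrite (_ : average l _ = fun s => c * average l f s); last by apply/funext => s; exact: averageZ.
rewrite L1massZ; last exact: L1_average.
rewrite ler_pdivlMr// in lf; apply: le_trans lf.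
by rewrite mulrC ler_wpM2l ?L1mass_ge0// lerDl.
Qed.

Lemma averages_out_lim f : L1 f -> (forall e, 0 < e ->
    exists g, averages_out g /\ L1mass (fun s => f s - g s) <= e) -> averages_out f.
Proof.
move=> Lf H; split=> // e e0; have e2 : 0 < e / 2 by rewrite divr_gt0.
have [g [[Lg Ag] fg]] := H _ e2; have [l lg] := Ag _ e2; exists l.
have Lfg : L1 (fun s => f s - g s) by exact: inLpB.
rewrite (_ : average l f = fun s => average l (fun s => f s - g s) s + average l g s).
  apply: (le_trans (L1mass_triangle (L1_average l Lfg) (L1_average l Lg))).
  by rewrite (splitr e) lerD// (le_trans (L1mass_average l Lfg)).
by apply/funext => s; rewrite -averageD; congr (average l _ s); apply/funext => u; rewrite subrK.
Qed.

(** Doubling the step telescopes: the averages of [f - f (v + .)] along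
    [v], [2v], [4v], etc. are [2^-k] times a difference of two translates. *)
Lemma averages_out_diff v f : L1 f -> averages_out (fun s => f s - f (addRd v s)).
Proof.
move=> Lf; split; first by apply: inLpB => //; exact: inLp_addRd.
move=> e e0.
have H k : exists l u, forall s, average l (fun s => f s - f (addRd v s)) s =
    (2^-1) ^+ k * (f s - f (addRd u s)).
  elim: k => [|k [l [u lu]]]; first by exists [::], v => s; rewrite mul1r.
  exists (u :: l), (addRd u u) => s; rewrite /= /half_translate !lu -addRdA exprS.
  by field.
have m0 : 0 <= L1mass f by exact: L1mass_ge0.
have e1 : 0 < e / (2 * L1mass f + 1) by apply: divr_gt0 => //; lra.
have z1 : `|2^-1 : R| < 1 by rewrite ger0_norm; lra.
have /cvgrPdist_le /(_ _ e1) [k _ /(_ k (leqnn k))] := cvg_expr z1.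
rewrite sub0r normrN ger0_norm ?exprn_ge0// => kh.
have [l [u lu]] := H k; exists l; rewrite (funext lu).
have Lu := inLp_addRd u Lf.
rewrite L1massZ; last exact: inLpB.
have : L1mass (fun s => f s - f (addRd u s)) <= 2 * L1mass f.
  rewrite (_ : (fun s => _) = fun s => f s + (-1) * f (addRd u s)).
    apply: (le_trans (L1mass_triangle Lf (inLpZ (-1) Lu))).
    by rewrite L1massZ// L1mass_translate// normrN normr1; lra.
  by apply/funext => s; rewrite mulN1r.
move=> h; rewrite ger0_norm ?exprn_ge0//.
rewrite ler_pdivlMr in kh; last by lra.
apply: le_trans kh; apply: ler_wpM2l; first exact: exprn_ge0.
by apply: (le_trans h); lra.
Qed.

Lemma averages_out0 : averages_out (fun=> 0).
Proof.
have := averages_outZ 0 (averages_out_diff (zeroRd R d) (inLp0 (@ltr01 R) lam)).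
by congr averages_out; apply/funext => s; rewrite mul0r.
Qed.

Lemma averages_out_translate v f g : L1 f -> (forall s, g (addRd v s) = f s) -> L1 g ->
  averages_out (fun s => g s - f s).
Proof.
move=> Lf gf Lg; have := averages_out_diff v Lg.
by congr averages_out; apply/funext => s; rewrite gf.
Qed.

End averages.

Section mean_zero.
Context (R : realType) (d : nat).
Local Notation lam := (lebesgue_Rd R d).
Local Notation L1 := (inLp 1 (lebesgue_Rd R d)).
Implicit Types (f g : Rd R d -> R) (v : Rd R d).

Definition equiv_avg f g := averages_out (fun s => f s - g s).

Lemma equiv_refl f : equiv_avg f f.
Proof.
by have := averages_out0 R d; congr averages_out; apply/funext => s; rewrite subrr.
Qed.

Lemma equiv_sym f g : equiv_avg f g -> equiv_avg g f.
Proof.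
move=> /(averages_outZ (-1)); congr averages_out.
by apply/funext => s; rewrite mulN1r opprB.
Qed.

Lemma equiv_trans g f h : equiv_avg f g -> equiv_avg g h -> equiv_avg f h.
Proof.
move=> A B; have := averages_outD A B.
by congr averages_out; apply/funext => s; rewrite addrA subrK.
Qed.

Lemma equivD f g f' g' : equiv_avg f g -> equiv_avg f' g' ->
  equiv_avg (fun s => f s + f' s) (fun s => g s + g' s).
Proof.
move=> A B; have := averages_outD A B.
by congr averages_out; apply/funext => s; ring.
Qed.

Lemma equivZ c f g : equiv_avg f g -> equiv_avg (fun s => c * f s) (fun s => c * g s).
Proof.
move=> /(averages_outZ c); congr averages_out.
by apply/funext => s; ring.
Qed.

Lemma equiv_translate v f g : L1 f -> L1 g -> (forall s, g (addRd v s) = f s) ->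
  equiv_avg f g.
Proof. by move=> Lf Lg gf; apply: equiv_sym; exact: (averages_out_translate (v := v)). Qed.

(** A family additive in a nonnegative parameter is, up to functions that
    average out, linear in it: compare [g l] with [k / n * g 1], where
    [k <= n * l < k + 1]. *)
Lemma additive_linear (g : R -> Rd R d -> R) (C : R) :
  (forall x, 0 <= x -> L1 (g x)) -> (forall x, 0 <= x -> L1mass (g x) <= C * x) ->
  (forall x y, 0 <= x -> 0 <= y -> equiv_avg (g (x + y)) (fun s => g x s + g y s)) ->
  forall x, 0 <= x -> equiv_avg (g x) (fun s => x * g 1 s).
Proof.
move=> Lg mg gD.
have C0 : 0 <= C by have := mg 1 ler01; rewrite mulr1; apply: le_trans; exact: L1mass_ge0.
have g0 : equiv_avg (g 0) (fun=> 0).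
  have := gD 0 0 (lexx _) (lexx _); rewrite addr0 => /equiv_sym.
  by congr averages_out; apply/funext => s; rewrite addrK subr0.
have gn n x : 0 <= x -> equiv_avg (fun s => n%:R * g x s) (g (n%:R * x)).
  move=> x0; elim: n => [|n IH].
    by rewrite mul0r; apply: equiv_sym; under [X in equiv_avg _ X]eq_fun do rewrite mul0r.
  rewrite (_ : (fun s => _) = fun s => n%:R * g x s + g x s).
    rewrite -natr1 mulrDl mul1r; apply: (equiv_trans (equivD IH (equiv_refl _))).
    by apply: equiv_sym; apply: gD => //; exact: mulr_ge0.
  by apply/funext => s; rewrite -natr1 mulrDl mul1r.
move=> x x0; have L1g := Lg 1 ler01.
apply: averages_out_lim; first by apply: inLpB => //; [exact: Lg|exact: inLpZ].
move=> e e0.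
have [n nb] : exists n : nat, 2 * C <= e * n.+1%:R.
  exists (Num.truncn (2 * C / e)); apply/ltW.
  by rewrite [ltRHS]mulrC -ltr_pdivrMr//; exact: truncnS_gt.
set N : R := n.+1%:R in nb; have N0 : 0 < N by rewrite ltr0n.
have Nx : 0 <= N * x by apply: mulr_ge0 => //; exact: ltW.
have [k1 k2] : (Num.truncn (N * x))%:R <= N * x /\ N * x < (Num.truncn (N * x)).+1%:R.
  by have /andP[] := truncn_itv Nx.
set k := Num.truncn _ in k1 k2.
pose y := N * x - k%:R.
have y0 : 0 <= y by rewrite subr_ge0.
have y1 : y <= 1 by rewrite /y -natr1 in k2 *; lra.
have E : equiv_avg (fun s => N * g x s) (fun s => k%:R * g 1 s + g y s).
  apply: (equiv_trans (gn n.+1 x x0)); rewrite -/N.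
  have -> : N * x = k%:R * 1 + y by rewrite /y; ring.
  apply: (equiv_trans (gD _ _ _ y0)); first by rewrite mulr1.
  by apply: equivD; [apply: equiv_sym; exact: gn|exact: equiv_refl].
exists (fun s => N^-1 * (N * g x s - (k%:R * g 1 s + g y s))); split.
  exact: averages_outZ.
have Ly := Lg y y0.
rewrite (_ : (fun s => _) = fun s => N^-1 * (g y s + (- y) * g 1 s)); last first.
  apply/funext => s; rewrite /y; have : N != 0 by rewrite gt_eqF.
  by move=> N1; field.
rewrite L1massZ; last by apply: L1D => //; exact: inLpZ.
have h1 := L1mass_triangle Ly (inLpZ (- y) L1g).
rewrite (L1massZ _ L1g) normrN (ger0_norm y0) in h1.
have h2 := mg y y0; have h3 := mg 1 ler01.
rewrite ger0_norm ?invr_ge0 ?(ltW N0)// mulrC ler_pdivrMr//.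
apply: (le_trans _ nb); apply: (le_trans h1).
have h4 := L1mass_ge0 (g 1).
move: (L1mass _) (L1mass _) h2 h3 h4 => p q h2 h3 h4; nra.
Qed.

Definition vec (l : 'I_d -> R) : Rd R d := [tuple l i | i < d].

Lemma L1_box (b c : 'I_d -> R) : L1 (\1_(box b c)).
Proof.
apply: inLp_indic; [exact: ltr01|exact: measurable_box|].
by rewrite [X in (X < _)%E]lebesgue_box ltry.
Qed.

Lemma L1mass_box (b c : 'I_d -> R) : L1mass (\1_(box b c)) = \prod_(i < d) Num.max 0 (c i - b i).
Proof.
rewrite L1massE /amass /Rintegral.
rewrite (_ : (fun x => _) = fun x => (\1_(box b c) x)%:E); last first.
  by apply/funext => x /=; rewrite powRr1// ger0_norm.
rewrite integral_indic//; last exact: measurable_box.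
by rewrite setIT [X in fine X]lebesgue_box.
Qed.

Lemma box_translate (b c : 'I_d -> R) :
  equiv_avg (\1_(box b c)) (\1_(box (fun=> 0) (fun i => c i - b i))).
Proof.
apply: (equiv_translate (v := vec (fun i => - b i))); try exact: L1_box.
move=> s; rewrite !indicE; congr (nat_of_bool _)%:R; apply: asbool_equiv_eq.
by split => h i; have := h i; rewrite tnth_addRd tnth_mktuple; lra.
Qed.

Lemma mem_box_side (b c : 'I_d -> R) (s : Rd R d) (i : 'I_d) :
  (s \in box b c) = (b i <= tnth s i < c i) &&
    [forall j, (j != i) ==> (b j <= tnth s j < c j)].
Proof.
apply/idP/andP; first by rewrite inE => h; split => //; apply/forallP => j; rewrite h implybT.
move=> [h /forallP H]; rewrite inE => j.
by have [->//|ji] := eqVneq j i; have := H j; rewrite ji.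
Qed.

(** Splitting a box across the side [i] gives a box and a translate of one, so
    its indicator is additive in the length of that side. *)
Lemma box_side (l : 'I_d -> R) (i : 'I_d) (x : R) : 0 <= x ->
  let g y := \1_(box (fun=> 0) (fun j => if j == i then y else l j)) : Rd R d -> R in
  equiv_avg (g x) (fun s => x * g 1 s).
Proof.
move=> x0 g.
pose C := \prod_(j < d | j != i) Num.max 0 (l j).
apply: (additive_linear (C := C)) => // [y _|y y0|y z y0 z0].
- exact: L1_box.
- rewrite L1mass_box (bigD1 i)//= eqxx subr0 (max_idPr y0) mulrC.
  rewrite (eq_bigr (fun j => Num.max 0 (l j))) ?lexx// => j /negbTE ->.
  by rewrite subr0.
- pose f := \1_(box (fun j => if j == i then y else 0)
    (fun j => if j == i then y + z else l j)) : Rd R d -> R.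
  have -> : g (y + z) = fun s => g y s + f s.
    apply/funext => s; rewrite /g /f !indicE !(mem_box_side _ _ _ i) eqxx.
    set Q := [forall j, _]; set Q1 := [forall j, _]; set Q2 := [forall j, _].
    have -> : Q1 = Q by apply: eq_forallb => j; case: (j == i).
    have -> : Q2 = Q by apply: eq_forallb => j; case: (j == i).
    case: Q; rewrite ?andbT ?andbF ?addr0//.
    have [h1|h1] := leP y (tnth s i); have [h2|h2] := ltP (tnth s i) (y + z);
      have [h3|h3] := leP 0 (tnth s i) => //=; rewrite ?addr0 ?add0r//; lra.
  apply: equivD; first exact: equiv_refl.
  apply: (equiv_trans (box_translate _ _)).
  have -> : (fun j => (if j == i then y + z else l j) - (if j == i then y else 0)) =
      (fun j => if j == i then z else l j).
    by apply/funext => j; case: (j == i); [rewrite addrC addKr|rewrite subr0].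
  exact: equiv_refl.
Qed.

(** Normalise the sides one after the other. *)
Lemma box_equiv (b c : 'I_d -> R) :
  equiv_avg (\1_(box b c)) (fun s => (\prod_(i < d) Num.max 0 (c i - b i)) *
    \1_(box (fun=> 0) (fun=> 1)) s).
Proof.
have [/forallP bc|] := boolP [forall i, b i <= c i]; last first.
  rewrite negb_forall => /fintype.existsP[i nbc]; have cb : c i < b i by rewrite ltNge.
  rewrite (bigD1 i)//= (max_idPl _) ?mul0r; last by rewrite subr_le0 ltW.
  under [X in equiv_avg _ X]eq_fun do rewrite mul0r.
  rewrite (_ : \1_(box b c) = fun=> 0); first exact: equiv_refl.
  apply/funext => s; rewrite indicE memNset// => /(_ i) /andP[h1 h2].
  by have := le_lt_trans h1 h2; rewrite ltNge ltW.
apply: (equiv_trans (box_translate b c)).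
pose l i := c i - b i; have l0 i : 0 <= l i by rewrite subr_ge0.
rewrite (eq_bigr l) => [|i _]; last by rewrite (max_idPr (l0 i)).
pose r k (i : 'I_d) : R := if (i < k)%N then 1 else l i.
have H k : (k <= d)%N -> equiv_avg (\1_(box (fun=> 0) l))
    (fun s => (\prod_(i < d | (i < k)%N) l i) * \1_(box (fun=> 0) (r k)) s).
  elim: k => [|k IH] kd.
    rewrite big_pred0//; under [X in equiv_avg _ X]eq_fun do rewrite mul1r.
    exact: equiv_refl.
  apply: (equiv_trans (IH (ltnW kd))).
  pose o := Ordinal kd.
  have E x : (fun j => if j == o then x else r k j) =
      (fun j : 'I_d => if (j < k)%N then 1 else if j == o then x else l j).
    apply/funext => j; rewrite /r; case: eqP => [->|_] /=; first by rewrite ltnn.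
    by [].
  have -> : r k = fun j => if j == o then l o else r k j.
    by apply/funext => j; case: eqP => // ->; rewrite /r /= ltnn.
  have -> : r k.+1 = fun j => if j == o then 1 else r k j.
    apply/funext => j; rewrite /r ltnS leq_eqVlt -val_eqE/=.
    by case: eqP => //= _; case: (j < k)%N.
  have -> : \prod_(i < d | (i < k.+1)%N) l i = l o * \prod_(i < d | (i < k)%N) l i.
    rewrite (bigD1 o)//=; congr (_ * _); apply: eq_bigl => j.
    rewrite ltnS leq_eqVlt -val_eqE /=.
    by have [->|jk] := eqVneq (j : nat) k; rewrite ?ltnn ?andbF ?andbT.
  have := equivZ (\prod_(i < d | (i < k)%N) l i) (box_side (r k) o (l0 o)).
  by congr averages_out; apply/funext => s; rewrite mulrA [l o * _]mulrC.
have := H d (leqnn d); congr averages_out; apply/funext => s.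
have -> : \prod_(i < d | (i < d)%N) l i = \prod_(i < d) l i.
  by apply: eq_bigl => i; rewrite ltn_ord.
by rewrite (_ : r d = fun=> 1)//; apply/funext => i; rewrite /r ltn_ord.
Qed.

(** Boxes of equal volume are equivalent up to functions that average out, and
    the indicators of boxes span a dense subspace. *)
Theorem mean_zero_averages_out (f : Rd R d -> R) : L1 f ->
  \int[lam]_s f s = 0 -> averages_out f.
Proof.
pose E n := @cube R d n.
pose I (h : Rd R d -> R) := \int[lam]_s h s.
pose one := \1_(box (fun=> 0) (fun=> 1)) : Rd R d -> R.
have Lone : L1 one by exact: L1_box.
have int_f h : L1 h -> lam.-integrable setT (EFin \o h).
  move=> [mf fi]; apply: (@le_integrable _ _ _ lam setT measurableT _ _ _ _ fi).
    exact/measurable_EFinP.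
  by move=> x _; rewrite lee_fin /= powRr1// normr_id.
have Ile h : L1 h -> `|I h| <= L1mass h.
  move=> Lf; rewrite L1massE /amass (_ : (fun x => _) = fun x => `|h x|).
    by apply: le_normr_Rintegral => //; exact: int_f.
  by apply/funext => x; rewrite powRr1.
move=> Lf f0.
suff : equiv_avg f (fun s => I f * one s).
  by congr averages_out; apply/funext => s; rewrite /I f0 mul0r subr0.
move: f Lf {f0}.
apply: (@Lp_density _ 1 ltr01 _ _ lam (@boxes R d) E
  (fun f => equiv_avg f (fun s => I f * one s))).
- exact: measurable_boxes.
- exact: boxes_setI.
- by move=> n; do 2 eexists; reflexivity.
- exact: cube_ndecr.
- exact: cube_cover.
- by move=> n; rewrite [X in (X < _)%E]lebesgue_box ltry.
- move=> f g c Lf Lg Kf Kg; have := equivD (equivZ c Kf) Kg.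
  have -> : I (fun x => c * f x + g x) = c * I f + I g.
    rewrite /I RintegralD//; first by rewrite RintegralZl//; exact: int_f.
      exact: int_f (inLpZ c Lf).
    exact: int_f.
  by congr averages_out; apply/funext => s; ring.
- move=> f Lf H; apply: averages_out_lim; first by apply: inLpB => //; exact: inLpZ.
  move=> e e0; have e1 : 0 < e / (1 + L1mass one).
    by apply: divr_gt0 => //; have := L1mass_ge0 one; lra.
  have [g [Lg Kg fg]] := H _ e1; exists (fun s => g s - I g * one s); split => //.
  have Lfg : L1 (fun s => f s - g s) by exact: inLpB.
  rewrite (_ : (fun s => _) = fun s => (f s - g s) + (I g - I f) * one s); last first.
    by apply/funext => s; ring.
  apply: (le_trans (L1mass_triangle Lfg (inLpZ _ Lone))); rewrite L1massZ//.
  have : `|I g - I f| <= L1mass (fun s => f s - g s).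
    rewrite distrC; apply: le_trans (Ile _ Lfg).
    by rewrite /I RintegralB//; exact: int_f.
  rewrite -L1massE in fg; rewrite ler_pdivlMr in fg; last by have := L1mass_ge0 one; lra.
  have := L1mass_ge0 one; move: (L1mass _) (L1mass _) `|_| fg => p q r h1 h2 h3.
  by apply: le_trans h1; nra.
- move=> _ [b [c ->]] _.
  suff -> : I (\1_(box b c)) = \prod_(i < d) Num.max 0 (c i - b i) by exact: box_equiv.
  rewrite /I /Rintegral integral_indic//; last exact: measurable_box.
  by rewrite setIT [X in fine X]lebesgue_box.
Qed.

End mean_zero.

(** * Positive functionals on cosine polynomials *)

Section cosine_polynomials.
Context (R : realType) (T : Type).
Implicit Types (p q : seq (R * lincomb R T)) (x : T -> R) (u v : (T -> R) -> R)
  (N : lincomb R T -> R).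

Definition cev p x := \sum_(b <- p) b.1 * cos (ev b.2 x).

(** If [N] is the exponent of a process, this is the derivative at [t = 0+] of
    the expectation of [cev p] at the path multiplied by [t ^ (1 / alpha)]. *)
Definition generator N p := - \sum_(b <- p) b.1 * N b.2.

Definition pscale c p := [seq (c * b.1, b.2) | b <- p].

Lemma cev_cat p q x : cev (p ++ q) x = cev p x + cev q x.
Proof. by rewrite /cev big_cat. Qed.

Lemma cev_cons b p x : cev (b :: p) x = b.1 * cos (ev b.2 x) + cev p x.
Proof. by rewrite /cev big_cons. Qed.

Lemma cev_scale c p x : cev (pscale c p) x = c * cev p x.
Proof. by rewrite /cev big_map big_distrr; apply: eq_bigr => b _ /=; rewrite mulrA. Qed.

Lemma generator_cat N p q : generator N (p ++ q) = generator N p + generator N q.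
Proof. by rewrite /generator big_cat opprD. Qed.

Lemma generator_scale N c p : generator N (pscale c p) = c * generator N p.
Proof.
rewrite /generator big_map mulrN big_distrr; congr (- _).
by apply: eq_bigr => b _ /=; rewrite mulrA.
Qed.

Lemma ev0 (a : lincomb R T) : ev a (fun=> 0) = 0.
Proof. by rewrite /ev big1// => p _; rewrite mulr0. Qed.

Lemma cev0 p : cev p (fun=> 0) = \sum_(b <- p) b.1.
Proof. by apply: eq_bigr => b _; rewrite ev0 cos0 mulr1. Qed.

Definition cosp u := exists p, forall x, cev p x = u x.

Lemma cosp_cst c : cosp (fun=> c).
Proof.
exists [:: (c, [::])] => x; rewrite /cev big_seq1 /= ev_nil cos0.
exact: mulr1.
Qed.

Lemma cosp_cev p : cosp (cev p).
Proof. by exists p. Qed.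

Lemma cospD u v : cosp u -> cosp v -> cosp (fun x => u x + v x).
Proof. by move=> [p pu] [q qv]; exists (p ++ q) => x; rewrite cev_cat pu qv. Qed.

Lemma cospZ c u : cosp u -> cosp (fun x => c * u x).
Proof. by move=> [p pu]; exists (pscale c p) => x; rewrite cev_scale pu. Qed.

Lemma cospM u v : cosp u -> cosp v -> cosp (fun x => u x * v x).
Proof.
move=> [p pu] [q qv]; suff [r rpq] : cosp (fun x => cev p x * cev q x).
  by exists r => x; rewrite rpq pu qv.
clear pu qv; elim: p => [|[c a] p [r IH]].
  have [r H] := cosp_cst 0; exists r => x.
  by rewrite H /cev big_nil mul0r.
suff [s sq] : cosp (fun x => c * cos (ev a x) * cev q x).
  by exists (s ++ r) => x; rewrite cev_cat sq IH cev_cons -mulrDl.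
clear IH r; elim: q => [|[k b] q [r IH]].
  have [r H] := cosp_cst 0; exists r => x.
  by rewrite H /cev big_nil mulr0.
exists ((c * k / 2, a ++ b) :: (c * k / 2, a ++ scale (-1) b) :: r) => x.
by rewrite !cev_cons /= IH !ev_cat ev_scale mulN1r cosD cosB; field.
Qed.

Lemma cospX u n : cosp u -> cosp (fun x => u x ^+ n).
Proof.
move=> cu; elim: n => [|n IH]; first exact: cosp_cst.
by have := cospM cu IH; congr cosp; apply/funext => x; rewrite exprS.
Qed.

Lemma cospB u v : cosp u -> cosp v -> cosp (fun x => u x - v x).
Proof.
move=> cu cv; have := cospD cu (cospZ (-1) cv).
by congr cosp; apply/funext => x; rewrite mulN1r.
Qed.

(** The invariant bounds [r - t] by [r / (1 + k * r / 2)], hence by [2 / k]. *)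
Lemma sqrt_step (r t k : R) : 0 <= t <= r -> r <= 1 -> 0 <= k ->
  (r - t) * (1 + k * (r / 2)) <= r ->
  let t' := t + 2^-1 * (r ^+ 2 - t ^+ 2) in
  0 <= t' <= r /\ (r - t') * (1 + (k + 1) * (r / 2)) <= r.
Proof.
move=> /andP[t0 tr] r1 k0 h t'; have r0 : 0 <= r by exact: le_trans tr.
have E : r - t' = (r - t) * (1 - (r + t) / 2) by rewrite /t'; field.
have h1 : 0 <= t' by rewrite /t' expr2 expr2; nra.
have h2 : 0 <= (r - t) * (1 - (r + t) / 2) by apply: mulr_ge0; lra.
have h3 : t' <= r by rewrite -subr_ge0 E.
rewrite h1 h3; split => //; apply: le_trans h; rewrite E -mulrA.
apply: ler_wpM2l; first by lra.
apply: (@le_trans _ _ ((1 - r / 2) * (1 + (k + 1) * (r / 2)))).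
  by apply: ler_wpM2r; [have := mulr_ge0 k0 r0; lra|lra].
have := mulr_ge0 k0 (mulr_ge0 r0 r0); have := mulr_ge0 r0 r0; lra.
Qed.

(** Polynomial approximation of the absolute value from below, by the
    iteration [t + (r^2 - t^2) / 2] for the square root of [r^2]. *)
Lemma cosp_abs u (U e : R) : cosp u -> 0 < U -> 0 < e -> (forall x, `|u x| <= U) ->
  exists2 q, cosp q & forall x, `|u x| - e <= q x <= `|u x|.
Proof.
move=> cu U0 e0 uU.
pose r x := `|u x| / U.
have r1 x : 0 <= r x <= 1.
  by apply/andP; split; [apply: divr_ge0 => //; exact: ltW|rewrite ler_pdivrMr// mul1r].
have cr2 : cosp (fun x => r x ^+ 2).
  have := cospZ (U^-1 ^+ 2) (cospX 2 cu); congr cosp; apply/funext => x.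
  by rewrite /r exprMn real_normK ?num_real// mulrC.
have H (k : nat) : exists2 q, cosp q & forall x,
    0 <= q x <= r x /\ (r x - q x) * (1 + k%:R * (r x / 2)) <= r x.
  elim: k => [|k [q cq qr]].
    exists (fun=> 0); first exact: cosp_cst.
    by move=> x; have /andP[r0 _] := r1 x; rewrite lexx r0; split => //; lra.
  exists (fun x => q x + 2^-1 * (r x ^+ 2 - q x ^+ 2)).
    by apply: cospD => //; apply: cospZ; apply: cospB => //; exact: cospX.
  move=> x; have [h1 h2] := qr x; have /andP[_ r2] := r1 x.
  by rewrite -[k.+1%:R]natr1; exact: (sqrt_step h1 r2 (ler0n _ k) h2).
have [k ke] : exists k : nat, 2 * U <= e * k%:R.
  exists (Num.truncn (2 * U / e)).+1; apply/ltW.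
  by rewrite [ltRHS]mulrC -ltr_pdivrMr//; exact: truncnS_gt.
have [q cq qr] := H k; exists (fun x => U * q x); first exact: cospZ.
move=> x; have [/andP[h1 h2] h3] := qr x; have /andP[r0 r2] := r1 x.
have -> : `|u x| = U * r x by rewrite /r mulrC divfK// gt_eqF.
apply/andP; split; last by rewrite ler_pM2l.
rewrite lerBlDr addrC -lerBlDr -mulrBr.
have k0 : 0 <= k%:R :> R by exact: ler0n.
have [->|rn] := eqVneq (r x) 0.
  by rewrite sub0r mulrN (le_trans _ (ltW e0))// oppr_le0 mulr_ge0// ltW.
have rp : 0 < r x by rewrite lt_neqAle eq_sym rn.
have h4 : k%:R * (r x - q x) <= 2.
  rewrite -(ler_pM2r rp); move: (r x) (q x) k%:R h3 h2 k0 => s t n; nra.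
have kp : 0 < k%:R :> R.
  rewrite lt_neqAle k0 andbT; apply/eqP => k00; rewrite -k00 mulr0 in ke.
  by have := mulr_gt0 (@ltr0n R 2) U0; rewrite ltNge ke.
rewrite -(ler_pM2r kp); apply: le_trans ke.
by rewrite -mulrA [_ * k%:R]mulrC [leRHS]mulrC ler_pM2l.
Qed.

End cosine_polynomials.

Section exponent_positivity.
Context (R : realType) (alpha : R) (alpha0 : 0 < alpha) (T : Type).
Context (dO : measure_display) (O : measurableType dO) (P : probability O R).
Variables (X : T -> O -> R) (N : lincomb R T -> R).
Hypothesis XN : sas_exponent alpha P X N.

Lemma exp_cev c p : brv (fun w => cev p (fun t => c * X t w)) /\
  \int[P]_w cev p (fun t => c * X t w) =
  \sum_(b <- p) b.1 * expR (- (`|c| `^ alpha * N b.2)).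
Proof.
have [mX _ Nh XE] := XN.
elim: p => [|b p [bp IH]].
  rewrite big_nil (_ : (fun w => _) = cst 0); last by apply/funext => w; rewrite /cev big_nil.
  by split; [exact: brv_cst|exact: exp_cst].
have evE w : ev b.2 (fun t => c * X t w) = ev (scale c b.2) (X^~ w).
  by rewrite ev_scale /ev big_distrr/=; apply: eq_bigr => q _; rewrite mulrCA.
have bb : brv (fun w => cos (0 + ev (scale c b.2) (X^~ w))) by exact: brv_cos_ev.
rewrite (_ : (fun w => _) = fun w => b.1 * cos (0 + ev (scale c b.2) (X^~ w)) +
    cev p (fun t => c * X t w)); last first.
  by apply/funext => w; rewrite cev_cons evE add0r.
split; first by apply: brvD => //; exact: brvZ.
by rewrite exp_add ?exp_scale//; [rewrite IH XE cos0 mul1r Nh big_cons|exact: brvZ].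
Qed.

Lemma expRN_le (y : R) : 0 <= y -> `|expR (- y) - (1 - y)| <= y ^+ 2.
Proof.
move=> y0; have h1 : 1 - y <= expR (- y) by have := expR_ge1Dx (- y); lra.
rewrite ger0_norm ?subr_ge0//.
suff : expR (- y) <= 1 - y + y ^+ 2 by lra.
have y1 : 0 < 1 + y by lra.
rewrite -(ler_pM2r y1); apply: (@le_trans _ _ 1).
  by rewrite expRN mulrC ler_pdivrMr ?expR_gt0// mul1r expR_ge1Dx.
have -> : (1 - y + y ^+ 2) * (1 + y) = 1 + y ^+ 3 by ring.
by rewrite lerDl exprn_ge0.
Qed.

(** The expectation of [cev p] along the path multiplied by a small constant
    is nonnegative, vanishes to first order, and has derivative
    [generator N p]. *)
Lemma generator_ge0 p : (forall x, 0 <= cev p x) -> cev p (fun=> 0) = 0 ->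
  0 <= generator N p.
Proof.
move=> p0; rewrite cev0 => w0; have [mX N0 Nh XE] := XN.
pose K := \sum_(b <- p) `|b.1| * N b.2 ^+ 2.
have K0 : 0 <= K by apply: sumr_ge0 => b _; rewrite mulr_ge0// exprn_ge0.
have H h : 0 < h -> 0 <= h * generator N p + h ^+ 2 * K.
  move=> h0; have [bp E] := exp_cev (h `^ alpha^-1) p.
  have : 0 <= \int[P]_w cev p (fun t => h `^ alpha^-1 * X t w) by apply: Rintegral_ge0.
  rewrite E (ger0_norm (powR_ge0 _ _)) -powRrM mulVf ?gt_eqF// powRr1 ?(ltW h0)//.
  move=> h1; apply: (le_trans h1).
  have -> : h * generator N p + h ^+ 2 * K =
      \sum_(b <- p) (b.1 * (1 - h * N b.2) + `|b.1| * (h * N b.2) ^+ 2).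
    rewrite big_split /= (eq_bigr (fun b => b.1 + (- h) * (b.1 * N b.2))); last first.
      by move=> b _; ring.
    rewrite big_split /= w0 add0r -mulr_sumr mulrN -mulNr; congr (_ + _).
    by rewrite mulr_sumr; apply: eq_bigr => b _; ring.
  apply: ler_sum => b _.
  have := expRN_le (mulr_ge0 (ltW h0) (N0 b.2)).
  move: (h * N b.2) => y; move: (expR (- y)) => x hxy.
  have : b.1 * (x - (1 - y)) <= `|b.1| * y ^+ 2.
    by apply: (le_trans (ler_norm _)); rewrite normrM ler_wpM2l.
  lra.
rewrite leNgt; apply/negP => g0.
have K1 : 0 < 2 * (K + 1) by lra.
pose h := - generator N p / (2 * (K + 1)).
have h0 : 0 < h by apply: divr_gt0 => //; lra.
have hE : h * (2 * (K + 1)) = - generator N p by rewrite /h divfK// gt_eqF.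
have := H h h0; have := mulr_ge0 (ltW h0) K0.
move: (generator N p) hE g0 => g hE g0 h1.
have -> : h * g + h ^+ 2 * K = h * (g + h * K) by ring.
by rewrite pmulr_rge0//; lra.
Qed.

End exponent_positivity.

Section domination.
Context (R : realType) (T : Type).
Variables N N1 : lincomb R T -> R.
Hypothesis positive : forall p, (forall x, 0 <= cev p x) -> cev p (fun=> 0) = 0 ->
  0 <= generator N1 p <= generator N p.

Lemma generator_le p q : (forall x, cev p x <= cev q x) ->
  cev p (fun=> 0) = cev q (fun=> 0) -> generator N1 p <= generator N1 q.
Proof.
move=> pq e.
have qp x : 0 <= cev (q ++ pscale (-1) p) x.
  by rewrite cev_cat cev_scale; have := pq x; lra.
have qp0 : cev (q ++ pscale (-1) p) (fun=> 0) = 0 by rewrite cev_cat cev_scale e; lra.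
have /andP[h _] := positive qp qp0.
by rewrite generator_cat generator_scale in h; lra.
Qed.

Context (dS : measure_display) (S : measurableType dS).
Variable mu : {measure set S -> \bar R}.
Variables (phi : S -> T -> R) (om : S -> R) (C : R).
Hypotheses (C0 : 0 < C) (om0 : forall s, 0 <= om s).
Hypothesis kernel : forall a : lincomb R T,
  mu.-integrable setT (EFin \o (fun s => (1 - cos (ev a (phi s))) * om s)) /\
  \int[mu]_s ((1 - cos (ev a (phi s))) * om s) = C * N a.

Definition weighted p s := cev p (phi s) * om s.

(** A cosine polynomial that vanishes at the zero path is a combination of the
    functions [1 - cos (ev a x)]. *)
Lemma weighted_integral p : cev p (fun=> 0) = 0 ->
  mu.-integrable setT (EFin \o weighted p) /\ \int[mu]_s weighted p s = C * generator N p.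
Proof.
rewrite cev0 => p0.
suff [h1 h2] : mu.-integrable setT (EFin \o (fun s =>
       \sum_(b <- p) (- b.1) * ((1 - cos (ev b.2 (phi s))) * om s))) /\
    \int[mu]_s (\sum_(b <- p) (- b.1) * ((1 - cos (ev b.2 (phi s))) * om s)) =
    C * generator N p.
  suff <- : (fun s => \sum_(b <- p) (- b.1) * ((1 - cos (ev b.2 (phi s))) * om s)) =
    weighted p by [].
  apply/funext => s; rewrite /weighted /cev mulr_suml.
  rewrite (eq_bigr (fun b => b.1 * cos (ev b.2 (phi s)) * om s - b.1 * om s)).
    by rewrite sumrB -[X in _ - X]mulr_suml p0 mul0r subr0.
  by move=> b _; ring.
clear p0; elim: p => [|b p [i1 i2]].
  under eq_fun do rewrite big_nil.
  rewrite /generator big_nil oppr0 mulr0 Rintegral_cst// mul0r; split => //.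
  exact: integrable0.
have [k1 k2] := kernel b.2.
have k3 : mu.-integrable setT (EFin \o (fun s => - b.1 * ((1 - cos (ev b.2 (phi s))) * om s))).
  exact: (integrableZl measurableT (- b.1) k1).
under eq_fun do rewrite big_cons.
split; first exact: (integrableD measurableT k3 i1).
rewrite RintegralD// i2 RintegralZl// k2 /generator big_cons; ring.
Qed.

(** Write [p = z u + p (1 - z / Z)^m], where [z] is a nonnegative cosine
    polynomial that bounds [p]; a cosine polynomial approximates [|u|], and the
    last term is small because [1 - z / Z < 1] wherever [p] does not vanish. *)
Lemma generator_dominated p : cev p (fun=> 0) = 0 ->
  C * generator N1 p <= \int[mu]_s `|weighted p s|.
Proof.
move=> p0.
pose z x := \sum_(b <- p) `|b.1| * (1 - cos (ev b.2 x)).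
have cz : cosp z.
  rewrite /z; elim: (p) => [|b q IH].
    by have := cosp_cst T (0 : R); congr cosp; apply/funext => x; rewrite big_nil.
  have cb : cosp (fun x => `|b.1| * (1 - cev [:: (1, b.2)] x)).
    by apply: cospZ; apply: cospB; [exact: cosp_cst|exact: cosp_cev].
  have := cospD cb IH; congr cosp; apply/funext => x.
  by rewrite big_cons cev_cons /= /cev big_nil addr0 mul1r.
have cos1 (y : R) : 0 <= 1 - cos y <= 2.
  by have := cos_le1 y; have := cos_geN1 y; lra.
pose K := \sum_(b <- p) `|b.1|.
have K0 : 0 <= K by exact: sumr_ge0.
have z0 x : 0 <= z x.
  by apply: sumr_ge0 => b _; have /andP[h _] := cos1 (ev b.2 x); rewrite mulr_ge0.
have zK x : z x <= 2 * K.
  rewrite /z /K mulr_sumr; apply: ler_sum => b _; rewrite mulrC ler_wpM2r//.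
  by have /andP[] := cos1 (ev b.2 x).
have pz x : `|cev p x| <= z x.
  have -> : cev p x = \sum_(b <- p) (- b.1) * (1 - cos (ev b.2 x)).
    rewrite (eq_bigr (fun b => b.1 * cos (ev b.2 x) - b.1)); last by move=> b _; ring.
    by rewrite sumrB -cev0 p0 subr0.
  apply: (le_trans (ler_norm_sum _ _ _)); apply: ler_sum => b _.
  have /andP[h _] := cos1 (ev b.2 x).
  by rewrite normrM normrN (ger0_norm h).
have zz0 : z (fun=> 0) = 0.
  by rewrite /z big1// => b _; rewrite ev0 cos0 subrr mulr0.
pose Z := 2 * K + 1; have Z0 : 0 < Z by rewrite /Z; lra.
pose t x := z x / Z.
have t0 x : 0 <= t x < 1.
  rewrite /t divr_ge0 ?(ltW Z0)//= ltr_pdivrMr// mul1r.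
  by have := zK x; rewrite /Z; lra.
have ct : cosp (fun x => 1 - t x).
  apply: cospB; first exact: cosp_cst.
  by have := cospZ Z^-1 cz; congr cosp; apply/funext => x; rewrite mulrC.
have tm m x : 0 <= (1 - t x) ^+ m <= 1.
  by have /andP[h1 h2] := t0 x; rewrite exprn_ge0 ?exprn_ile1//; lra.
have V m : exists2 v, cosp v & forall x, 0 <= v x <= m%:R /\ t x * v x = 1 - (1 - t x) ^+ m.
  elim: m => [|m [v cv vm]].
    exists (fun=> 0); first exact: cosp_cst.
    by move=> x; rewrite lexx mulr0 expr0 subrr.
  exists (fun x => v x + (1 - t x) ^+ m); first by apply: cospD => //; exact: cospX.
  move=> x; have [h1 h2] := vm x; have h3 := tm m x; rewrite -[m.+1%:R]natr1 exprS.
  by split; [lra|rewrite mulrDr h2; ring].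
have [zl zlE] := cz.
have zl0 : cev zl (fun=> 0) = 0 by rewrite zlE.
have [iz _] := weighted_integral zl0.
pose W m s := z (phi s) * (1 - t (phi s)) ^+ m * om s.
have cW m : cosp (fun x => z x * (1 - t x) ^+ m) by apply: cospM => //; exact: cospX.
have W0 m s : 0 <= W m s.
  by rewrite /W mulr_ge0// mulr_ge0//; have /andP[] := tm m (phi s).
have iW m : mu.-integrable setT (EFin \o W m).
  have [q qE] := cW m; have [|h _] := @weighted_integral q; first by rewrite qE zz0 mul0r.
  by move: h; rewrite (_ : weighted q = W m)//; apply/funext => s; rewrite /weighted qE.
have W_cvg : amass 1 mu (fun s => W m s - 0) @[m --> \oo] --> (0 : R).
  apply: (@amass_dominated _ _ (@ltr01 R) _ _ mu W (fun=> 0) (weighted zl)).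
  - by move=> m; have /integrableP[/measurable_EFinP] := iW m.
  - exact: measurable_cst.
  - have /integrableP[/measurable_EFinP mz _] := iz; split => //.
    rewrite (_ : (fun x => _) = fun s => `|weighted zl s|).
      exact: (integrable_norm iz).
    by apply/funext => s; rewrite powRr1.
  - move=> m s; rewrite subr0 /W /weighted zlE !normrM ler_wpM2r// ler_piMr//.
    by have /andP[h1 h2] := tm m (phi s); rewrite ger0_norm.
  - apply: aeW => s; rewrite /W.
    have [zs|zs] := eqVneq (z (phi s)) 0.
      by under eq_fun do rewrite zs !mul0r; exact: cvg_cst.
    rewrite -(mul0r (om s)) -(mulr0 (z (phi s))); apply: cvgM; last exact: cvg_cst.
    apply: cvgM; first exact: cvg_cst.
    apply: cvg_expr; have /andP[h1 h2] := t0 (phi s).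
    have h3 : 0 < t (phi s) by rewrite divr_gt0// lt_neqAle eq_sym zs z0.
    by rewrite ger0_norm; lra.
have W_le m : \int[mu]_s W m s = amass 1 mu (fun s => W m s - 0).
  by apply: eq_Rintegral => s _; rewrite subr0 powRr1// ger0_norm.
have [ip _] := weighted_integral p0.
have ip1 : mu.-integrable setT (EFin \o (fun s => `|weighted p s|)) by exact: (integrable_norm ip).
have main m e : 0 < e -> C * generator N1 p <=
    \int[mu]_s `|weighted p s| + e * \int[mu]_s weighted zl s + \int[mu]_s W m s.
  move=> e0; have [v cv vE] := V m.
  pose u x := cev p x / Z * v x.
  have cu : cosp u.
    apply: cospM => //; have := cospZ Z^-1 (cosp_cev p).
    by congr cosp; apply/funext => x; rewrite mulrC.
  have um x : `|u x| <= m.+1%:R.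
    have [/andP[h1 h2] _] := vE x; rewrite /u normrM (ger0_norm h1) -[leRHS]mul1r.
    apply: ler_pM => //; last by apply: (le_trans h2); rewrite ler_nat.
    rewrite normrM normfV (gtr0_norm Z0) ler_pdivrMr// mul1r.
    by apply: (le_trans (pz x)); apply: (le_trans (zK x)); rewrite /Z; lra.
  have [q cq qE] := cosp_abs cu (ltr0Sn R m) e0 um.
  have [D DE] : cosp (fun x => z x * (q x + e) + z x * (1 - t x) ^+ m).
    apply: cospD => //; apply: cospM => //; apply: cospD => //; exact: cosp_cst.
  have D0 : cev D (fun=> 0) = 0 by rewrite DE zz0 !mul0r addr0.
  have zu x : z x * u x = cev p x * (1 - (1 - t x) ^+ m).
    have [_ <-] := vE x; rewrite /u /t; have Zn : Z != 0 by rewrite gt_eqF.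
    by field.
  have pD x : cev p x <= cev D x.
    have -> : cev p x = z x * u x + cev p x * (1 - t x) ^+ m by rewrite zu; ring.
    rewrite DE; apply: lerD.
      by apply: ler_wpM2l => //; have := qE x; have := ler_norm (u x); lra.
    apply: ler_wpM2r; first by have /andP[] := tm m x.
    exact: le_trans (ler_norm _) (pz x).
  have Dp x : cev D x <= `|cev p x| + e * z x + z x * (1 - t x) ^+ m.
    rewrite DE mulrDr lerD2r [z x * e]mulrC lerD2r.
    have /andP[_ h] := qE x; apply: (@le_trans _ _ (z x * `|u x|)).
      exact: ler_wpM2l.
    rewrite -[z x](ger0_norm (z0 x)) -normrM zu normrM ler_piMr//.
    by have /andP[h1 h2] := tm m x; rewrite ger0_norm; lra.
  have D1 x : 0 <= cev D x.
    rewrite DE; apply: addr_ge0; apply: mulr_ge0 => //; last by have /andP[] := tm m x.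
    by have := qE x; have := normr_ge0 (u x); lra.
  have [iD ED] := weighted_integral D0.
  apply: (@le_trans _ _ (\int[mu]_s weighted D s)).
    rewrite ED; apply: ler_wpM2l; first exact: ltW.
    apply: (le_trans (generator_le pD _)); first by rewrite p0 D0.
    by have /andP[] := positive D1 D0.
  have iez : mu.-integrable setT (EFin \o (fun s => e * weighted zl s)).
    exact: (integrableZl measurableT e iz).
  have i12 : mu.-integrable setT (EFin \o (fun s => `|weighted p s| + e * weighted zl s)).
    exact: (integrableD measurableT ip1 iez).
  rewrite -RintegralZl// -RintegralD// -RintegralD//.
  apply: le_Rintegral => //; first exact: (integrableD measurableT i12 (iW m)).
  move=> s _; rewrite /weighted /W zlE normrM (ger0_norm (om0 s)) mulrA -!mulrDl.
  by apply: ler_wpM2r.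
apply/ler_addgt0Pr => e e0.
pose I := \int[mu]_s weighted zl s.
have I0 : 0 <= I.
  by apply: Rintegral_ge0 => s _; rewrite /weighted zlE mulr_ge0.
have e1 : 0 < e / 2 / (I + 1) by rewrite !divr_gt0//; lra.
have e2 : 0 < e / 2 by rewrite divr_gt0.
have /cvgrPdist_le /(_ _ e2) [m _ /(_ m (leqnn m))] := W_cvg.
rewrite sub0r normrN ger0_norm ?amass_ge0// -W_le => hm.
apply: (le_trans (main m _ e1)); rewrite -addrA lerD2l [leRHS](splitr e) lerD//.
rewrite -/I; have h : e / 2 / (I + 1) * (I + 1) = e / 2 by rewrite divfK// gt_eqF; lra.
by rewrite -[leRHS]h ler_wpM2l ?(ltW e1)//; lra.
Qed.

End domination.

(** * The scale kernel *)

(** Integration against [e^(- alpha w) dw] over all dilations [e^w] turns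
    [1 - cos] into a constant multiple of the power [alpha]. *)
Section scale_kernel.
Context (R : realType) (alpha : R) (alpha0 : 0 < alpha) (alpha2 : alpha < 2).
Local Notation leb := (@lebesgue_measure R).

Definition wave (y w : R) : R := (1 - cos (expR w * y)) * expR (- (alpha * w)).

Lemma cos_le1_sub (y : R) : 0 <= 1 - cos y <= 2.
Proof. by have := cos_le1 y; have := cos_geN1 y; lra. Qed.

Lemma wave_ge0 y w : 0 <= wave y w.
Proof. by apply: mulr_ge0; [have /andP[] := cos_le1_sub (expR w * y)|exact: expR_ge0]. Qed.

Lemma measurable_dilation (c : R) : measurable_fun setT (fun w : R => expR (c * w)).
Proof.
apply: measurableT_comp; first exact: measurable_expR.
by apply: measurable_funM; [exact: measurable_cst|exact: measurable_id].
Qed.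

Lemma measurable_wave y : measurable_fun setT (wave y).
Proof.
apply: measurable_funM; last first.
  by under eq_fun do rewrite -mulNr; exact: measurable_dilation.
apply: measurable_funB; first exact: measurable_cst.
apply: measurableT_comp; first exact: continuous_measurable_fun (@continuous_cos R).
apply: measurable_funM; last exact: measurable_cst.
exact: measurable_expR.
Qed.

Lemma cos_half (y : R) : cos y = 1 - 2 * sin (y / 2) ^+ 2.
Proof.
rewrite {1}(_ : y = (y / 2) *+ 2); last by rewrite -mulr_natr divfK.
by rewrite cos_mulr2n cos2sin2; ring.
Qed.

Lemma one_sub_cos_le (y : R) : 1 - cos y <= y ^+ 2.
Proof.
rewrite cos_half; have := sin_lipschitz0 (y / 2); move: (sin _) => s.
rewrite -ler_sqr ?nnegrE// !real_normK ?num_real// => h.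
have := sqr_ge0 y; have : (y / 2) ^+ 2 = y ^+ 2 / 4 by field.
lra.
Qed.

Lemma expR_tail_fin (b : R) : 0 < b ->
  (\int[leb]_(w in `[0%R, +oo[) (expR (- (b * w)))%:E < +oo)%E.
Proof.
move=> b0; have h := integral_exponential_pdf b0.
have m1 : measurable_fun setT (EFin \o exponential_pdf b).
  by apply/measurable_EFinP; exact: measurable_exponential_pdf.
have m2 : measurable_fun setT (fun w => (b^-1 * exponential_pdf b w)%:E).
  apply/measurable_EFinP; apply: measurable_funM; first exact: measurable_cst.
  exact: measurable_exponential_pdf.
have p0 w : 0 <= exponential_pdf b w by apply: exponential_pdf_ge0; exact: ltW.
apply: (@le_lt_trans _ _ (\int[leb]_w (b^-1 * exponential_pdf b w)%:E)%E); last first.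
  under eq_integral do rewrite EFinM.
  rewrite ge0_integralZl_EFin ?h ?mule1 ?ltry//; first by move=> w _; rewrite lee_fin.
  by rewrite invr_ge0 ltW.
have -> : (\int[leb]_(w in `[0%R, +oo[) (expR (- (b * w)))%:E =
    \int[leb]_(w in `[0%R, +oo[) (b^-1 * exponential_pdf b w)%:E)%E.
  apply: eq_integral => w; rewrite inE /= in_itv/= andbT => w0.
  by rewrite exponential_pdfE// mulNr mulKf// gt_eqF.
by apply: ge0_subset_integral => // w _; rewrite lee_fin mulr_ge0// invr_ge0 ltW.
Qed.

(** Near [+oo] the factor [1 - cos] is bounded, and near [-oo] it is at most
    [e^(2 w)], which beats [e^(- alpha w)] since [alpha < 2]. *)
Lemma integral_wave_fin : (\int[leb]_w (wave 1 w)%:E < +oo)%E.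
Proof.
have mw := measurable_wave 1.
have mI : measurable (`]-oo, (-0)%R] : set (measurableTypeR R)) by exact: measurable_itv.
rewrite -(setUv (`]-oo, (-0)%R] : set (measurableTypeR R))) ge0_integral_setU//; last 4 first.
- exact: measurableC.
- by apply: measurable_funTS; exact/measurable_EFinP.
- by move=> w _; rewrite lee_fin wave_ge0.
- exact/disj_setPCl.
apply: lte_add_pinfty.
  pose G (w : R) := expR ((2 - alpha) * w).
  have mG : measurable_fun setT G by exact: measurable_dilation.
  apply: (@le_lt_trans _ _ (\int[leb]_(w in `]-oo, (-0)%R]) (G w)%:E)%E).
    apply: ge0_le_integral => //.
    + by move=> w _; rewrite lee_fin wave_ge0.
    + by apply: measurable_funTS; exact/measurable_EFinP.
    + by apply: measurable_funTS; exact/measurable_EFinP.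
    move=> w _; rewrite lee_fin /wave /G mulr1.
    rewrite (_ : (2 - alpha) * w = w + w - alpha * w); last by ring.
    rewrite expRD [expR (w + w)]expRD; apply: ler_wpM2r; first exact: expR_ge0.
    by have := one_sub_cos_le (expR w); rewrite expr2.
  rewrite ge0_integration_by_substitutionNy.
  - have h2 : 0 < 2 - alpha by rewrite subr_gt0.
    apply: le_lt_trans (expR_tail_fin h2).
    rewrite le_eqVlt; apply/orP; left; apply/eqP.
    by apply: eq_integral => w _; rewrite /= /G mulrN.
  - apply: continuous_subspaceT => w; rewrite /G.
    apply: continuous_comp; last exact: continuous_expR.
    by apply: cvgM; [exact: cvg_cst|exact: cvg_id].
  - by move=> w _; exact: expR_ge0.
have m2 : measurable_fun setT (fun w : R => (2 * expR (- (alpha * w)))%:E).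
  apply/measurable_EFinP; apply: measurable_funM; first exact: measurable_cst.
  by under eq_fun do rewrite -mulNr; exact: measurable_dilation.
apply: (@le_lt_trans _ _ (\int[leb]_(w in `[0%R, +oo[) (2 * expR (- (alpha * w)))%:E)%E); last first.
  under eq_integral do rewrite EFinM.
  rewrite ge0_integralZl_EFin//.
  - by rewrite lte_mul_pinfty//; exact: expR_tail_fin.
  - apply: measurable_funTS; apply/measurable_EFinP.
    by under eq_fun do rewrite -mulNr; exact: measurable_dilation.
apply: (@le_trans _ _ (\int[leb]_(w in ~` `]-oo, (-0)%R]) (2 * expR (- (alpha * w)))%:E)%E).
  apply: ge0_le_integral => //.
  - exact: measurableC.
  - by move=> w _; rewrite lee_fin wave_ge0.
  - by apply: measurable_funTS; exact/measurable_EFinP.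
  - exact: measurable_funTS.
  - move=> w _; rewrite lee_fin /wave ler_wpM2r ?expR_ge0//.
    by have /andP[] := cos_le1_sub (expR w * 1).
apply: ge0_subset_integral => //.
- exact: measurableC.
- exact: measurable_funTS.
- by move=> w /=; rewrite !in_itv/= andbT => /negP; rewrite -ltNge oppr0 => /ltW.
Qed.

Definition wave_const : R := fine (\int[leb]_w (wave 1 w)%:E)%E.

Lemma wave_constE : (\int[leb]_w (wave 1 w)%:E = wave_const%:E)%E.
Proof.
rewrite /wave_const fineK// ge0_fin_numE ?integral_wave_fin//.
by apply: integral_ge0 => w _; rewrite lee_fin wave_ge0.
Qed.

(** The integrand is bounded below on a small interval to the left of [0]. *)
Lemma wave_const_gt0 : 0 < wave_const.
Proof.
rewrite -lte_fin -wave_constE.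
pose dl : R := (1 - cos 1) / 2.
have d0 : 0 < dl.
  have s0 : 0 < sin (1 / 2 : R).
    by apply: sin_gt0_pihalf; have := pihalf_ge1 R; lra.
  by rewrite /dl cos_half; have := mulr_gt0 s0 s0; rewrite -expr2; lra.
have mI : measurable (`[- dl, 0%R] : set (measurableTypeR R)) by exact: measurable_itv.
apply: (@lt_le_trans _ _ (\int[leb]_w (dl * \1_(`[- dl, 0%R] : set R) w)%:E)%E).
  under eq_integral do rewrite EFinM.
  rewrite ge0_integralZl_EFin//; last 2 first.
  - by apply/measurable_EFinP; exact: measurable_indic.
  - exact: ltW.
  have E : leb `[- dl, 0%R] = dl%:E.
    by rewrite lebesgue_measure_itv/= lte_fin oppr_lt0 d0 -EFinB sub0r opprK.
  rewrite integral_indic// setIT [X in (_ * X)%E](_ : _ = dl%:E)//.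
  by rewrite -EFinM lte_fin mulr_gt0.
apply: ge0_le_integral => //.
- by move=> w _; rewrite lee_fin mulr_ge0// ltW.
- apply/measurable_EFinP; apply: measurable_funM; first exact: measurable_cst.
  exact: measurable_indic.
- by apply/measurable_EFinP; exact: measurable_wave.
move=> w _; rewrite lee_fin indicE.
have [|_] := boolP (w \in _); last by rewrite mulr0 wave_ge0.
rewrite inE /= in_itv/= mulr1 => /andP[w1 w2].
have e1 : 1 + w <= expR w by exact: expR_ge1Dx.
have e2 : expR w <= 1 by rewrite -expR0 ler_expR.
have h : dl <= 1 - cos (expR w).
  have : cos (expR w) - cos 1 <= 1 - expR w.
    apply: (le_trans (ler_norm _)); apply: (le_trans (cos_lipschitz _ _)).
    by rewrite ler0_norm; lra.
  rewrite /dl; have : expR w >= 1 - dl by lra.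
  rewrite /dl; lra.
rewrite /wave mulr1 -[leLHS]mulr1; apply: ler_pM => //; first exact: ltW.
rewrite -expR0 ler_expR oppr_ge0; apply: mulr_ge0_le0 => //; exact: ltW.
Qed.

Lemma ge0_integral_Rd_cons d (F : Rd R d.+1 -> \bar R) : measurable_fun setT F ->
  (forall u, (0 <= F u)%E) ->
  (\int[lebesgue_Rd R d.+1]_u F u =
   \int[lebesgue_Rd R d]_s \int[leb]_w F (consRd (w, s)))%E.
Proof.
move=> mF F0; have mc := @measurable_consRd R d.
have := @ge0_integral_pushforward _ _ _ _ _ _ mc (leb \x lebesgue_Rd R d)%E setT F
  measurableT mF (fun y _ => F0 y).
rewrite preimage_setT (fubini_tonelli2 (F \o @consRd R d) (measurableT_comp mF mc)
  (fun p => F0 (consRd p))) => E.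
exact: E.
Qed.

Lemma ge0_integral_translate (c : R) (f : R -> \bar R) : measurable_fun setT f ->
  (forall w, (0 <= f w)%E) -> (\int[leb]_w f (c + w)%R = \int[leb]_w f w)%E.
Proof.
move=> mf f0.
have H (h : R -> \bar R) : measurable_fun setT h -> (forall w, (0 <= h w)%E) ->
    (\int[lebesgue_Rd R 1]_u h (tnth u ord0) = \int[leb]_w h w)%E.
  move=> mh h0; rewrite (ge0_integral_Rd_cons (F := fun u => h (tnth u ord0)))//; last first.
    by apply: measurableT_comp => //; exact: measurable_tnth.
  rewrite (eq_integral (cst (\int[leb]_w h w)%E)); last first.
    by move=> s _; apply: eq_integral => w _.
  rewrite integral_dirac//.
  by rewrite [X in (X * _)%E](_ : _ = 1%E) ?mul1e// diracE mem_set.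
have mc : measurable_fun setT (fun w : R => f (c + w)).
  apply: (measurableT_comp mf).
  by apply: measurable_funD; [exact: measurable_cst|exact: measurable_id].
rewrite -!H//.
rewrite -(ge0_integral_addRd ([tuple c] : Rd R 1) (f := fun u => f (tnth u ord0)))//; last first.
  by apply: (measurableT_comp mf); exact: measurable_tnth.
by apply: eq_integral => u _; rewrite tnth_addRd.
Qed.

(** A dilation by [|y|] is a translation of [w] by [ln |y|]. *)
Lemma integral_wave y : (\int[leb]_w (wave y w)%:E = (wave_const * `|y| `^ alpha)%:E)%E.
Proof.
have [->|y0] := eqVneq y 0.
  rewrite normr0 powR0 ?gt_eqF// mulr0 (_ : (fun w => _) = cst 0%E) ?integral0//.
  by apply/funext => w; rewrite /wave mulr0 cos0 subrr mul0r.
have n0 : 0 < `|y| by rewrite normr_gt0.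
have E w : wave y w = `|y| `^ alpha * wave 1 (ln `|y| + w).
  rewrite /wave mulr1 expRD lnK ?posrE// [`|y| * expR w]mulrC.
  have -> : cos (expR w * `|y|) = cos (expR w * y).
    by case: (ger0P y) => // _; rewrite mulrN cosN.
  rewrite mulrCA; congr (_ * _).
  rewrite mulrDr opprD expRD mulrA /powR gt_eqF// -expRD.
  by rewrite subrr expR0 mul1r.
under eq_integral do rewrite E EFinM.
have mw : measurable_fun setT (fun w : R => (wave 1 w)%:E).
  by apply/measurable_EFinP; exact: measurable_wave.
have mlw : measurable_fun setT (fun w : R => (wave 1 (ln `|y| + w))%:E).
  apply: (measurableT_comp mw).
  by apply: measurable_funD; [exact: measurable_cst|exact: measurable_id].
rewrite ge0_integralZl_EFin ?powR_ge0//; last by move=> w _; rewrite lee_fin wave_ge0.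
rewrite (ge0_integral_translate _ mw); last by move=> w; rewrite lee_fin wave_ge0.
by rewrite wave_constE -EFinM mulrC.
Qed.

End scale_kernel.

(** * Moving averages are indecomposable *)

Section moving_average.
Context (R : realType) (alpha : R) (alpha0 : 0 < alpha) (alpha2 : alpha < 2) (d : nat).
Local Notation lam := (lebesgue_Rd R d).
Local Notation lam1 := (lebesgue_Rd R d.+1).
Variable g : Rd R d -> R.
Hypothesis Lg : inLp alpha lam g.
Implicit Types (u v : Rd R d.+1) (a b : lincomb R (Rd R d))
  (p : seq (R * lincomb R (Rd R d))).

Definition hd u : R := tnth u ord0.
Definition tl u : Rd R d := [tuple tnth u (lift ord0 i) | i < d].

Definition ma_exponent a := amass alpha lam (fun s => ev a (fun t => g (addRd t s))).

(** The pairs [u = (w, s)] parametrise the positive multiples of translates of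
    [g]. Under [density] these paths carry the Levy measure of the moving
    average, up to symmetrisation and a constant. *)
Definition dilated_path u t := expR (hd u) * g (addRd t (tl u)).
Definition density u := expR (- (alpha * hd u)).

Local Notation wt := (weighted dilated_path density).

Lemma hd_cons w (s : Rd R d) : hd (consRd (w, s)) = w.
Proof. by []. Qed.

Lemma tl_cons w (s : Rd R d) : tl (consRd (w, s)) = s.
Proof. by apply: eq_from_tnth => i; rewrite tnth_mktuple tnthS. Qed.

Lemma hdD v u : hd (addRd v u) = hd v + hd u.
Proof. exact: tnth_addRd. Qed.

Lemma tlD v u : tl (addRd v u) = addRd (tl v) (tl u).
Proof. by apply: eq_from_tnth => i; rewrite !(tnth_addRd, tnth_mktuple). Qed.

Lemma ev_dilated a u : ev a (dilated_path u) =
  expR (hd u) * ev a (fun t => g (addRd t (tl u))).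
Proof.
by rewrite /ev big_distrr /=; apply: eq_bigr => p _; rewrite mulrCA.
Qed.

Lemma inLp_ma a : inLp alpha lam (fun s => ev a (fun t => g (addRd t s))).
Proof. by apply: inLp_ev => // t; exact: inLp_addRd. Qed.

Lemma measurable_hd : measurable_fun setT hd.
Proof. exact: measurable_tnth. Qed.

Lemma measurable_tl : measurable_fun setT tl.
Proof.
apply/measurable_fun_tnthP => i; rewrite /comp.
by under eq_fun do rewrite tnth_mktuple; exact: measurable_tnth.
Qed.

Lemma dilated_kernel a :
  lam1.-integrable setT (EFin \o (fun u => (1 - cos (ev a (dilated_path u))) * density u)) /\
  \int[lam1]_u ((1 - cos (ev a (dilated_path u))) * density u) =
    wave_const alpha * ma_exponent a.
Proof.
pose h s := ev a (fun t => g (addRd t s)); have [mh ih] := inLp_ma a.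
rewrite -/h in mh ih.
have E u : (1 - cos (ev a (dilated_path u))) * density u = wave alpha (h (tl u)) (hd u).
  by rewrite ev_dilated.
under eq_fun do rewrite E.
have mw : measurable_fun setT (fun u => wave alpha (h (tl u)) (hd u)).
  apply: measurable_funM; last first.
    under eq_fun do rewrite -mulNr.
    exact: (measurableT_comp (measurable_dilation (- alpha)) measurable_hd).
  apply: measurable_funB; first exact: measurable_cst.
  apply: measurableT_comp; first exact: continuous_measurable_fun (@continuous_cos R).
  apply: measurable_funM; last exact: (measurableT_comp mh measurable_tl).
  exact: (measurableT_comp (@measurable_expR R) measurable_hd).
have I : (\int[lam1]_u (wave alpha (h (tl u)) (hd u))%:E =
    (wave_const alpha * ma_exponent a)%:E)%E.
  rewrite (ge0_integral_Rd_cons (F := fun u => (wave alpha (h (tl u)) (hd u))%:E)); last 2 first.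
  - exact/measurable_EFinP.
  - by move=> u; rewrite lee_fin wave_ge0.
  under eq_integral do under eq_integral do rewrite hd_cons tl_cons.
  under eq_integral do rewrite (integral_wave alpha0 alpha2) EFinM.
  rewrite ge0_integralZl_EFin//; last 2 first.
  - by apply/measurable_EFinP; exact: measurable_apow.
  - by apply/ltW; exact: wave_const_gt0.
  by rewrite (amassE (inLp_ma a)) EFinM.
split; last by rewrite /Rintegral I.
apply/integrableP; split; first exact/measurable_EFinP.
under eq_integral do rewrite /= ger0_norm ?wave_ge0//.
by rewrite I ltry.
Qed.

(** The action on cosine polynomials that corresponds to a translation of the
    pair [(w, s)]. *)
Definition move v p := [seq (expR (- (alpha * hd v)) * q.1,
  scale (expR (hd v)) (translate (tl v) q.2)) | q <- p].

Lemma weighted_move v p u : wt (move v p) u = wt p (addRd v u).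
Proof.
have E q : cos (ev (scale (expR (hd v)) (translate (tl v) q)) (dilated_path u)) =
    cos (ev q (dilated_path (addRd v u))).
  rewrite ev_scale ev_translate /ev big_distrr /=; congr cos; apply: eq_bigr => b _.
  by rewrite /dilated_path hdD tlD expRD addRdA; ring.
rewrite /weighted /cev big_map (eq_bigr (fun q =>
  expR (- (alpha * hd v)) * (q.1 * cos (ev q.2 (dilated_path (addRd v u)))))).
  by rewrite -big_distrr /= /density hdD mulrDr opprD expRD; ring.
by move=> q _ /=; rewrite E mulrA.
Qed.

Lemma half_translate_weighted v p :
  half_translate v (wt p) = wt (pscale 2^-1 (p ++ move v p)).
Proof.
apply/funext => u; rewrite /half_translate -weighted_move /weighted.
by rewrite cev_scale cev_cat; ring.
Qed.

Section functional.
Variable N1 : lincomb R (Rd R d) -> R.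
Hypothesis N1_scale : forall c a, N1 (scale c a) = `|c| `^ alpha * N1 a.
Hypothesis N1_translate : forall h a, N1 (translate h a) = N1 a.
Hypothesis positive : forall p, (forall x, 0 <= cev p x) -> cev p (fun=> 0) = 0 ->
  0 <= generator N1 p <= generator ma_exponent p.

Lemma generator_move v p : generator N1 (move v p) = generator N1 p.
Proof.
rewrite /generator big_map; congr (- _); apply: eq_bigr => q _ /=.
rewrite N1_scale N1_translate ger0_norm ?expR_ge0// /powR gt_eqF ?expR_gt0// expRK.
have En : expR (alpha * hd v) != 0 by rewrite gt_eqF ?expR_gt0.
by rewrite expRN; field.
Qed.

Lemma average_weighted l p : cev p (fun=> 0) = 0 -> exists q,
  [/\ average l (wt p) = wt q, cev q (fun=> 0) = 0 & generator N1 q = generator N1 p].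
Proof.
move=> p0; elim: l => [|v l [q [E q0 qN]]]; first by exists p.
exists (pscale 2^-1 (q ++ move v q)); split.
- by rewrite /= E half_translate_weighted.
- rewrite cev_scale cev_cat q0 cev0 big_map -mulr_sumr -cev0 q0; ring.
- by rewrite generator_scale generator_cat generator_move qN; field.
Qed.

(** The averages of [wt p] tend to [0] in mean when its integral vanishes,
    whereas averaging does not change the value of the functional at [p]. *)
Lemma generator_kernel p : cev p (fun=> 0) = 0 -> generator ma_exponent p = 0 ->
  generator N1 p = 0.
Proof.
move=> p0 gp0; have C0 := wave_const_gt0 alpha0 alpha2.
have [ip Ip] := weighted_integral dilated_kernel p0.
have Lp : inLp 1 lam1 (wt p).
  have /integrableP[/measurable_EFinP mp _] := ip; split => //.
  rewrite (_ : (fun x => _) = fun u => `|wt p u|); first exact: (integrable_norm ip).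
  by apply/funext => u; rewrite powRr1.
have Ip0 : \int[lam1]_u wt p u = 0 by rewrite Ip gp0 mulr0.
have [_ Ap] := mean_zero_averages_out Lp Ip0.
have dens0 u : 0 <= density u by exact: expR_ge0.
have H q : cev q (fun=> 0) = 0 -> wave_const alpha * generator N1 q <= L1mass (wt q).
  move=> q0; apply: (le_trans (generator_dominated positive C0 dens0 dilated_kernel q0)).
  rewrite L1massE le_eqVlt; apply/orP; left; apply/eqP.
  by apply: eq_Rintegral => u _; rewrite powRr1.
have absH : wave_const alpha * `|generator N1 p| <= 0.
  apply/ler_addgt0Pr => e e0; rewrite add0r.
  have [l le] := Ap e e0; have [q [E q0 <-]] := average_weighted l p0.
  rewrite E in le; apply: le_trans le.
  have [h|h] := leP 0 (generator N1 q); first by rewrite ger0_norm//; exact: H.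
  rewrite ltr0_norm//; have := H (pscale (-1) q).
  rewrite cev_scale q0 mulr0 generator_scale mulN1r => /(_ erefl).
  rewrite !L1massE => /le_trans; apply; rewrite le_eqVlt; apply/orP; left; apply/eqP.
  by apply: eq_Rintegral => u _; rewrite /weighted cev_scale mulN1r mulNr normrN.
apply/eqP; rewrite -normr_le0; rewrite pmulr_rle0// in absH.
Qed.

Lemma exponent_nil (N : lincomb R (Rd R d) -> R) :
  (forall c a, N (scale c a) = `|c| `^ alpha * N a) -> N [::] = 0.
Proof. by move=> /(_ 0 [::]); rewrite normr0 powR0 ?gt_eqF// mul0r. Qed.

Lemma proportional_exponent a b : N1 a * ma_exponent b = ma_exponent a * N1 b.
Proof.
pose N := ma_exponent.
have N0 : N [::] = 0.
  by rewrite /N /ma_exponent; under eq_fun do rewrite ev_nil; exact: amass0.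
suff H x y : N a = x -> N b = y -> N1 a * y = x * N1 b by exact: H.
move=> ax y_b.
(* The functional of the moving average vanishes at [p], and the constant term
   makes [p] vanish at the zero path. *)
pose p := [:: (- y, a); (x, b); (y - x, [::])].
have p0 : cev p (fun=> 0) = 0 by rewrite cev0 !big_cons big_nil /=; ring.
have := generator_kernel p0; rewrite /generator !big_cons !big_nil /= -/N.
rewrite N0 (exponent_nil N1_scale) ax y_b.
have -> : - (- y * x + (x * y + ((y - x) * 0 + 0))) = 0 by ring.
move=> /(_ erefl); move: (N1 a) (N1 b) => m k h.
have -> : m * y = x * k + - (- y * m + (x * k + ((y - x) * 0 + 0))) by ring.
by rewrite h addr0.
Qed.

End functional.

(** The exponent of a component satisfies the hypotheses of
    [proportional_exponent]: it is homogeneous, invariant under time shifts, and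
    on nonnegative polynomials the other components only increase the
    functional of the sum. *)
Theorem moving_average_indecomposable dO (O : measurableType dO) (P : probability O R)
    (X : Rd R d -> {RV P >-> R}) :
  integral_representation alpha X lam (fun t s => g (addRd t s)) ->
  indecomposable alpha X.
Proof.
move=> rX dQ OQ Q _ [n [Y [k [[SY sY iY XY] ->]]]].
pose N := ma_exponent.
have NX : sas_exponent alpha P X N by exact: integral_representation_exponent rX.
have [NY YN] := choice (fun j => SaS_process_exponent (SY j)).
have NS : N =1 fun a => \sum_(j < n) NY j a.
  apply: (exponent_unique NX); apply: (fdd_eq_exponent _ XY).
    by move=> t; exact: measurable_funPT.
  exact: independent_exponent_sum.
have [mY N0 Nh YE] := YN k.
have Nle a : NY k a <= N a.
  rewrite NS (bigD1 k)//= lerDl; apply: sumr_ge0 => j _.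
  by have [_ h _ _] := YN j.
have pos p : (forall x, 0 <= cev p x) -> cev p (fun=> 0) = 0 ->
    0 <= generator (NY k) p <= generator N p.
  move=> p0 w0; have G j := generator_ge0 alpha0 (YN j) p0 w0.
  have -> : generator N p = \sum_(j < n) generator (NY j) p.
    rewrite /generator sumrN exchange_big /=; congr (- _); apply: eq_bigr => q _.
    by rewrite NS mulr_sumr.
  by rewrite G (bigD1 k)//= lerDl sumr_ge0.
have prop a b : NY k a * N b = N a * NY k b.
  exact: (proportional_exponent Nh (stationary_exponent (YN k) (sY k)) pos).
have [c cN] : exists c : R, NY k = fun a => `|c| `^ alpha * N a.
  have [[b Nb]|no] := pselect (exists b, N b != 0).
    exists ((NY k b / N b) `^ alpha^-1); apply/funext => a.
    have [_ Nge _ _] := NX.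
    rewrite (ger0_norm (powR_ge0 _ _)) -powRrM mulVf ?gt_eqF// powRr1; last first.
      by rewrite divr_ge0.
    by rewrite mulrAC [NY k b * _]mulrC -prop mulfK.
  exists 0; apply/funext => a; rewrite normr0 powR0 ?gt_eqF// mul0r.
  apply/eqP; rewrite eq_le N0 andbT; apply: (le_trans (Nle a)).
  by have [->//|Na] := eqVneq (N a) 0; case: no; exists a.
have ZN := YN k; rewrite cN in ZN.
exists c; exact: (exponent_fdd_eq ZN (exponent_scale c NX)).
Qed.

End moving_average.

(** * The characterisation *)

Theorem corollary3p2 (R : realType) (alpha : R) (halpha0 : 0 < alpha)
    (halpha2 : alpha < 2) (d : nat)
    (dO : measure_display) (O : measurableType dO) (P : probability O R)
    (X : Rd R d -> {RV P >-> R})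
    (dV : measure_display) (V : measurableType dV) (hV : standard_borel R V)
    (nu : probability V R) (f : Rd R d * V -> R)
    (hf : f \in Lfun (lebesgue_Rd R d \x nu)%E alpha%:E)
    (hXsas : SaS_process alpha X)
    (hX : integral_representation alpha X (lebesgue_Rd R d \x nu)%E
            (fun t sv => f (addRd t sv.1, sv.2))) :
  indecomposable alpha X <->
  exists2 g : Rd R d -> R, g \in Lfun (lebesgue_Rd R d) alpha%:E &
    integral_representation alpha X (lebesgue_Rd R d)
      (fun t s => g (addRd t s)).
Proof.
have Lf : inLp alpha (lebesgue_Rd R d \x nu)%E f by exact/(inLp_Lfun halpha0).
split=> [iX|[g gL rX]].
  have [g Lg rg] := indecomposable_moving_average halpha0 halpha2 Lf hX iX.
  by exists g => //; exact/(inLp_Lfun halpha0).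
apply: (moving_average_indecomposable halpha0 halpha2 _ rX).
exact/(inLp_Lfun halpha0).
Qed.
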